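(* A state $\rho=(\rho_n)_n$ is weak Solovay random if and only if for every $\epsilon>0$ and every $c>0$ there is $n_0$ such that for all $n\ge n_0$, $QK^{\epsilon}(\rho_n)\ge n+c$.
   Context: Let $\mathbb{U}$ be a fixed universal prefix-free Turing machine and $K$ the associated prefix-free Kolmogorov complexity. Finite sets of vectors with complex algebraic entries are coded by natural numbers via a fixed canonical effective indexing; $\mathbb{U}(\sigma)\downarrow=F$ means that $\mathbb{U}$ on input $\sigma$ halts and outputs the code of $F$. $\mathbb{C}^{2^n}_{alg}$ denotes the set of vectors in $\mathbb{C}^{2^n}$ all of whose entries are complex algebraic numbers. All logarithms are base 2. For a density matrix $\tau$ on $\mathbb{C}^{2^{n}}$ write $|\tau|=n$. For $\epsilon>0$ define $QK^{\epsilon}(\tau)=\inf\{|\sigma|+\log|F| : \mathbb{U}(\sigma)\downarrow=F,\ F \text{ an orthonormal subset of } \mathbb{C}^{2^{|\tau|}}_{alg},\ \sum_{v\in F}\langle v|\tau|v\rangle>\epsilon\}$, with $\inf\emptyset=\infty$. A state is a sequence $\rho=(\rho_n)_{n\in\mathbb{N}}$ where each $\rho_n$ is a density matrix on $\mathbb{C}^{2^n}$ and, for all $n\ge1$, the partial trace of $\rho_n$ over the last qubit equals $\rho_{n-1}$. A special projection is a Hermitian projection matrix with complex algebraic entries (these can be effectively coded by natural numbers, so computable sequences of them make sense). For a special projection $S$ on $\mathbb{C}^{2^n}$ put $\tau(S)=2^{-n}\operatorname{Tr}(S)$ and, for a state $\rho$, $\rho(S)=\operatorname{Tr}(\rho_nS)$.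 A strong Solovay test is a computable sequence $(S^m)_m$ of special projections with $\sum_m\tau(S^m)<\infty$. A state $\rho$ fails $(S^m)_m$ at level $\epsilon>0$ if $\rho(S^m)>\epsilon$ for infinitely many $m$; it passes the test if it fails it at no $\epsilon>0$. A state is weak Solovay random if it passes every strong Solovay test. *)

(* Defs.v *)
From HB Require Import structures.
From mathcomp Require Import all_boot all_order all_algebra.
From mathcomp Require Import complex.
From mathcomp Require Import all_classical all_reals all_analysis.
From mathcomp Require Import zify.

Set Implicit Arguments.
Unset Strict Implicit.
Unset Printing Implicit Defensive.

Import Order.TTheory GRing.Theory Num.Theory.

(* Syntax of mu-recursive function terms (arity is handled loosely:
   every term acts on an argument list). *)
Inductive recf : Type :=
| RZero : recf
| RSucc : recf
| RProj : nat -> recf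
| RComp : recf -> seq recf -> recf
| RPrec : recf -> recf -> recf
| RMu : recf -> recf.

Inductive eval : recf -> seq nat -> nat -> Prop :=
| evZero v : eval RZero v 0
| evSucc x v : eval RSucc (x :: v) x.+1
| evProj i v : (i < size v)%N -> eval (RProj i) v (nth 0%N v i)
| evComp f gs v ws y : evals gs v ws -> eval f ws y -> eval (RComp f gs) v y
| evPrec0 f g v y : eval f v y -> eval (RPrec f g) (0%N :: v) y
| evPrecS f g n v r y :
    eval (RPrec f g) (n :: v) r -> eval g (n :: r :: v) y ->
    eval (RPrec f g) (n.+1 :: v) y
| evMu f v n :
    eval f (n :: v) 0 ->
    (forall m, (m < n)%N -> exists k, eval f (m :: v) k.+1) ->
    eval (RMu f) v n
with evals : seq recf -> seq nat -> seq nat -> Prop :=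
| evsNil v : evals [::] v [::]
| evsCons g gs v w ws : eval g v w -> evals gs v ws -> evals (g :: gs) v (w :: ws).

(* Bijective coding of binary strings by natural numbers:
   s |-> (the number with binary expansion 1s) - 1. *)
Definition code_bits (s : seq bool) : nat :=
  (foldl (fun a (b : bool) => a.*2 + b) 1 s).-1.

(* A machine on binary strings with natural-number outputs, given as a
   (partial) input/output relation. *)
Definition machine := seq bool -> nat -> Prop.

Definition partial_computable (M : machine) : Prop :=
  exists e : recf, forall s y, M s y <-> eval e [:: code_bits s] y.

Definition prefix_free (M : machine) : Prop :=
  forall s t y z, M s y -> M t z -> prefix s t -> s = t.

Definition prefix_free_machine (M : machine) : Prop :=
  partial_computable M /\ prefix_free M.

Definition universal_prefix_free (U : machine) : Prop :=
  prefix_free_machine U /\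
  forall M, prefix_free_machine M ->
    exists rho : seq bool, forall s y, M s y <-> U (rho ++ s) y.

Section Quantum.
Variable R : realType.
Local Notation C := (R[i]).
Local Open Scope ring_scope.

Definition realC (x : R) : C := real_complex R x.

Definition ctrans m n (A : 'M[C]_(m, n)) : 'M[C]_(n, m) := (map_mx Num.conj A)^T.

Definition cdot m (u v : 'cV[C]_m) : C := (ctrans u *m v) 0 0.

Definition qform m (v : 'cV[C]_m) (A : 'M[C]_m) : C := (ctrans v *m A *m v) 0 0.

Definition hermitian m (A : 'M[C]_m) : Prop := ctrans A = A.

Definition density_matrix m (A : 'M[C]_m) : Prop :=
  hermitian A /\ (forall v : 'cV[C]_m, 0 <= qform v A) /\ \tr A = 1.

(* index of basis vector |i b> (b = last qubit) in dimension 2^(n+1) *)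
Lemma qidx_proof n (i : 'I_(2 ^ n)) (b : 'I_2) : (i * 2 + b < 2 ^ n.+1)%N.
Proof.
have hi := ltn_ord i; have hb := ltn_ord b.
rewrite expnSr.
set z := (2 ^ n)%N in hi *.
lia.
Qed.

Definition qidx n (i : 'I_(2 ^ n)) (b : 'I_2) : 'I_(2 ^ n.+1) :=
  Ordinal (qidx_proof i b).

Definition ptrace_last n (A : 'M[C]_(2 ^ n.+1)) : 'M[C]_(2 ^ n) :=
  \matrix_(i, j) \sum_(b < 2) A (qidx i b) (qidx j b).

Definition is_state (rho : forall n, 'M[C]_(2 ^ n)) : Prop :=
  (forall n, density_matrix (rho n)) /\
  (forall n, ptrace_last (rho n.+1) = rho n).

Local Notation dec := CodeSeq.decode.

Definition rat_of_nat (k : nat) : rat :=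
  let s := dec k in
  ((Posz (nth 0%N s 0) - Posz (nth 0%N s 1))%:~R) / ((nth 0%N s 2).+1)%:R.

Definition poly_of_nat (k : nat) : {poly rat} := Poly (map rat_of_nat (dec k)).

(* k = code of [:: p; a; b; c; d] codes the unique root z of the nonzero
   polynomial p with a <= Re z <= b and c <= Im z <= d. *)
Definition in_box (k : nat) (z : C) : Prop :=
  let s := dec k in
  ratr (rat_of_nat (nth 0%N s 1)) <= Re z <= ratr (rat_of_nat (nth 0%N s 2)) /\
  ratr (rat_of_nat (nth 0%N s 3)) <= Im z <= ratr (rat_of_nat (nth 0%N s 4)).

Definition dec_alg (k : nat) (z : C) : Prop :=
  let p := poly_of_nat (nth 0%N (dec k) 0) in
  p != 0 /\ root (map_poly ratr p) z /\ in_box k z /\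
  (forall w, root (map_poly ratr p) w -> in_box k w -> w = z).

Definition algebraicC (z : C) : Prop :=
  exists p : {poly rat}, p != 0 /\ root (map_poly ratr p) z.

Definition dec_vec m (k : nat) (v : 'cV[C]_m) : Prop :=
  size (dec k) = m /\ forall i : 'I_m, dec_alg (nth 0%N (dec k) i) (v i 0).

(* finite lists of vectors; the coded finite set is [undup L] *)
Definition dec_list m (k : nat) (L : seq 'cV[C]_m) : Prop :=
  size L = size (dec k) /\
  forall i, (i < size L)%N -> dec_vec (nth 0%N (dec k) i) (nth 0 L i).

Definition dec_mx n (k : nat) (A : 'M[C]_(2 ^ n)) : Prop :=
  let s := dec k in
  nth 0%N s 0 = n /\
  let es := dec (nth 0%N s 1) in
  size es = (2 ^ n * 2 ^ n)%N /\
  forall i j : 'I_(2 ^ n), dec_alg (nth 0%N es (i * 2 ^ n + j)) (A i j).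

Definition log2 (x : R) : R := ln x / ln 2.

Definition orthonormal m (F : seq 'cV[C]_m) : Prop :=
  forall u v, u \in F -> v \in F -> cdot u v = (u == v)%:R.

(* U sigma outputs (the code of) the finite set F = undup L *)
Definition QK (U : machine) (eps : R) n (tau : 'M[C]_(2 ^ n)) : \bar R :=
  ereal_inf [set x : \bar R | exists (sigma : seq bool) (k : nat) (L : seq 'cV[C]_(2 ^ n)),
     U sigma k /\ dec_list k L /\ orthonormal (undup L) /\
     realC eps < \sum_(v <- undup L) qform v tau /\
     x = ((size sigma)%:R + log2 (size (undup L))%:R)%:E].

Definition special_projection n (S : 'M[C]_(2 ^ n)) : Prop :=
  hermitian S /\ S *m S = S /\ (forall i j, algebraicC (S i j)).

Definition tau_mx n (S : 'M[C]_(2 ^ n)) : C := \tr S / (2 ^ n)%:R.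

Definition strong_solovay_test (d : nat -> nat) (S : forall m, 'M[C]_(2 ^ d m)) : Prop :=
  (exists e : recf, forall m, exists k, eval e [:: m] k /\ dec_mx k (S m)) /\
  (forall m, special_projection (S m)) /\
  (exists B : R, forall N, \sum_(m < N) tau_mx (S m) <= realC B).

Definition state_val (rho : forall n, 'M[C]_(2 ^ n)) n (S : 'M[C]_(2 ^ n)) : C :=
  \tr (rho n *m S).

Definition fails_at (rho : forall n, 'M[C]_(2 ^ n)) (d : nat -> nat)
  (S : forall m, 'M[C]_(2 ^ d m)) (eps : R) : Prop :=
  forall M, exists m, (M <= m)%N /\ realC eps < state_val rho (S m).

Definition passes (rho : forall n, 'M[C]_(2 ^ n)) (d : nat -> nat)
  (S : forall m, 'M[C]_(2 ^ d m)) : Prop :=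
  forall eps : R, 0 < eps -> ~ fails_at rho S eps.

Definition weak_solovay_random (rho : forall n, 'M[C]_(2 ^ n)) : Prop :=
  forall d S, @strong_solovay_test d S -> passes rho S.

End Quantum.

(* Main.v *)
Require Import Defs.
From HB Require Import structures.
From mathcomp Require Import all_boot all_order all_algebra.
From mathcomp Require Import complex.
From mathcomp Require Import all_classical all_reals all_analysis.
From mathcomp Require Import zify ring lra.

Import Order.TTheory GRing.Theory Num.Theory.

(* A frame is replaced, on both sides of the equivalence, by an orthogonal family
   of vectors with Gaussian rational entries close to it; such a family exists by
   Gram-Schmidt without normalisation, its defining properties are decidable by
   rational arithmetic, and its closeness to given algebraic entries is certified
   by evaluating the defining polynomials on a fine grid of the isolating boxes.
   It can thus be found by unbounded search, and no arithmetic on algebraic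
   numbers is needed.
   If the complexity is small infinitely often, enumerate the programs that print
   such a frame and collect, once per program, the projection on the approximating
   family; Kraft's inequality bounds the total weight, so this is a strong Solovay
   test, and it is failed.
   Conversely, given a test, approximate each projection by a family of the same
   size, and give it a codeword whose dyadic interval lies in the interval reserved
   for it by its weight; these intervals are disjoint, so the resulting machine is
   prefix-free and describes the families within a constant of the bound. *)

Set Implicit Arguments.
Unset Strict Implicit.
Unset Printing Implicit Defensive.

(** * Recursive functions *)

Local Open Scope nat_scope.
Local Notation eval := Defs.eval.
Local Notation dec := CodeSeq.decode.
Local Notation gauss := (complex rat).
Local Notation Re := complex.Re.
Local Notation Im := complex.Im.

(** Whether a printed number is a valid code of an orthonormal set is never decided. The checks are
    one-sided: whatever passes them contains an exactly orthogonal rational family, so the collected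
    projections form a test even if some program prints an invalid code, and closeness is derived
    only for codes that are valid. Approximation costs a constant factor of the level in one
    direction and half of it in the other; this is harmless because both sides of the equivalence
    quantify over all levels, just as the quantifier over [c] absorbs additive constants in the
    length of descriptions. The number of vectors must not change at all, since it enters both the
    trace of a projection and the complexity. Hence Gram-Schmidt, which keeps the number, and hence
    the use of traces being integers. A machine has to print unit vectors, whose entries have the
    form z / sqrt N with z a Gaussian rational. These are the only irrational numbers that must be
    named, and an explicit polynomial and box are given for them. *)

Definition computable1 (f : nat -> nat) :=
  exists e, forall x, eval e [:: x] (f x).
Definition computable2 (f : nat -> nat -> nat) :=
  exists e, forall x y, eval e [:: x; y] (f x y).

Lemma computable2_app (f : nat -> nat -> nat) g h :
  computable2 f -> computable1 g -> computable1 h ->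
  computable1 (fun x => f (g x) (h x)).
Proof.
move=> [e He] [e1 H1] [e2 H2]; exists (RComp e [:: e1; e2]) => x.
by apply: (@evComp _ _ _ [:: g x; h x]) => //; repeat constructor.
Qed.

Lemma computable2_app2 (f : nat -> nat -> nat) g h :
  computable2 f -> computable2 g -> computable2 h ->
  computable2 (fun x y => f (g x y) (h x y)).
Proof.
move=> [e He] [e1 H1] [e2 H2]; exists (RComp e [:: e1; e2]) => x y.
by apply: (@evComp _ _ _ [:: g x y; h x y]) => //; repeat constructor.
Qed.

Lemma computable1_app (f : nat -> nat) g :
  computable1 f -> computable1 g -> computable1 (fun x => f (g x)).
Proof.
move=> [e He] [e1 H1]; exists (RComp e [:: e1]) => x.
by apply: (@evComp _ _ _ [:: g x]) => //; repeat constructor.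
Qed.

Lemma computable1_app2 (f : nat -> nat) g :
  computable1 f -> computable2 g -> computable2 (fun x y => f (g x y)).
Proof.
move=> [e He] [e1 H1]; exists (RComp e [:: e1]) => x y.
by apply: (@evComp _ _ _ [:: g x y]) => //; repeat constructor.
Qed.

Lemma computable1_id : computable1 id.
Proof. by exists (RProj 0) => x; apply: (@evProj 0 [:: x]). Qed.

Lemma computable2_fst : computable2 (fun x _ => x).
Proof. by exists (RProj 0) => x y; apply: (@evProj 0 [:: x; y]). Qed.

Lemma computable2_snd : computable2 (fun _ y => y).
Proof. by exists (RProj 1) => x y; apply: (@evProj 1 [:: x; y]). Qed.

Lemma computable1_succ : computable1 succn.
Proof. by exists RSucc => x; constructor. Qed.

Lemma computable1_const c : computable1 (fun _ => c).
Proof.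
elim: c => [|c IH]; first by exists RZero => x; constructor.
exact: computable1_app computable1_succ IH.
Qed.

Lemma computable2_const c : computable2 (fun _ _ => c).
Proof.
exact: (computable1_app2 (f := fun=> c) (computable1_const c) computable2_fst).
Qed.

(** In this scheme the step does not see the parameter. It suffices to obtain pairing and
    projections, from which the general scheme [computable2_rec] follows. *)
Lemma computable2_rec1 (f : nat -> nat) (g : nat -> nat -> nat) :
  computable1 f -> computable2 g ->
  computable2 (fun n x => nat_rect (fun=> nat) (f x) g n).
Proof.
move=> [ef Hf] [eg Hg].
exists (RPrec ef (RComp eg [:: RProj 0; RProj 1])) => n x.
elim: n => [|n IH]; first exact: evPrec0.
apply: (evPrecS IH); apply: (@evComp _ _ _ [:: n; _]); last exact: Hg.
set v := [:: n; _; x]; apply: evsCons; first exact: (@evProj 0 v).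
by apply: evsCons; [exact: (@evProj 1 v) | exact: evsNil].
Qed.

Lemma eq_computable1 (f g : nat -> nat) : f =1 g -> computable1 f -> computable1 g.
Proof. by move=> fg [e He]; exists e => x; rewrite -fg. Qed.

Lemma eq_computable2 (f g : nat -> nat -> nat) :
  f =2 g -> computable2 f -> computable2 g.
Proof. by move=> fg [e He]; exists e => x y; rewrite -fg. Qed.

Lemma computable2_swap f : computable2 f -> computable2 (fun x y => f y x).
Proof.
by move=> Hf; apply: (computable2_app2 Hf computable2_snd computable2_fst).
Qed.

Lemma computable1_rec0 (c : nat) (g : nat -> nat -> nat) : computable2 g ->
  computable1 (nat_rect (fun=> nat) c g).
Proof.
move=> Hg; apply: (computable2_app (f := fun n x => nat_rect (fun=> nat) c g n)
   (h := id)  _ computable1_id computable1_id).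
exact: computable2_rec1 (computable1_const c) Hg.
Qed.

Lemma computable2_add : computable2 addn.
Proof.
apply: (eq_computable2 _ (computable2_rec1 computable1_id
   (computable1_app2 computable1_succ computable2_snd))) => n x.
by elim: n => //= n ->.
Qed.

Lemma computable1_pred : computable1 predn.
Proof. by apply: (eq_computable1 _ (computable1_rec0 0 computable2_fst)); case. Qed.

Lemma computable2_sub : computable2 subn.
Proof.
suff H : computable2 (fun n x => x - n) by exact: computable2_swap H.
apply: (eq_computable2 _ (computable2_rec1 computable1_id
   (computable1_app2 computable1_pred computable2_snd))) => n x.
by elim: n => [|n IH] /=; rewrite ?subn0 // IH subnS.
Qed.

(** Pairing is consing for the coding of lists: a list code is a nested pair ended by 0, and no
    separate coding of pairs is needed. *)
Definition pairc (x y : nat) : nat := CodeSeq.code (x :: dec y).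
Definition fstc (k : nat) : nat := head 0 (dec k).
Definition sndc (k : nat) : nat := CodeSeq.code (behead (dec k)).

Lemma paircE x y : pairc x y = 2 ^ x * y.*2.+1.
Proof. by rewrite /pairc /= -/(CodeSeq.code (dec y)) CodeSeq.decodeK. Qed.

Lemma dec_pairc x y : dec (pairc x y) = x :: dec y.
Proof. exact: CodeSeq.codeK. Qed.

Lemma fstc_pairc x y : fstc (pairc x y) = x.
Proof. by rewrite /fstc dec_pairc. Qed.

Lemma sndc_pairc x y : sndc (pairc x y) = y.
Proof. by rewrite /sndc dec_pairc /= CodeSeq.decodeK. Qed.

Lemma dec_sndc k : dec (sndc k) = behead (dec k).
Proof. exact: CodeSeq.codeK. Qed.

Lemma pairc_fst_snd k : 0 < k -> pairc (fstc k) (sndc k) = k.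
Proof.
move=> k0; rewrite /pairc /fstc /sndc CodeSeq.codeK.
have := CodeSeq.decodeK k; case: (dec k) => [/= k00|x s] //.
by rewrite -k00 in k0.
Qed.

Lemma pairc_gt0 x y : 0 < pairc x y.
Proof. by rewrite paircE muln_gt0 expn_gt0. Qed.

Lemma computable2_pair : computable2 pairc.
Proof.
have H : computable2 (fun _ y => y + y).
  exact: computable2_app2 computable2_add computable2_snd computable2_snd.
have H1 : computable1 (fun y => (y + y).+1).
  apply: computable1_app computable1_succ _.
  exact: computable2_app computable2_add computable1_id computable1_id.
apply: (eq_computable2 _ (computable2_rec1 H1 H)) => x y.
by rewrite paircE; elim: x => [|x /= ->]; rewrite ?mul1n ?addnn // expnS; lia.
Qed.

Lemma computable1_odd : computable1 (fun n => odd n : nat).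
Proof.
have H := computable2_app2 computable2_sub (computable2_const 1) computable2_snd.
apply: (eq_computable1 _ (computable1_rec0 0 H)).
by elim => //= n ->; case: (odd n).
Qed.

Lemma computable1_half : computable1 half.
Proof.
have H := computable2_app2 computable2_add computable2_snd
   (computable1_app2 computable1_odd computable2_fst).
apply: (eq_computable1 _ (computable1_rec0 0 H)).
elim => //= n ->; rewrite uphalf_half; lia.
Qed.

Lemma computable1_mu (f : nat -> nat -> nat) (F : nat -> nat) : computable2 f ->
  (forall x, f (F x) x = 0) -> (forall x m, m < F x -> f m x <> 0) ->
  computable1 F.
Proof.
move=> [e He] F0 Fn; exists (RMu e) => x; apply: evMu => [|m mF].
  by rewrite -(F0 x).
by exists (f m x).-1; have := He m x; case: (f m x) (Fn x m mF).
Qed.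

Lemma iter_half_pairc i x y : i <= x -> iter i half (pairc x y) = pairc (x - i) y.
Proof.
elim: i => [|i IH] ix; first by rewrite subn0.
rewrite iterS IH ?(ltnW ix) // !paircE -(subnSK ix) expnS -mulnA mul2n.
exact: doubleK.
Qed.

Lemma computable2_iter_half : computable2 (fun i k => iter i half k).
Proof.
apply: (eq_computable2 _ (computable2_rec1 computable1_id
   (computable1_app2 computable1_half computable2_snd))) => n x.
by elim: n => //= n ->.
Qed.

(** For positive [k], [fstc k] is the exponent of 2 in [k], the least number of halvings that leads
    to an odd number. *)
Lemma computable1_fst : computable1 fstc.
Proof.
have H := computable1_app2 computable1_odd computable2_iter_half.
(* The subtracted [1 - k] ends the search at once for [k = 0], where no halving gives an odd
   number. *)
apply: (computable1_mu (f := fun i k => (1 - odd (iter i half k)) - (1 - k))).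
- apply: computable2_app2 computable2_sub _ _.
    exact: computable2_app2 computable2_sub (computable2_const 1) H.
  exact: computable2_app2 computable2_sub (computable2_const 1) computable2_snd.
- move=> [//|k]; rewrite -{2}(pairc_fst_snd (ltn0Sn k)).
  by rewrite iter_half_pairc // subnn paircE mul1n /= odd_double.
- move=> [//|k] m mk; rewrite -{1}(pairc_fst_snd (ltn0Sn k)).
  rewrite iter_half_pairc ?(ltnW mk) // paircE -(subnSK mk) expnS -mulnA mul2n.
  by rewrite odd_double.
Qed.

Lemma computable1_snd : computable1 sndc.
Proof.
have H := computable2_app computable2_iter_half computable1_fst computable1_id.
apply: (eq_computable1 _ (computable1_app computable1_half H)) => -[//|k].
rewrite -{2}(pairc_fst_snd (ltn0Sn k)) iter_half_pairc // subnn paircE mul1n.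
exact: (half_bit_double _ true).
Qed.

(** The three arguments of the step are packed into one number in the way names of elements of a
    product are. *)
Lemma computable2_rec (f g : nat -> nat) : computable1 f -> computable1 g ->
  computable2 (fun n x =>
    nat_rect (fun=> nat) (f x) (fun n r => g (pairc x (pairc n r))) n).
Proof.
move=> [ef Hf] [eg Hg]; have [ep Hp] := computable2_pair.
exists (RPrec ef (RComp eg [:: RComp ep [:: RProj 2;
         RComp ep [:: RProj 0; RProj 1]]])) => n x.
elim: n => [|n IH]; first exact: evPrec0.
apply: (evPrecS IH); set r := nat_rect _ _ _ _.
apply: (@evComp _ _ _ [:: pairc x (pairc n r)]); last exact: Hg.
set v := [:: n; r; x].
have H0 : eval (RProj 0) v n by exact: (@evProj 0 v).
have H1 : eval (RProj 1) v r by exact: (@evProj 1 v).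
have H2 : eval (RProj 2) v x by exact: (@evProj 2 v).
apply: evsCons; last exact: evsNil.
apply: (@evComp _ _ _ [:: x; pairc n r]); last exact: Hp.
do 2! (apply: evsCons => //); last exact: evsNil.
apply: (@evComp _ _ _ [:: n; r]); last exact: Hp.
by do 2! (apply: evsCons => //); exact: evsNil.
Qed.

(** * Computability on represented types *)

(* [rep c x] : the number [c] is a name of [x]; an object may have several
   names, and [computable] functions act on names. *)
Class Rep (T : Type) := rep : nat -> T -> Prop.

Definition computable A B `{Rep A} `{Rep B} (f : A -> B) :=
  exists2 g, computable1 g & forall c x, rep c x -> rep (g c) (f x).

#[global] Instance rep_nat : Rep nat := fun c n => c = n.
#[global] Instance rep_bool : Rep bool := fun c b => (c != 0) = b.
#[global] Instance rep_pair A B `{Rep A} `{Rep B} : Rep (A * B) :=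
  fun c p => rep (fstc c) p.1 /\ rep (sndc c) p.2.
Definition rep_seq_def A `{Rep A} (c : nat) (s : seq A) :=
  List.Forall2 rep (dec c) s.
#[global] Instance rep_seq A `{Rep A} : Rep (seq A) := fun c s => rep_seq_def c s.

(** A constant function is computable only if its value has a name, which a transcendental number
    does not. *)
Class Named T `{Rep T} (x : T) := named : exists c, rep c x.

#[global] Instance named_nat (n : nat) : Named n. Proof. by exists n. Qed.
#[global] Instance named_bool (b : bool) : Named b.
Proof. by exists (b : nat); case: b. Qed.
#[global] Instance named_pair A B `{Rep A} `{Rep B} (x : A) (y : B) :
  Named x -> Named y -> Named (x, y).
Proof.
move=> [c Hc] [d Hd]; exists (pairc c d).
by split; rewrite /= ?fstc_pairc ?sndc_pairc.
Qed.
#[global] Instance named_nil A `{Rep A} : Named (@nil A).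
Proof. by exists 0; apply: List.Forall2_nil. Qed.

#[global] Instance named_cons A `{Rep A} (x : A) (s : seq A) :
  Named x -> Named s -> Named (x :: s).
Proof.
move=> [c Hc] [d Hd]; exists (pairc c d).
by rewrite /rep /rep_seq /rep_seq_def dec_pairc; apply: List.Forall2_cons.
Qed.

(** * Closure properties of computable functions *)

Section Closure.
Context A `{RA : Rep A}.

Lemma computable_id : computable (fun x : A => x).
Proof. by exists id => //; exact: computable1_id. Qed.

Lemma computable_comp B C `{Rep B} `{Rep C} (f : B -> C) (g : A -> B) :
  computable f -> computable g -> computable (fun x => f (g x)).
Proof.
move=> [f' Hf fE] [g' Hg gE]; exists (fun c => f' (g' c)).
  exact: computable1_app.
by move=> c x /gE/fE.
Qed.

Lemma computable_cst B `{Rep B} (b : B) : Named b -> computable (fun _ : A => b).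
Proof. by move=> [c Hc]; exists (fun=> c) => //; exact: computable1_const. Qed.

Lemma computable_pair B C `{Rep B} `{Rep C} (f : A -> B) (g : A -> C) :
  computable f -> computable g -> computable (fun x => (f x, g x)).
Proof.
move=> [f' Hf fE] [g' Hg gE]; exists (fun c => pairc (f' c) (g' c)).
  exact: computable2_app computable2_pair Hf Hg.
move=> c x cx; split; rewrite /= ?fstc_pairc ?sndc_pairc; [exact: fE|exact: gE].
Qed.

Lemma computable_fst B C `{Rep B} `{Rep C} (f : A -> B * C) :
  computable f -> computable (fun x => (f x).1).
Proof.
move=> [f' Hf fE]; exists (fun c => fstc (f' c)).
  exact: computable1_app computable1_fst Hf.
by move=> c x /fE[].
Qed.

Lemma computable_snd B C `{Rep B} `{Rep C} (f : A -> B * C) :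
  computable f -> computable (fun x => (f x).2).
Proof.
move=> [f' Hf fE]; exists (fun c => sndc (f' c)).
  exact: computable1_app computable1_snd Hf.
by move=> c x /fE[].
Qed.

Lemma computable_nat1 (op : nat -> nat) (f : A -> nat) : computable1 op ->
  computable f -> computable (fun x => op (f x)).
Proof.
move=> Ho [f' Hf fE]; exists (fun c => op (f' c)); first exact: computable1_app.
by move=> c x /fE ->.
Qed.

Lemma computable_nat2 (op : nat -> nat -> nat) (f g : A -> nat) : computable2 op ->
  computable f -> computable g -> computable (fun x => op (f x) (g x)).
Proof.
move=> Ho [f' Hf fE] [g' Hg gE]; exists (fun c => op (f' c) (g' c)).
  exact: computable2_app.
by move=> c x cx; rewrite (fE _ _ cx) (gE _ _ cx).
Qed.

Lemma computable_rec B `{Rep B} (n : A -> nat) (z : A -> B)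
    (step : A -> nat -> B -> B) :
  computable n -> computable z ->
  computable (fun p : A * (nat * B) => step p.1 p.2.1 p.2.2) ->
  computable (fun x => nat_rect (fun=> B) (z x) (step x) (n x)).
Proof.
move=> [n' Hn nE] [z' Hz zE] [g Hg gE].
exists (fun c => nat_rect (fun=> nat) (z' c)
   (fun m r => g (pairc c (pairc m r))) (n' c)).
  exact: (computable2_app (h := id) (computable2_rec Hz Hg) Hn computable1_id).
move=> c x cx; rewrite (nE _ _ cx); elim: (n x) => [|m IH] /=; first exact: zE.
apply: (gE _ (x, (m, _))); split; rewrite /= ?fstc_pairc ?sndc_pairc //.
by split; rewrite /= ?fstc_pairc ?sndc_pairc.
Qed.

Lemma computable_if B `{Rep B} (b : A -> bool) (f g : A -> B) :
  computable b -> computable f -> computable g ->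
  computable (fun x => if b x then f x else g x).
Proof.
move=> [b' Hb bE] [f' Hf fE] [g' Hg gE].
exists (fun c => nat_rect (fun=> nat) (g' c)
   (fun m r => f' (fstc (pairc c (pairc m r)))) (b' c)).
  have H1 := computable2_rec Hg (computable1_app Hf computable1_fst).
  exact: (computable2_app (h := id) H1 Hb computable1_id).
move=> c x cx; rewrite -(bE _ _ cx); case: (b' c) => [|m] /=; first exact: gE.
by rewrite fstc_pairc; exact: fE.
Qed.

Lemma computable_ex_minn (p : A -> nat -> bool) (exP : forall x, exists n, p x n) :
  (forall c, exists x : A, rep c x) ->
  computable (fun q : A * nat => p q.1 q.2) ->
  computable (fun x => ex_minn (exP x)).
Proof.
(* The realizer is a total function on numbers, so its search must end on every [c]; by [tot], each
   [c] names some [x], for which [exP] applies. *)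
move=> tot [p' Hp pE]; have pE' c x n : rep c x -> (p' (pairc c n) != 0) = p x n.
  by move=> cx; apply: (pE _ (x, n)); split; rewrite /= ?fstc_pairc ?sndc_pairc.
have exP' c : exists n, p' (pairc c n) != 0.
  by have [x cx] := tot c; have [n pn] := exP x; exists n; rewrite (pE' _ x).
exists (fun c => ex_minn (exP' c)).
  apply: (computable1_mu (f := fun n c => 1 - p' (pairc c n))).
  - apply: computable2_app2 computable2_sub (computable2_const 1) _.
    exact: computable1_app2 Hp (computable2_swap computable2_pair).
  - by move=> c; case: ex_minnP => n; case: (p' _).
  - move=> c m; case: ex_minnP => n _ nmin mn.
    by case: (p' _) (nmin m) => //= k /(_ isT); rewrite leqNgt mn.
move=> c x cx; rewrite /rep /rep_nat.
case: ex_minnP => n pn nmin; case: ex_minnP => m pm mmin; apply/eqP.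
by rewrite eqn_leq nmin ?(pE' _ x) // mmin // -(pE' c).
Qed.
End Closure.

Lemma computable_natE (f : nat -> nat) : computable f <-> computable1 f.
Proof.
split=> [[g Hg gE]|Hf]; last by exists f => // c x ->.
by apply: (eq_computable1 _ Hg) => x; exact: gE.
Qed.

(** These classes hold curried functions, so that [comp_auto] can find the computability of a head
    symbol by instance resolution and recurse on its arguments. *)
Class Comp1 A B `{Rep A} `{Rep B} (f : A -> B) := comp1 : computable f.
Class Comp2 A B C `{Rep A} `{Rep B} `{Rep C} (f : A -> B -> C) :=
  comp2 : computable (fun p : A * B => f p.1 p.2).
Class Comp3 A B C D `{Rep A} `{Rep B} `{Rep C} `{Rep D} (f : A -> B -> C -> D) :=
  comp3 : computable (fun p : A * (B * C) => f p.1 p.2.1 p.2.2).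
Class Comp4 A B C D E `{Rep A} `{Rep B} `{Rep C} `{Rep D} `{Rep E}
    (f : A -> B -> C -> D -> E) :=
  comp4 : computable (fun p : A * (B * (C * D)) => f p.1 p.2.1 p.2.2.1 p.2.2.2).

Section Application.
Context A B1 B2 B3 B4 B `{Rep A} `{Rep B1} `{Rep B2} `{Rep B3} `{Rep B4} `{Rep B}.
Variables (f1 : A -> B1) (f2 : A -> B2) (f3 : A -> B3) (f4 : A -> B4).

Lemma computable_app1 (h : B1 -> B) : Comp1 h ->
  computable f1 -> computable (fun x => h (f1 x)).
Proof. exact: computable_comp. Qed.

Lemma computable_app2 (h : B1 -> B2 -> B) : Comp2 h ->
  computable f1 -> computable f2 -> computable (fun x => h (f1 x) (f2 x)).
Proof.
by move=> Hh K1 K2; exact: (computable_comp Hh (computable_pair K1 K2)).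
Qed.

Lemma computable_app3 (h : B1 -> B2 -> B3 -> B) : Comp3 h ->
  computable f1 -> computable f2 -> computable f3 ->
  computable (fun x => h (f1 x) (f2 x) (f3 x)).
Proof.
move=> Hh K1 K2 K3.
exact: (computable_comp Hh (computable_pair K1 (computable_pair K2 K3))).
Qed.

Lemma computable_app4 (h : B1 -> B2 -> B3 -> B4 -> B) : Comp4 h ->
  computable f1 -> computable f2 -> computable f3 -> computable f4 ->
  computable (fun x => h (f1 x) (f2 x) (f3 x) (f4 x)).
Proof.
move=> Hh K1 K2 K3 K4; exact: (computable_comp Hh
  (computable_pair K1 (computable_pair K2 (computable_pair K3 K4)))).
Qed.
End Application.

#[global] Instance comp_fst A B `{Rep A} `{Rep B} : Comp1 (@fst A B).
Proof. by apply: computable_fst; exact: computable_id. Qed.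
#[global] Instance comp_snd A B `{Rep A} `{Rep B} : Comp1 (@snd A B).
Proof. by apply: computable_snd; exact: computable_id. Qed.

(** A hook for folds, maps and big operators, redefined once these are known to be computable. *)
Ltac comp_binder := fail.
Ltac comp_step := cbv beta;
  first [comp_binder |
  lazymatch goal with
  | |- computable (fun x => x) => apply computable_id
  | |- computable (fun _ => ?b) => apply computable_cst; typeclasses eauto
  | |- computable (fun x => (@?f x, @?g x)) => apply (computable_pair (f := f) (g := g))
  | |- computable (fun x => (@?f x).1) => apply (computable_fst (f := f))
  | |- computable (fun x => (@?f x).2) => apply (computable_snd (f := f))
  | |- computable (fun x => if _ then _ else _) => apply computable_if
  | |- computable (fun x => nat_rect _ (@?z x) (@?s x) (@?n x)) =>
      apply (computable_rec (n := n) (z := z) (step := s))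
  | _ => first
     [ assumption
     | match goal with |- computable ?h => change (Comp1 h); typeclasses eauto end
     | match goal with |- computable (fun x => ?h (@?f1 x)) =>
         apply (computable_app1 (f1 := f1) (h := h)); [typeclasses eauto|] end
     | match goal with |- computable (fun x => ?h (@?f1 x) (@?f2 x)) =>
         apply (computable_app2 (f1 := f1) (f2 := f2) (h := h));
           [typeclasses eauto| |] end
     | match goal with |- computable (fun x => ?h (@?f1 x) (@?f2 x) (@?f3 x)) =>
         apply (computable_app3 (f1 := f1) (f2 := f2) (f3 := f3) (h := h));
           [typeclasses eauto| | |] end
     | match goal with |- computable (fun x => ?h (@?f1 x) (@?f2 x) (@?f3 x) (@?f4 x)) =>
         apply (computable_app4 (f1 := f1) (f2 := f2) (f3 := f3) (f4 := f4) (h := h));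
           [typeclasses eauto| | | |] end
     | match goal with |- @computable ?A ?B ?RA ?RB ?h =>
         lazymatch h with
         | (fun _ => _) => fail
         | _ => change (@computable A B RA RB (fun x => h x))
         end end ]
  end].
Ltac comp_auto := rewrite /Comp1 /Comp2 /Comp3 /Comp4; repeat comp_step.

Lemma comp1_nat (op : nat -> nat) : computable1 op -> Comp1 op.
Proof. by move=> Ho; apply/computable_natE. Qed.

Lemma comp2_nat (op : nat -> nat -> nat) : computable2 op -> Comp2 op.
Proof.
by move=> Ho; apply: computable_nat2 => //;
  [apply: computable_fst | apply: computable_snd]; apply: computable_id.
Qed.

#[global] Instance comp_succn : Comp1 succn := comp1_nat computable1_succ.
#[global] Instance comp_predn : Comp1 predn := comp1_nat computable1_pred.
#[global] Instance comp_addn : Comp2 addn := comp2_nat computable2_add.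
#[global] Instance comp_subn : Comp2 subn := comp2_nat computable2_sub.
#[global] Instance comp_pairc : Comp2 pairc := comp2_nat computable2_pair.
#[global] Instance comp_fstc : Comp1 fstc := comp1_nat computable1_fst.
#[global] Instance comp_sndc : Comp1 sndc := comp1_nat computable1_snd.

Lemma eq_computable A B `{Rep A} `{Rep B} (f g : A -> B) :
  f =1 g -> computable f -> computable g.
Proof. by move=> fg [h Hh hE]; exists h => // c x cx; rewrite -fg; exact: hE. Qed.

#[global] Instance comp_muln : Comp2 muln.
Proof.
rewrite /Comp2; apply: (@eq_computable _ _ _ _
  (fun p => nat_rect (fun=> nat) 0 (fun _ r => r + p.2) p.1)); last by comp_auto.
by move=> [x y] /=; elim: x => //= x ->; rewrite mulSn addnC.
Qed.

#[global] Instance comp_expn : Comp2 expn.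
Proof.
rewrite /Comp2; apply: (@eq_computable _ _ _ _
  (fun p => nat_rect (fun=> nat) 1 (fun _ r => r * p.1) p.2)); last by comp_auto.
by move=> [x y] /=; elim: y => //= y ->; rewrite expnSr.
Qed.

Lemma computable_eq0 A `{Rep A} (f : A -> nat) :
  computable f -> computable (fun x => f x == 0).
Proof.
move=> [f' Hf fE]; exists (fun c => 1 - f' c).
  exact: computable2_app computable2_sub (computable1_const 1) Hf.
by move=> c x /fE ->; rewrite /rep /rep_bool; case: (f x).
Qed.
#[global] Instance comp_leq : Comp2 leq.
Proof. by apply: computable_eq0; comp_auto. Qed.
#[global] Instance comp_negb : Comp1 negb.
Proof.
rewrite /Comp1; apply: (@eq_computable _ _ _ _ (fun b => if b then false else true)) => //.
by comp_auto.
Qed.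
#[global] Instance comp_andb : Comp2 andb.
Proof.
rewrite /Comp2; apply: (@eq_computable _ _ _ _ (fun b => if b.1 then b.2 else false)) => //.
by comp_auto.
Qed.
#[global] Instance comp_orb : Comp2 orb.
Proof.
rewrite /Comp2; apply: (@eq_computable _ _ _ _ (fun b => if b.1 then true else b.2)) => //.
by comp_auto.
Qed.
#[global] Instance comp_eqn : Comp2 (@eq_op nat).
Proof.
rewrite /Comp2; apply: (@eq_computable _ _ _ _ (fun p => (p.1 <= p.2) && (p.2 <= p.1))).
  by move=> [x y] /=; rewrite eqn_leq.
by comp_auto.
Qed.


(** Lets the code of a list serve as a bound on the number of iterations needed to traverse it. *)
Lemma size_le_code s : size s <= CodeSeq.code s.
Proof.
elim: s => //= x s IH; have : 0 < 2 ^ x by rewrite expn_gt0.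
by move: IH; rewrite -/(CodeSeq.code s); case: (2 ^ x) => //= u; lia.
Qed.

Lemma computable_foldl A B S `{Rep A} `{Rep B} `{Rep S}
    (l : A -> seq B) (z : A -> S) (step : A -> S -> B -> S) :
  computable l -> computable z ->
  computable (fun p : A * (S * B) => step p.1 p.2.1 p.2.2) ->
  computable (fun x => foldl (step x) (z x) (l x)).
Proof.
move=> [l' Hl lE] [z' Hz zE] [g Hg gE].
(* A state pairs the code of the remaining list with the accumulator. It no longer changes once the
   list is exhausted, so iterating too often does no harm. *)
pose st c (s : nat) := if fstc s == 0 then s else
  pairc (sndc (fstc s)) (g (pairc c (pairc (sndc s) (fstc (fstc s))))).
exists (fun c => sndc (nat_rect (fun=> nat) (pairc (l' c) (z' c))
                               (fun _ => st c) (l' c))).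
  have Cg := comp1_nat Hg; have Cl := comp1_nat Hl; have Cz := comp1_nat Hz.
  by apply/computable_natE; rewrite /st; comp_auto.
move=> c x cx.
suff K : forall m k a (w : S) (s : seq B), size s <= m ->
    @rep (seq B) (@rep_seq B H0) k s -> @rep S H1 a w ->
    @rep S H1 (sndc (nat_rect (fun=> nat) (pairc k a) (fun _ => st c) m))
        (foldl (step x) w s).
  apply: K; [|exact: lE|exact: zE].
  have <- : size (dec (l' c)) = size (l x) := List.Forall2_length (lE _ _ cx).
  by rewrite -[X in _ <= X]CodeSeq.decodeK size_le_code.
have iterE m u : nat_rect (fun=> nat) u (fun _ => st c) m = iter m (st c) u.
  by elim: m => //= m ->.
elim=> [|m IH] k a w s.
  by case: s => // _ _ aw /=; rewrite sndc_pairc.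
move=> sm kb aw; rewrite iterE iterSr {2}/st fstc_pairc sndc_pairc -iterE.
case: s kb sm => [|y s].
  move=> kb _; have k0 : k = 0.
    by rewrite -[k]CodeSeq.decodeK; inversion kb.
  rewrite k0 /= iterE; suff -> : iter m (st c) (pairc 0 a) = pairc 0 a.
    by rewrite sndc_pairc.
  by elim: m {IH} => //= m ->; rewrite /st fstc_pairc.
move=> kb /= sm; have k0 : 0 < k.
  by case: k kb => // kb; inversion kb.
rewrite -[k]pairc_fst_snd // in kb *.
have -> : (pairc (fstc k) (sndc k) == 0) = false by apply/negbTE; rewrite -lt0n pairc_gt0.
rewrite fstc_pairc sndc_pairc; move: kb; rewrite /rep /rep_seq /rep_seq_def dec_pairc => kb.
inversion kb; apply: IH => //.
apply: (gE _ (x, (w, y))); split; rewrite /= ?fstc_pairc ?sndc_pairc //.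
by split; rewrite /= ?fstc_pairc ?sndc_pairc.
Qed.

#[global] Instance comp_cons A `{Rep A} : Comp2 (@cons A).
Proof.
exists (fun c => pairc (fstc c) (sndc c)).
  exact: computable2_app computable2_pair computable1_fst computable1_snd.
move=> c [x s] [/= cx cs]; rewrite /rep /rep_seq /rep_seq_def dec_pairc.
exact: List.Forall2_cons.
Qed.

Lemma computable_rev A B `{Rep A} `{Rep B} (l : A -> seq B) :
  computable l -> computable (fun x => rev (l x)).
Proof.
move=> Hl; apply: (@eq_computable _ _ _ _
  (fun x => foldl (fun s y => y :: s) [::] (l x))).
  by move=> x; rewrite -[RHS]cats0 -[rev _ ++ _]catrevE;
     elim: (l x) [::] => //= y s IH t; rewrite IH.
by apply: (computable_foldl (step := fun _ s y => y :: s)) => //; comp_auto.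
Qed.

Lemma computable_foldr A B S `{Rep A} `{Rep B} `{Rep S}
    (l : A -> seq B) (z : A -> S) (step : A -> B -> S -> S) :
  computable l -> computable z ->
  computable (fun p : A * (B * S) => step p.1 p.2.1 p.2.2) ->
  computable (fun x => foldr (step x) (z x) (l x)).
Proof.
move=> Hl Hz Hs; apply: (@eq_computable _ _ _ _
  (fun x => foldl (fun s y => step x y s) (z x) (rev (l x)))).
  by move=> x; rewrite foldl_rev.
apply: computable_foldl; [exact: computable_rev|by []|].
apply: (computable_comp (g := fun p => (p.1, (p.2.2, p.2.1))) Hs).
by comp_auto.
Qed.

Ltac comp_binder ::= lazymatch goal with
  | |- computable (fun x => foldr (@?f x) (@?z x) (@?l x)) =>
      apply (computable_foldr (l := l) (z := z) (step := f))
  end.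

(** * Maps, quantifiers and big operators over lists *)

Section ListBinders.
Context A B C `{Rep A} `{Rep B} `{Rep C} (l : A -> seq B).

Lemma computable_map (f : A -> B -> C) :
  computable l -> computable (fun p : A * B => f p.1 p.2) ->
  computable (fun x => map (f x) (l x)).
Proof.
move=> Hl Hf; apply: (@eq_computable _ _ _ _
  (fun x => foldr (fun y s => f x y :: s) [::] (l x))).
  by move=> x; elim: (l x) => //= y s ->.
have Hf' : Comp2 f by [].
by comp_auto.
Qed.

Lemma computable_all (f : A -> pred B) :
  computable l -> computable (fun p : A * B => f p.1 p.2) ->
  computable (fun x => all (f x) (l x)).
Proof.
move=> Hl Hf; apply: (@eq_computable _ _ _ _
  (fun x => foldr (fun y s => f x y && s) true (l x))).
  by move=> x; elim: (l x) => //= y s ->.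
have Hf' : Comp2 (f : A -> B -> bool) by [].
by comp_auto.
Qed.

Lemma computable_has (f : A -> pred B) :
  computable l -> computable (fun p : A * B => f p.1 p.2) ->
  computable (fun x => has (f x) (l x)).
Proof.
move=> Hl Hf; apply: (@eq_computable _ _ _ _
  (fun x => foldr (fun y s => f x y || s) false (l x))).
  by move=> x; elim: (l x) => //= y s ->.
have Hf' : Comp2 (f : A -> B -> bool) by [].
by comp_auto.
Qed.

Lemma computable_big (op : C -> C -> C) (z : C) (f : A -> B -> C) :
  computable l -> Comp2 op -> Named z -> computable (fun p : A * B => f p.1 p.2) ->
  computable (fun x => \big[op/z]_(y <- l x) f x y).
Proof.
move=> Hl Hop Hz Hf; apply: (@eq_computable _ _ _ _
  (fun x => foldr (fun y s => op (f x y) s) z (l x))).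
  by move=> x; rewrite unlock /reducebig; elim: (l x) => //= y s ->.
have Hf' : Comp2 f by [].
by comp_auto.
Qed.
End ListBinders.

Ltac comp_binder ::= lazymatch goal with
  | |- computable (fun x => foldr (@?f x) (@?z x) (@?l x)) =>
      apply (computable_foldr (l := l) (z := z) (step := f))
  | |- computable (fun x => map (@?f x) (@?l x)) =>
      apply (computable_map (l := l) (f := f))
  | |- computable (fun x => all (@?f x) (@?l x)) =>
      apply (computable_all (l := l) (f := f))
  | |- computable (fun x => has (@?f x) (@?l x)) =>
      apply (computable_has (l := l) (f := f))
  | |- computable (fun x => bigop ?z (@?l x) (fun y => BigBody y ?op true (@?f x y))) =>
      apply (computable_big (l := l) (op := op) (z := z) (f := f));
        [ | typeclasses eauto | typeclasses eauto | ]
  end.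

#[global] Instance comp_size A `{Rep A} : Comp1 (@size A).
Proof.
rewrite /Comp1; apply: (@eq_computable _ _ _ _ (fun s => foldr (fun _ n => n.+1) 0 s)).
  by elim=> //= x s ->.
by comp_auto.
Qed.

#[global] Instance comp_cat A `{Rep A} : Comp2 (@cat A).
Proof.
rewrite /Comp2; apply: (@eq_computable _ _ _ _
   (fun p => foldr (fun x s => x :: s) p.2 p.1)).
  by case=> s t /=; elim: s => //= x s ->.
by comp_auto.
Qed.

#[global] Instance comp_iota0 : Comp1 (iota 0).
Proof.
rewrite /Comp1; apply: (@eq_computable _ _ _ _
   (fun n => nat_rect (fun=> seq nat) [::] (fun i s => s ++ [:: i]) n)).
  by elim=> // n /= ->; rewrite -[_ ++ _](iotaD 0 n 1) addn1.
by comp_auto.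
Qed.

#[global] Instance comp_behead A `{Rep A} : Comp1 (@behead A).
Proof.
exists sndc; first exact: computable1_snd.
move=> c s cs; rewrite /rep /rep_seq /rep_seq_def dec_sndc.
by move: cs; rewrite /rep /rep_seq /rep_seq_def; case: (dec c) => [|y t] cs; inversion cs.
Qed.

#[global] Instance comp_nth A `{Rep A} (d : A) `{!Named d} : Comp2 (nth d).
Proof.
have Hh : Comp1 (head d).
  have [e He] := @named _ _ d _.
  exists (fun c => if c == 0 then e else fstc c).
    apply/computable_natE; apply: computable_if; last exact: comp_fstc.
      exact: (computable_eq0 (@computable_id nat _)).
    exact: computable_cst.
  move=> c s; rewrite /rep /rep_seq /rep_seq_def => cs; case: eqP => [c0|/eqP c0].
    by rewrite c0 in cs; inversion cs.
  move: cs; rewrite -[c]pairc_fst_snd ?lt0n // dec_pairc fstc_pairc.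
  by move=> cs; inversion cs.
rewrite /Comp2; apply: (@eq_computable _ _ _ _ (fun p => head d
   (nat_rect (fun=> seq A) p.1 (fun _ s => behead s) p.2))); last by comp_auto.
move=> [s i] /=; have -> : nat_rect (fun=> seq A) s (fun=> [eta behead]) i = drop i s.
  by elim: i => [|i /= ->]; rewrite ?drop0 // -[i.+1]add1n -drop_drop drop1.
by rewrite -nth0 nth_drop addn0.
Qed.

#[global] Instance comp_dec : Comp1 dec.
Proof.
exists id; first exact: computable1_id.
move=> c x ->; rewrite /rep /rep_seq /rep_seq_def.
by elim: (dec x) => //= *; constructor.
Qed.

(** * Step-bounded evaluation *)

(* The value [y.+1] means "halts with output [y]", and [0] "no answer in [t] steps". *)
Fixpoint evalt (e : recf) (t : nat) (v : seq nat) {struct e} : nat :=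
  match e with
  | RZero => 1
  | RSucc => if size v == 0 then 0 else (nth 0 v 0).+2
  | RProj i => if i < size v then (nth 0 v i).+1 else 0
  | RComp f gs =>
      let r := foldr (fun g r =>
          ((0 < evalt g t v) && r.1, (evalt g t v).-1 :: r.2)) (true, [::]) gs in
      if r.1 then evalt f t r.2 else 0
  | RPrec f g =>
      if size v == 0 then 0 else
      nat_rect (fun=> nat) (evalt f t (behead v))
        (fun n r => if r == 0 then 0 else evalt g t (n :: r.-1 :: behead v))
        (nth 0 v 0)
  | RMu f =>
      (* states of the search: 0 = going on, 1 = stuck, n.+2 = found n *)
      (nat_rect (fun=> nat) 0 (fun n s => if s == 0 then
         (if evalt f t (n :: v) == 0 then 1 else
          if evalt f t (n :: v) == 1 then n.+2 else 0) else s) t).-1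
  end.

(** An induction principle with hypotheses for the list of terms under [RComp], which the automatic
    one leaves out. *)
Fixpoint recf_nested_ind (P : recf -> Prop) (PZ : P RZero) (PS : P RSucc)
  (Pp : forall i, P (RProj i))
  (Pc : forall f gs, P f -> List.Forall P gs -> P (RComp f gs))
  (Pr : forall f g, P f -> P g -> P (RPrec f g))
  (Pm : forall f, P f -> P (RMu f)) (e : recf) : P e :=
  let rec := recf_nested_ind PZ PS Pp Pc Pr Pm in
  match e with
  | RZero => PZ | RSucc => PS | RProj i => Pp i
  | RComp f gs => Pc f gs (rec f)
      ((fix go gs : List.Forall P gs := match gs with
        | [::] => List.Forall_nil P
        | g :: gs' => List.Forall_cons g (rec g) (go gs') end) gs)
  | RPrec f g => Pr f g (rec f) (rec g)
  | RMu f => Pm f (rec f)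
  end.

#[global] Instance comp_evalt e : Comp2 (evalt e).
Proof.
elim/recf_nested_ind: e => [||i|f gs Hf Hgs|f g Hf Hg|f Hf]; rewrite /Comp2 /=;
  try by comp_auto.
apply: computable_if; first last.
- by comp_auto.
- apply: (computable_app2 Hf); first by comp_auto.
  apply: computable_snd; elim: Hgs => [|g gs' Hg _ IH] /=; first by comp_auto.
  have Hg' : Comp2 (evalt g) by [].
  apply: computable_pair; last by apply: (computable_app2 _ _ (computable_snd IH)); comp_auto.
  by apply: (computable_app2 _ _ (computable_fst IH)); comp_auto.
apply: computable_fst; elim: Hgs => [|g gs' Hg _ IH] /=; first by comp_auto.
have Hg' : Comp2 (evalt g) by [].
apply: computable_pair; last by apply: (computable_app2 _ _ (computable_snd IH)); comp_auto.
by apply: (computable_app2 _ _ (computable_fst IH)); comp_auto.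
Qed.


Lemma evalt_sound e t v y : evalt e t v = y.+1 -> eval e v y.
Proof.
elim/recf_nested_ind: e t v y => [||i|f gs IHf IHgs|f g IHf IHg|f IHf] t v y /=.
- by case=> <-; constructor.
- by case: v => //= x v [<-]; constructor.
- by case: ltnP => // iv [<-]; constructor.
- set r := foldr _ _ gs.
  case r1E: r.1 => // /IHf Hf; apply: evComp Hf; rewrite /r in r1E *.
  elim: IHgs r1E => [|g gs' IHg _ IH] /=; first by constructor.
  case/andP=> g0 /IH K; constructor => //.
  by apply: (IHg t); rewrite prednK.
- case: v => //= n v.
  elim: n y => [|n IHn] y /=; first by move/IHf; constructor.
  case: eqP => // /eqP r0 /IHg; apply: evPrecS; apply: IHn.
  by rewrite prednK // lt0n.
- set st := (X in nat_rect _ _ X _); set s0 := nat_rect _ _ st t.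
  case s0E: s0 => [|[|n]] //= -[<-].
  (* The invariant of the search: as long as it goes on, all smaller arguments gave positive values,
     and a state that reports success certifies an evaluation of [RMu f]. *)
  suff K m s : nat_rect (fun=> nat) 0 st m = s ->
      (s = 0 -> forall k, k < m -> exists z, eval f (k :: v) z.+1) /\
      (forall n, s = n.+2 -> eval (RMu f) v n).
    by have [_] := K _ _ s0E; apply.
  elim: m s => [|m IH] s /=; first by move=> <-; split.
  have [] := IH _ erefl; set s' := nat_rect _ _ st m => K1 K2.
  rewrite /st; case: eqP => [s'0|s'0] <-; last by split => // s0'; case: s'0.
  case E: (evalt f t (m :: v)) => [|[|w]] /=; split => //.
    move=> k [<-]; apply: evMu => [|j jm]; first exact: (IHf t).
    exact: K1.
  move=> _ k; rewrite ltnS leq_eqVlt => /orP[/eqP ->|]; last exact: K1.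
  by exists w; apply: (IHf t).
Qed.

(** The conclusion concerns all large bounds, so that the bounds for subterms can be combined by
    taking the maximum. *)
Lemma evalt_complete e v y : eval e v y ->
  exists t0, forall t, t0 <= t -> evalt e t v = y.+1.
Proof.
elim/recf_nested_ind: e v y => [||i|f gs IHf IHgs|f g IHf IHg|f IHf] v y H.
- by inversion H; exists 0.
- by inversion H; exists 0.
- by inversion H; subst; exists 0 => t _ /=; case: ltnP (H1) => //; rewrite ltnNge => ->.
- inversion H as [| | |f' gs' v' ws y' Hws Hf| | |]; subst.
  have [tf Htf] := IHf _ _ Hf.
  have [tg Htg] : exists t0, forall t, t0 <= t ->
     foldr (fun g r => ((0 < evalt g t v) && r.1, (evalt g t v).-1 :: r.2))
       (true, [::]) gs = (true, ws).
    elim: IHgs ws Hws {H Hf tf Htf} => [|g gs' IHg _ IH] ws Hws.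
      by inversion Hws; subst; exists 0.
    inversion Hws as [|g' gs'' v' w ws' Hg Hgs]; subst.
    have [t1 H1] := IHg _ _ Hg; have [t2 H2] := IH _ Hgs.
    exists (maxn t1 t2) => t; rewrite geq_max => /andP[le1 le2].
    by rewrite /= H1 // H2.
  exists (maxn tf tg) => t; rewrite geq_max => /andP[le1 le2].
  by rewrite /= Htg //= Htf.
- have [n [u vE]] : exists n u, v = n :: u by inversion H; subst; do 2 eexists.
  subst v; elim: n y H => [|n IHn] y H.
    inversion H as [| | | |f' g' v' y' Hf| |]; subst.
    by have [t Ht] := IHf _ _ Hf; exists t.
  inversion H as [| | | | |f' g' n' v' r y' Hr Hg|]; subst.
  have [t1 H1] := IHn _ Hr; have [t2 H2] := IHg _ _ Hg.
  exists (maxn t1 t2) => t; rewrite geq_max => /andP[le1 le2].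
  by have /= := H1 t le1 => ->; rewrite /= H2.
- inversion H as [| | | | | |f' v' n H0 Hn]; subst.
  have [t0 Ht0] := IHf _ _ H0.
  have [t1 Ht1] : exists t1, forall t, t1 <= t -> forall k, k < y ->
       1 < evalt f t (k :: v).
    elim: y Hn {H H0 Ht0} => [|m IH] Hn; first by exists 0.
    have [|t1 Ht1] := IH; first by move=> k km; apply: Hn; apply: ltnW.
    have [w /IHf [t2 Ht2]] := Hn m (leqnn _).
    exists (maxn t1 t2) => t; rewrite geq_max => /andP[le1 le2] k.
    rewrite ltnS leq_eqVlt => /orP[/eqP ->|km]; first by rewrite Ht2.
    exact: Ht1.
  exists (maxn (maxn t0 t1) y.+1) => t; rewrite !geq_max => /andP[/andP[le0 le1] ley] /=.
  set st := (X in nat_rect _ _ X _).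
  have Ky m : m <= y -> nat_rect (fun=> nat) 0 st m = 0.
    elim: m => //= m IH my; rewrite IH ?(ltnW my) // /st /=.
    by have := Ht1 t le1 m my; case: (evalt f t (m :: v)) => [|[|w]].
  have Kt m : y < m -> nat_rect (fun=> nat) 0 st m = y.+2.
    elim: m => // m IH; rewrite ltnS leq_eqVlt => /orP[/eqP <-|ym] /=.
      by rewrite (Ky _ (leqnn y)) /st /= Ht0.
    by rewrite IH // /st.
  by rewrite Kt.
Qed.

Lemma eval_inj e v y z : eval e v y -> eval e v z -> y = z.
Proof.
move=> /evalt_complete[t Ht] /evalt_complete[u Hu].
have := Ht (maxn t u) (leq_maxl _ _); rewrite Hu ?leq_maxr // => -[].
by [].
Qed.

(** * Rational and Gaussian rational arithmetic *)

(** Allows unbounded search over [T]: every number names an element, and every element is met. *)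
Class Decodable T `{Rep T} (decode : nat -> T) := {
  rep_decode : forall c, rep c (decode c);
  decode_surj : forall x, exists c, decode c = x }.

#[global] Instance decodable_nat : Decodable (id : nat -> nat).
Proof. by split=> [c|x] //; exists x. Qed.

Definition decode_pair A B (dA : nat -> A) (dB : nat -> B) c :=
  (dA (fstc c), dB (sndc c)).
#[global] Instance decodable_pair A B `{Rep A} `{Rep B}
  (dA : nat -> A) (dB : nat -> B)
  `{!Decodable dA} `{!Decodable dB} : Decodable (decode_pair dA dB).
Proof.
split=> [c|[x y]]; first by split; apply: rep_decode.
have [a <-] := decode_surj (decode := dA) x.
have [b <-] := decode_surj (decode := dB) y.
by exists (pairc a b); rewrite /decode_pair fstc_pairc sndc_pairc.
Qed.

Definition decode_seq A (dA : nat -> A) c := map dA (dec c).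
#[global] Instance decodable_seq A `{Rep A} (dA : nat -> A) `{!Decodable dA} :
  Decodable (decode_seq dA).
Proof.
split=> [c|s].
  rewrite /rep /rep_seq /rep_seq_def /decode_seq.
  by elim: (dec c) => [|a s IH] /=; constructor => //; apply: rep_decode.
elim: s => [|x s [c <-]]; first by exists 0.
have [a <-] := decode_surj x.
by exists (pairc a c); rewrite /decode_seq dec_pairc.
Qed.

Lemma named_decodable T `{Rep T} (d : nat -> T) `{!Decodable d} x : Named x.
Proof. by have [c <-] := decode_surj x; exists c; apply: rep_decode. Qed.

Lemma computable_decode T `{Rep T} (d : nat -> T) `{!Decodable d} : Comp1 d.
Proof. by exists id; [exact: computable1_id | move=> c x ->; apply: rep_decode]. Qed.

(** Agrees with the rationals inside the codes of algebraic numbers, so that polynomials and boxes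
    can be read off a code directly. Fractions are not reduced. *)
#[global] Instance rep_rat : Rep rat := fun c q => rat_of_nat c = q.

Definition mkrat (a b d : nat) : nat := pairc a (pairc b (pairc d 0)).
Local Notation qpos c := (nth 0 (dec c) 0).
Local Notation qneg c := (nth 0 (dec c) 1).
Local Notation qden c := (nth 0 (dec c) 2).

Lemma rat_of_natE c :
  rat_of_nat c = (((qpos c)%:R - (qneg c)%:R) / (qden c).+1%:R)%R.
Proof. by rewrite /rat_of_nat intrB -!pmulrn. Qed.

Lemma rat_of_mkrat a b d :
  rat_of_nat (mkrat a b d) = ((a%:R - b%:R) / d.+1%:R)%R.
Proof. by rewrite rat_of_natE /mkrat !dec_pairc. Qed.

Lemma natS_neq0 n : (1 + n%:R != 0 :> rat)%R.
Proof. by rewrite -mulrS pnatr_eq0. Qed.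

#[global] Instance decodable_rat : Decodable rat_of_nat.
Proof.
split=> // q; have d0 := denq_gt0 q.
exists (mkrat (if numq q is Posz n then n else 0)
  (if numq q is Negz n then n.+1 else 0) `|denq q|.-1); rewrite rat_of_mkrat.
rewrite prednK ?absz_gt0 ?gt_eqF // -[RHS]divq_num_den; congr (_ / _)%R.
  by case: (numq q) => n; rewrite ?subr0 // sub0r NegzE mulrNz.
by rewrite -[in RHS](gtz0_abs d0) pmulrn.
Qed.
#[global] Instance named_rat (q : rat) : Named q := named_decodable (d := rat_of_nat) q.

Lemma comp1_rat (op : rat -> rat) (f : nat -> nat) : Comp1 f ->
  (forall c, rat_of_nat (f c) = op (rat_of_nat c)) -> Comp1 op.
Proof.
move=> /computable_natE Hf fE; exists f => // c q; rewrite /rep /rep_rat => <-.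
exact: fE.
Qed.

Lemma computable2_of_comp2 (f : nat -> nat -> nat) : Comp2 f ->
  computable1 (fun c => f (fstc c) (sndc c)).
Proof. by move=> Hf; apply/computable_natE; comp_auto. Qed.

Lemma comp2_rat (op : rat -> rat -> rat) (f : nat -> nat -> nat) : Comp2 f ->
  (forall c d, rat_of_nat (f c d) = op (rat_of_nat c) (rat_of_nat d)) -> Comp2 op.
Proof.
move=> Hf fE; exists (fun c => f (fstc c) (sndc c)); first exact: computable2_of_comp2.
by move=> c [q r] [/= <- <-]; exact: fE.
Qed.

Lemma comp2_rat_bool (op : rat -> rat -> bool) (f : nat -> nat -> bool) : Comp2 f ->
  (forall c d, f c d = op (rat_of_nat c) (rat_of_nat d)) -> Comp2 op.
Proof.
move=> [g Hg gE] fE; exists g => // c [q r] [/= <- <-].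
by rewrite -fE; apply: (gE _ (_, _)).
Qed.

#[global] Instance comp_addq : Comp2 (fun x y : rat => x + y)%R.
Proof.
pose f c d := mkrat (qpos c * (qden d).+1 + qpos d * (qden c).+1)
  (qneg c * (qden d).+1 + qneg d * (qden c).+1) ((qden c).+1 * (qden d).+1).-1.
apply: (@comp2_rat _ f); first by rewrite /f /mkrat; comp_auto.
move=> c d; rewrite rat_of_mkrat !rat_of_natE prednK ?muln_gt0 // !natrD !natrM.
by field; rewrite !natS_neq0.
Qed.

#[global] Instance comp_mulq : Comp2 (fun x y : rat => x * y)%R.
Proof.
pose f c d := mkrat (qpos c * qpos d + qneg c * qneg d)
  (qpos c * qneg d + qneg c * qpos d) ((qden c).+1 * (qden d).+1).-1.
apply: (@comp2_rat _ f); first by rewrite /f /mkrat; comp_auto.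
move=> c d; rewrite rat_of_mkrat !rat_of_natE prednK ?muln_gt0 // !natrD !natrM.
by field; rewrite !natS_neq0.
Qed.

#[global] Instance comp_oppq : Comp1 (fun x : rat => - x)%R.
Proof.
pose f c := mkrat (qneg c) (qpos c) (qden c).
apply: (@comp1_rat _ f); first by rewrite /f /mkrat; comp_auto.
by move=> c; rewrite rat_of_mkrat rat_of_natE; field; rewrite natS_neq0.
Qed.

#[global] Instance comp_invq : Comp1 (fun x : rat => x^-1)%R.
Proof.
pose f c := if qneg c < qpos c then mkrat (qden c).+1 0 (qpos c - qneg c).-1 else
  if qpos c < qneg c then mkrat 0 (qden c).+1 (qneg c - qpos c).-1 else mkrat 0 0 0.
apply: (@comp1_rat _ f); first by rewrite /f /mkrat; comp_auto.
move=> c; rewrite /f [in RHS]rat_of_natE; case: ltnP => [lt|].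
  rewrite rat_of_mkrat prednK ?subn_gt0 // natrB ?(ltnW lt) // subr0.
  by rewrite invf_div.
move=> le; case: ltnP => [lt|ge].
  rewrite rat_of_mkrat prednK ?subn_gt0 // natrB ?(ltnW lt) // sub0r.
  by rewrite invf_div -(opprB (qneg c)%:R (qpos c)%:R)%R invrN mulrN mulNr.
have -> : qpos c = qneg c by apply/eqP; rewrite eqn_leq le ge.
by rewrite rat_of_mkrat !subrr !mul0r invr0.
Qed.

#[global] Instance comp_leq_rat : Comp2 (fun x y : rat => x <= y)%R.
Proof.
pose f c d := qpos c * (qden d).+1 + qneg d * (qden c).+1 <=
  qpos d * (qden c).+1 + qneg c * (qden d).+1.
apply: (@comp2_rat_bool _ f); first by rewrite /f; comp_auto.
move=> c d; rewrite !rat_of_natE ler_pdivrMr ?ltr0n // mulrAC ler_pdivlMr ?ltr0n //.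
rewrite !mulrBl lerBlDr -addrA [(- _ + _)%R]addrC addrA lerBrDr.
by rewrite /f -(ler_nat rat) !natrD !natrM.
Qed.

#[global] Instance comp_lt_rat : Comp2 (fun x y : rat => x < y)%R.
Proof.
rewrite /Comp2; apply: (@eq_computable _ _ _ _ (fun p => ~~ (p.2 <= p.1)%R)).
  by move=> p; rewrite -ltNge.
by comp_auto.
Qed.

#[global] Instance comp_eq_rat : Comp2 (@eq_op rat).
Proof.
rewrite /Comp2; apply: (@eq_computable _ _ _ _
   (fun p => (p.1 <= p.2)%R && (p.2 <= p.1)%R)).
  by move=> p; rewrite eq_le.
by comp_auto.
Qed.

#[global] Instance comp_norm_rat : Comp1 (fun x : rat => `|x|)%R.
Proof.
rewrite /Comp1; apply: (@eq_computable _ _ _ _ (fun x => if 0 <= x then x else - x)%R).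
  by move=> x; case: ger0P.
by comp_auto.
Qed.

#[global] Instance comp_natr_rat : Comp1 (fun n : nat => n%:R : rat)%R.
Proof.
exists (fun n => mkrat n 0 0); first by apply/computable_natE; rewrite /mkrat; comp_auto.
by move=> c x ->; rewrite /rep /rep_rat rat_of_mkrat subr0 divr1.
Qed.


#[global] Instance rep_gauss : Rep gauss :=
  fun c z => rep (fstc c) (complex.Re z) /\ rep (sndc c) (complex.Im z).

#[global] Instance comp_Re : Comp1 (@complex.Re rat).
Proof. by exists fstc; [exact: computable1_fst | move=> c z []]. Qed.
#[global] Instance comp_Im : Comp1 (@complex.Im rat).
Proof. by exists sndc; [exact: computable1_snd | move=> c z []]. Qed.
#[global] Instance comp_Complex : Comp2 (@Complex rat).
Proof. by exists id; [exact: computable1_id | move=> c [x y] []]. Qed.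

Definition decode_gauss c : gauss := Complex (rat_of_nat (fstc c)) (rat_of_nat (sndc c)).
#[global] Instance decodable_gauss : Decodable decode_gauss.
Proof.
split=> [c|[x y]]; first by split.
have [a <-] := decode_surj x; have [b <-] := decode_surj y.
by exists (pairc a b); rewrite /decode_gauss fstc_pairc sndc_pairc.
Qed.
#[global] Instance named_gauss (z : gauss) : Named z := named_decodable (d := decode_gauss) z.

#[global] Instance comp_addg : Comp2 (fun x y : gauss => x + y)%R.
Proof.
rewrite /Comp2; apply: (@eq_computable _ _ _ _ (fun p =>
  Complex (complex.Re p.1 + complex.Re p.2)%R (complex.Im p.1 + complex.Im p.2)%R)).
  by move=> [[a b] [c d]].
by comp_auto.
Qed.
#[global] Instance comp_oppg : Comp1 (fun x : gauss => - x)%R.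
Proof.
rewrite /Comp1; apply: (@eq_computable _ _ _ _ (fun p =>
  Complex (- complex.Re p)%R (- complex.Im p)%R)); first by move=> [a b].
by comp_auto.
Qed.
#[global] Instance comp_mulg : Comp2 (fun x y : gauss => x * y)%R.
Proof.
rewrite /Comp2; apply: (@eq_computable _ _ _ _ (fun p =>
  Complex (complex.Re p.1 * complex.Re p.2 - complex.Im p.1 * complex.Im p.2)%R
          (complex.Re p.1 * complex.Im p.2 + complex.Im p.1 * complex.Re p.2)%R)).
  by move=> [[a b] [c d]].
by comp_auto.
Qed.
#[global] Instance comp_conjg : Comp1 (@conjc rat).
Proof.
rewrite /Comp1; apply: (@eq_computable _ _ _ _ (fun p =>
  Complex (complex.Re p) (- complex.Im p)%R)); first by move=> [a b].
by comp_auto.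
Qed.
#[global] Instance comp_eqg : Comp2 (@eq_op gauss).
Proof.
rewrite /Comp2; apply: (@eq_computable _ _ _ _ (fun p =>
  (complex.Re p.1 == complex.Re p.2) && (complex.Im p.1 == complex.Im p.2))).
  by move=> [[a b] [c d]] /=; rewrite eq_complex.
by comp_auto.
Qed.


(** * Names of algebraic numbers *)

Local Open Scope ring_scope.

Lemma nth_dec k i : nth 0%N (dec k) i = fstc (iter i sndc k).
Proof.
elim: i k => [|i IH] k; first by rewrite /fstc nth0.
by rewrite iterSr -IH dec_sndc nth_behead.
Qed.

Section Approximation.
Variable R : realType.
Local Notation C := (R[i]).

Definition gC (z : gauss) : C := Complex (ratr (Re z)) (ratr (Im z)).

Lemma gCD : {morph gC : x y / x + y}.
Proof. by move=> [a b] [c d]; rewrite /gC /= !rmorphD. Qed.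
Lemma gCN : {morph gC : x / - x}.
Proof. by move=> [a b]; rewrite /gC /= !rmorphN. Qed.
Lemma gCB : {morph gC : x y / x - y}.
Proof. by move=> x y; rewrite gCD gCN. Qed.
Lemma gCM : {morph gC : x y / x * y}.
Proof.
move=> [a b] [c d]; apply/eqP; rewrite eq_complex /=.
by rewrite !(rmorphB, rmorphD, rmorphM) /= !eqxx.
Qed.
Lemma gC0 : gC 0 = 0. Proof. by rewrite /gC /= rmorph0. Qed.
Lemma gC1 : gC 1 = 1. Proof. by rewrite /gC /= rmorph0 rmorph1. Qed.
Lemma gC_conj z : gC z^*%C = (gC z)^*%C.
Proof. by case: z => a b; rewrite /gC /= rmorphN. Qed.
Lemma gC_rat (q : rat) : gC (Complex q 0) = ratr q.
Proof. by rewrite /gC /= rmorph0 -(fmorph_rat (real_complex R)). Qed.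
Lemma gC_inj : injective gC.
Proof. by move=> [a b] [c d] [] /fmorph_inj -> /fmorph_inj ->. Qed.

HB.instance Definition _ := GRing.isZmodMorphism.Build gauss C gC gCB.
HB.instance Definition _ := GRing.isMonoidMorphism.Build gauss C gC (conj gC1 gCM).

(** Used in place of the modulus because it is rational on Gaussian rationals, so that comparisons
    with it are decidable. *)
Definition n1 (K : realFieldType) (z : K[i]) : K := `|Re z| + `|Im z|.

Lemma n1_ge0 (K : realFieldType) (z : K[i]) : 0 <= n1 z.
Proof. by rewrite addr_ge0. Qed.
Lemma n1D (K : realFieldType) (x y : K[i]) : n1 (x + y) <= n1 x + n1 y.
Proof. by case: x y => [a b] [c d]; rewrite /n1 /= addrACA lerD // ler_normD. Qed.
Lemma n1N (K : realFieldType) (x : K[i]) : n1 (- x) = n1 x.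
Proof. by case: x => [a b]; rewrite /n1 /= !normrN. Qed.
Lemma n1M (K : realFieldType) (x y : K[i]) : n1 (x * y) <= n1 x * n1 y.
Proof.
case: x y => [a b] [c d]; rewrite /n1 /= mulrDl !mulrDr -!normrM.
have := ler_normB (a * c) (b * d); have := ler_normD (a * d) (b * c); lra.
Qed.
Lemma n1_gC z : n1 (gC z) = ratr (n1 z).
Proof. by rewrite /n1 /= rmorphD /= !ratr_norm. Qed.
Lemma n1_conj (K : realFieldType) (x : K[i]) : n1 x^*%C = n1 x.
Proof. by case: x => [a b]; rewrite /n1 /= normrN. Qed.
Lemma n1_0 (K : realFieldType) : n1 (0 : K[i]) = 0.
Proof. by rewrite /n1 /= normr0 addr0. Qed.

Lemma normc_le_n1 (z : C) : Normc.normc z <= n1 z.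
Proof.
case: z => a b; rewrite /n1 /=.
rewrite -(@ler_pXn2r _ 2) ?nnegrE ?sqrtr_ge0 ?addr_ge0 // sqr_sqrtr ?addr_ge0 ?sqr_ge0 //.
rewrite sqrrD !real_normK ?num_real //.
have := mulr_ge0 (normr_ge0 a) (normr_ge0 b); lra.
Qed.

Lemma n1_le_normc (z : C) : n1 z <= 2 * Normc.normc z.
Proof.
case: z => a b; rewrite /n1 /= mulr_natl mulr2n; apply: lerD.
  by rewrite -sqrtr_sqr ler_wsqrtr // lerDl sqr_ge0.
by rewrite -sqrtr_sqr ler_wsqrtr // lerDr sqr_ge0.
Qed.

(* Horner evaluation carrying an upper bound of [|p|] and a Lipschitz constant
   of [p] on the ball of radius [M]. *)
Definition hstep (M : rat) (g : gauss) (c : rat) (s : gauss * (rat * rat)) :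
    gauss * (rat * rat) :=
  (Complex c 0 + g * s.1, (`|c| + M * s.2.1, s.2.1 + M * s.2.2)).
Definition heval M g cs := foldr (hstep M g) (0, (0, 0)) cs.

Definition ratpoly (cs : seq rat) : {poly C} := map_poly ratr (Poly cs).

Lemma ratpoly_cons c cs z :
  (ratpoly (c :: cs)).[z] = ratr c + z * (ratpoly cs).[z].
Proof.
rewrite /ratpoly /= cons_poly_def rmorphD rmorphM /= map_polyX map_polyC /=.
by rewrite !hornerE mulrC addrC.
Qed.

Lemma ratpoly_nil z : (ratpoly [::]).[z] = 0.
Proof. by rewrite /ratpoly /= rmorph0 horner0. Qed.

Lemma heval_value M g cs : gC (heval M g cs).1 = (ratpoly cs).[gC g].
Proof.
elim: cs => [|c cs IH]; first by rewrite ratpoly_nil gC0.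
by rewrite ratpoly_cons /= gCD gCM IH gC_rat.
Qed.

Lemma heval_bound M g cs z : n1 z <= ratr M ->
  n1 (ratpoly cs).[z] <= ratr (heval M g cs).2.1.
Proof.
move=> zM; elim: cs => [|c cs IH]; first by rewrite ratpoly_nil n1_0 /= rmorph0.
rewrite ratpoly_cons /= rmorphD rmorphM /=; apply: (le_trans (n1D _ _)).
apply: lerD; first by rewrite -gC_rat n1_gC /n1 /= normr0 addr0.
by apply: (le_trans (n1M _ _)); rewrite ler_pM ?n1_ge0.
Qed.

Lemma heval_lipschitz M g cs z w : n1 z <= ratr M -> n1 w <= ratr M ->
  n1 ((ratpoly cs).[z] - (ratpoly cs).[w]) <= n1 (z - w) * ratr (heval M g cs).2.2.
Proof.
move=> zM wM; elim: cs => [|c cs IH].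
  by rewrite !ratpoly_nil subrr n1_0 /= rmorph0 mulr0.
rewrite !ratpoly_cons /= rmorphD rmorphM /=.
set p := ratpoly cs in IH *; set L := ratr (heval M g cs).2.2 in IH *.
(* The product rule for differences; its two terms give the two summands of the Lipschitz constant
   in [hstep]. *)
have -> : ratr c + z * p.[z] - (ratr c + w * p.[w]) =
  (z - w) * p.[z] + w * (p.[z] - p.[w]) by ring.
apply: (le_trans (n1D _ _)); rewrite [leRHS]mulrDr; apply: lerD.
  by apply: (le_trans (n1M _ _)); rewrite ler_wpM2l ?n1_ge0 // (heval_bound g).
apply: (le_trans (n1M _ _)); rewrite mulrCA.
by rewrite ler_pM ?n1_ge0.
Qed.

(** One Lipschitz constant is valid at all grid points, so a single mesh size can serve for all of
    them. *)
Lemma heval_const M g g' cs : (heval M g cs).2 = (heval M g' cs).2.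
Proof. by elim: cs => //= c cs ->. Qed.
End Approximation.

(** * The closeness certificate *)

Section ApproximationTest.

Definition coefs k := map rat_of_nat (dec (nth 0%N (dec k) 0)).
Definition boxend i k := rat_of_nat (nth 0%N (dec k) i).
Definition boxbound k :=
  `|boxend 1 k| + `|boxend 2 k| + (`|boxend 3 k| + `|boxend 4 k|).
(** The diameter of a grid cell in [n1]. The box is cut into [N.+1] intervals in each direction, so
    the grid indices run through [iota 0 N.+2]. *)
Definition mesh k (N : nat) : rat :=
  ((boxend 2 k - boxend 1 k) + (boxend 4 k - boxend 3 k)) / (N.+1)%:R.
Definition gridpt k (N i j : nat) : gauss := Complex
  (boxend 1 k + (boxend 2 k - boxend 1 k) / (N.+1)%:R * i%:R)
  (boxend 3 k + (boxend 4 k - boxend 3 k) / (N.+1)%:R * j%:R).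
Definition hgrid k N i j := heval (boxbound k) (gridpt k N i j) (coefs k).

(* Certifies that every root in the box of [k] is [2 d]-close to [q]: at each
   grid point [g] either [|p(g)|] is too large for a root to lie within one mesh
   of [g], or [g] is [d]-close to [q]. *)
Definition approx (k : nat) (q : gauss) (d : rat) (N : nat) : bool :=
  (mesh k N <= d) &&
  all (fun i => all (fun j =>
    ((hgrid k N i j).2.2 * mesh k N < n1 (hgrid k N i j).1) ||
    (n1 (gridpt k N i j - q) <= d)) (iota 0 N.+2)) (iota 0 N.+2).

#[global] Instance comp_rat_of_nat : Comp1 rat_of_nat := computable_decode (d := rat_of_nat).

#[global] Instance comp_n1 : Comp1 (@n1 rat).
Proof. by rewrite /n1; comp_auto. Qed.

#[global] Instance comp_hgrid : Comp4 hgrid.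
Proof.
by rewrite /hgrid /heval /hstep /gridpt /boxbound /coefs /boxend; comp_auto.
Qed.

#[global] Instance comp_approx : Comp4 approx.
Proof.
by rewrite /approx /gridpt /mesh /boxend; comp_auto.
Qed.
End ApproximationTest.


Lemma mem_iota0 i n : (i \in iota 0 n) = (i < n)%N.
Proof. by rewrite mem_iota /= add0n. Qed.

(** * Soundness and completeness of the certificate *)

Section ApproximationCorrect.
Variable R : realType.
Local Notation C := (R[i]).

Lemma ratrC (q : rat) : ratr q = (ratr q)%:C%C :> C.
Proof. by rewrite (fmorph_rat (real_complex R)). Qed.

Lemma in_boxE k (z : C) : in_box k z <->
  (ratr (boxend 1 k) <= Re z <= ratr (boxend 2 k)) /\
  (ratr (boxend 3 k) <= Im z <= ratr (boxend 4 k)).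
Proof. by rewrite /in_box -complexRe -complexIm !ratrC !lecR. Qed.

Lemma ex_natr_gt (x : R) : exists N : nat, x < N%:R.
Proof.
by exists (Num.truncn x).+1; apply: truncnS_gt.
Qed.

Lemma grid_near (a b x : R) (N : nat) : a <= x <= b ->
  exists2 i, (i < N.+2)%N & `|x - (a + (b - a) / N.+1%:R * i%:R)| <= (b - a) / N.+1%:R.
Proof.
case/andP=> ax xb; set h := (b - a) / _.
have N0 : (0 : R) < N.+1%:R by rewrite ltr0n.
have ab : a <= b by apply: le_trans xb.
have h0 : 0 <= h by rewrite divr_ge0 ?subr_ge0 // ltW.
have hE : h * N.+1%:R = b - a by rewrite /h divfK // gt_eqF.
(* The box may degenerate to a segment or a point. *)
have [hz|hn] := eqVneq h 0.
  exists 0%N => //; rewrite hz mulr0n mul0r addr0.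
  by move: hE; rewrite hz mul0r => hE; rewrite ger0_norm; lra.
have hp : 0 < h by rewrite lt_neqAle eq_sym hn.
have /Num.Theory.truncn_itv : 0 <= (x - a) / h by rewrite divr_ge0 ?subr_ge0.
set i := Num.truncn _ => /andP[ix xi]; exists i.
  rewrite ltnS -(ler_nat R); apply: le_trans ix _.
  by rewrite ler_pdivrMr // mulrC hE lerB.
move: ix xi; rewrite ler_pdivlMr // ltr_pdivrMr // -natr1 => ix xi.
by rewrite ger0_norm; lra.
Qed.

Lemma mesh_ge0 k N (z : C) : in_box k z -> 0 <= (ratr (mesh k N) : R).
Proof.
move/in_boxE => [/andP[h1 h2] /andP[h3 h4]].
rewrite /mesh fmorph_div /= ratr_nat rmorphD /= !rmorphB divr_ge0 //.
by rewrite addr_ge0 // subr_ge0 ?(le_trans h1) ?(le_trans h3).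
Qed.

Lemma box_n1 k (z : C) : in_box k z -> n1 z <= ratr (boxbound k).
Proof.
move/in_boxE => [/andP[h1 h2] /andP[h3 h4]].
rewrite /boxbound !rmorphD /= !ratr_norm /n1.
have K (a b x : R) : a <= x -> x <= b -> `|x| <= `|a| + `|b|.
  move=> ax xb; rewrite ler_norml; apply/andP; split.
    by have := ler_norm (- a); have := normr_ge0 b; rewrite normrN; lra.
  by have := ler_norm b; have := normr_ge0 a; lra.
by apply: lerD; apply: K.
Qed.

Lemma ratr_grid (a b : rat) (n i : nat) :
  ratr (a + (b - a) / n%:R * i%:R) = ratr a + (ratr b - ratr a) / n%:R * i%:R :> R.
Proof. by rewrite rmorphD /= rmorphM /= fmorph_div /= rmorphB /= !ratr_nat. Qed.

Lemma ratr_gridh (a b : rat) (n : nat) :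
  ratr ((b - a) / n%:R) = (ratr b - ratr a) / n%:R :> R.
Proof. by rewrite fmorph_div /= rmorphB /= ratr_nat. Qed.

Lemma gridpt_in_box k N i j (z : C) : in_box k z ->
  (i < N.+2)%N -> (j < N.+2)%N -> in_box k (gC R (gridpt k N i j)).
Proof.
move/in_boxE => [/andP[h1 h2] /andP[h3 h4]] iN jN; apply/in_boxE => /=.
have K (a b : R) l : a <= b -> (l < N.+2)%N -> a <= a + (b - a) / N.+1%:R * l%:R <= b.
  move=> ab lN; rewrite lerDl mulr_ge0 ?divr_ge0 ?subr_ge0 //=.
  rewrite -lerBrDl -mulrA [_ * l%:R]mulrC ler_piMr ?subr_ge0 //.
  by rewrite ler_pdivrMr ?ltr0n // mul1r ler_nat.
rewrite !ratr_grid.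
by split; apply: K; rewrite // ?(le_trans h1) ?(le_trans h3).
Qed.

Lemma boxbound_ge0 k : 0 <= boxbound k.
Proof. by rewrite !addr_ge0. Qed.

Lemma heval_ge0 M g cs : 0 <= M ->
  0 <= (heval M g cs).2.1 /\ 0 <= (heval M g cs).2.2.
Proof.
move=> M0; elim: cs => //= c cs [h1 h2].
by split; rewrite addr_ge0 // mulr_ge0.
Qed.

(** Some grid point g is within one mesh of the root, so |p(g)| is at most the Lipschitz constant
    times the mesh. This excludes the first alternative at g; the second one and the mesh contribute
    [d] each. *)
Lemma approx_sound k (z : C) q d N : dec_alg k z -> approx k q d N ->
  n1 (z - gC R q) <= 2 * ratr d.
Proof.
move=> [_ [zr [zb _]]] /andP[md /allP H].
have zb' := zb; move/in_boxE: zb' => [hx hy].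
have [i iN hi] := grid_near N hx; have [j jN hj] := grid_near N hy.
have /allP Hi := H i (etrans (mem_iota0 _ _) iN).
have := Hi j (etrans (mem_iota0 _ _) jN); set g := gridpt k N i j.
have zg : n1 (z - gC R g) <= ratr (mesh k N).
  rewrite /mesh mulrDl rmorphD /n1.
  have -> : Re (z - gC R g) = Re z - ratr (Re g) by case: (z).
  have -> : Im (z - gC R g) = Im z - ratr (Im g) by case: (z).
  by apply: lerD; rewrite /g /= ratr_grid ratr_gridh.
rewrite ltNge => /orP[/negP[]|gq].
  rewrite -(ler_rat R) -n1_gC heval_value rmorphM /=.
  have -> : (ratpoly R (coefs k)).[gC R g] =
      - ((ratpoly R (coefs k)).[z] - (ratpoly R (coefs k)).[gC R g]).
    by move/rootP: zr; rewrite /ratpoly /coefs => ->; rewrite sub0r opprK.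
  rewrite n1N; apply: le_trans (heval_lipschitz g _ _ _) _.
  - exact: box_n1 zb.
  - by apply: box_n1; apply: gridpt_in_box zb _ _.
  rewrite mulrC ler_wpM2l // ler0q.
  by have [] := heval_ge0 g (coefs k) (boxbound_ge0 k).
rewrite -(subrKA (gC R g)) mulr_natl mulr2n; apply: le_trans (n1D _ _) _.
apply: lerD; first by apply: le_trans zg _; rewrite ler_rat.
by rewrite -gCB n1_gC ler_rat.
Qed.

(* Away from the unique root of the box, all factors of the polynomial are
   bounded below on the box. *)
Lemma prod_roots_bound k (z : C) (e : R) (rs : seq C) : 0 < e ->
  (forall r, r \in rs -> r = z \/ ~ in_box k r) ->
  exists2 mu : R, 0 < mu & forall g : C, in_box k g -> e < n1 (g - z) ->
    mu <= Normc.normc (\prod_(r <- rs) (g - r)).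
Proof.
move=> e0; elim: rs => [|r rs IH] H.
  by exists 1 => // g _ _; rewrite big_nil Normc.normc1.
have [|mu mu0 Hmu] := IH; first by move=> s sr; apply: H; rewrite inE sr orbT.
have [nu nu0 Hnu] : exists2 nu : R, 0 < nu & forall g : C, in_box k g ->
    e < n1 (g - z) -> nu <= Normc.normc (g - r).
  have [->|rb] := H r (mem_head _ _).
    exists (e / 2); first by rewrite divr_gt0.
    by move=> g _ ge; have := n1_le_normc (g - z); lra.
  have n1c (g : C) : n1 (g - r) / 2 <= Normc.normc (g - r).
    by have := n1_le_normc (g - r); lra.
  have n1E (g : C) : n1 (g - r) = `|Re g - Re r| + `|Im g - Im r|.
    by case: (g); case: (r).
  set b1 := ratr (boxend 1 k) : R; set b2 := ratr (boxend 2 k) : R.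
  set b3 := ratr (boxend 3 k) : R; set b4 := ratr (boxend 4 k) : R.
  (* A point outside a closed box lies strictly beyond one of its sides, and the gap bounds its
     distance from all points of the box. *)
  have : [\/ Re r < b1, b2 < Re r | Im r < b3 \/ b4 < Im r].
    have [|h1] := ltP (Re r) b1; first by constructor 1.
    have [|h2] := ltP b2 (Re r); first by constructor 2.
    have [|h3] := ltP (Im r) b3; first by constructor 3; left.
    have [|h4] := ltP b4 (Im r); first by constructor 3; right.
    by case: rb; apply/in_boxE; rewrite h1 h2 h3 h4.
  have K (x : R) : 0 < x -> (forall g : C, in_box k g -> x <= n1 (g - r)) ->
      exists2 nu : R, 0 < nu & forall g : C, in_box k g ->
      e < n1 (g - z) -> nu <= Normc.normc (g - r).
    move=> x0 Hx; exists (x / 2); first by rewrite divr_gt0.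
    by move=> g /Hx h _; have := n1c g; lra.
  case=> [h|h|[h|h]].
  - apply: (K (b1 - Re r)); first by lra.
    move=> g /in_boxE[/andP[g1 g2] /andP[g3 g4]]; rewrite n1E.
    have := ler_norm (Re g - Re r); have := normr_ge0 (Im g - Im r).
    by rewrite -/b1 in g1; lra.
  - apply: (K (Re r - b2)); first by lra.
    move=> g /in_boxE[/andP[g1 g2] /andP[g3 g4]]; rewrite n1E (distrC (Re g)).
    have := ler_norm (Re r - Re g); have := normr_ge0 (Im g - Im r).
    by rewrite -/b2 in g2; lra.
  - apply: (K (b3 - Im r)); first by lra.
    move=> g /in_boxE[/andP[g1 g2] /andP[g3 g4]]; rewrite n1E.
    have := ler_norm (Im g - Im r); have := normr_ge0 (Re g - Re r).
    by rewrite -/b3 in g3; lra.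
  - apply: (K (Im r - b4)); first by lra.
    move=> g /in_boxE[/andP[g1 g2] /andP[g3 g4]]; rewrite n1E (distrC (Im g)).
    have := ler_norm (Im r - Im g); have := normr_ge0 (Re g - Re r).
    by rewrite -/b4 in g4; lra.
exists (mu * nu); first by rewrite mulr_gt0.
move=> g gb ge; rewrite big_cons Normc.normcM mulrC.
by apply: ler_pM; [exact: ltW | exact: ltW | exact: Hnu | exact: Hmu].
Qed.

(** At grid points farther than [d / 2] from [z], |p| is bounded below and a fine mesh gives the
    first alternative; the other grid points are within [d / 2 + d / 2] of [q]. Since all large [N]
    work, finitely many entries can share one. *)
Lemma approx_complete k (z : C) q (d : rat) : dec_alg k z -> 0 < d ->
  n1 (z - gC R q) <= ratr d / 2 ->
  exists N0, forall N, (N0 <= N)%N -> approx k q d N.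
Proof.
move=> [p0 [zr [zb zu]]] d0 zq.
set p := map_poly ratr _ in zr zu.
have pn0 : p != 0 by rewrite map_poly_eq0.
have [rs prs] := closed_field_poly_normal p.
have lc0 : lead_coef p != 0 by rewrite lead_coef_eq0.
have d2 : 0 < (ratr d : R) / 2 by rewrite divr_gt0 // ltr0q.
have [|mu mu0 Hmu] := prod_roots_bound (k := k) (z := z) (rs := rs) d2.
  move=> r rrs; have [rb|] := pselect (in_box k r); last by right.
  left; apply: zu => //; rewrite prs rootZ // root_prod_XsubC //.
pose nu := Normc.normc (lead_coef p) * mu.
have nu0 : 0 < nu.
  rewrite mulr_gt0 // lt_neqAle eq_sym; apply/andP; split.
    by apply: contra lc0 => /eqP/Normc.eq0_normc ->.
  by case: (lead_coef p) => a b /=; apply: sqrtr_ge0.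
have Hnu (g : C) : in_box k g -> ratr d / 2 < n1 (g - z) -> nu <= n1 p.[g].
  move=> gb ge; apply: le_trans (normc_le_n1 _).
  rewrite prs hornerZ Normc.normcM ler_wpM2l //.
    by case: (lead_coef p) => a b /=; apply: sqrtr_ge0.
  rewrite horner_prod; under eq_bigr do rewrite hornerXsubC.
  exact: Hmu.
pose L : R := ratr (heval (boxbound k) 0 (coefs k)).2.2.
pose W : R := ratr ((boxend 2 k - boxend 1 k) + (boxend 4 k - boxend 3 k)).
have dR : 0 < (ratr d : R) by rewrite ltr0q.
(* [N1] makes the mesh at most [d]; [N2] makes the Lipschitz constant times the mesh smaller than
   the lower bound [nu]. *)
have [N1 HN1] := ex_natr_gt (W / ratr d).
have [N2 HN2] := ex_natr_gt (L * W / nu).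
have meshE N : ratr (mesh k N) = W / N.+1%:R :> R.
  by rewrite /mesh fmorph_div /= ratr_nat.
exists (maxn N1 N2) => N; rewrite geq_max => /andP[le1 le2].
have N0 : (0 : R) < N.+1%:R by rewrite ltr0n.
apply/andP; split.
  rewrite -(ler_rat R) meshE ler_pdivrMr // mulrC -ler_pdivrMr //.
  apply: ltW; apply: lt_le_trans HN1 _; rewrite ler_nat; exact: leqW.
apply/allP => i; rewrite mem_iota0 => iN.
apply/allP => j; rewrite mem_iota0 => jN; set g := gridpt k N i j.
have gb : in_box k (gC R g) by apply: gridpt_in_box zb _ _.
have [gz|gz] := leP (n1 (gC R g - z)) (ratr d / 2); apply/orP; [right|left].
  rewrite -(ler_rat R) -n1_gC gCB -(subrKA z); apply: le_trans (n1D _ _) _.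
  lra.
rewrite -(ltr_rat R) -n1_gC heval_value rmorphM /= meshE.
rewrite /hgrid (heval_const _ _ 0) -/L; apply: lt_le_trans (Hnu _ gb gz).
rewrite mulrA ltr_pdivrMr // -ltr_pdivrMl // mulrC.
by apply: lt_le_trans HN2 _; rewrite ler_nat; exact: leqW.
Qed.
End ApproximationCorrect.


#[global] Instance rep_complex (R : realType) : Rep R[i] := @dec_alg R.

(** Makes [scaleC] total, with a positive radicand for every argument. *)
Definition posq (N : rat) : rat := if 0 < N then N else 1.

Lemma posq_gt0 N : 0 < posq N. Proof. by rewrite /posq; case: ifP. Qed.

(* [(a + b i) / sqrt N] is a root of [X^4 - 2 A X^2 + A^2 + B^2], where [A + B i]
   is its square; the four roots lie in different closed quadrants, up to the
   coincidences on the axes. *)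
Definition sqA (z : gauss) N := (Re z * Re z - Im z * Im z) / posq N.
Definition sqB (z : gauss) N := (Re z * Im z + Re z * Im z) / posq N.
(** A rational bound for both parts of the number named, as |t| <= 1 + t^2. *)
Definition sqM (z : gauss) N := 1 + (Re z * Re z + Im z * Im z) / posq N.
Definition sqrt_name (z : gauss) (N : rat) :=
  ([:: sqA z N * sqA z N + sqB z N * sqB z N; 0; - (sqA z N + sqA z N); 0; 1],
   (if 0 <= Re z then 0 else - sqM z N, (if 0 <= Re z then sqM z N else 0,
   (if 0 <= Im z then 0 else - sqM z N, (if 0 <= Im z then sqM z N else 0, 0%N))))).

#[global] Instance comp_sqrt_name : Comp2 sqrt_name.
Proof. by rewrite /sqrt_name /sqA /sqB /sqM /posq; comp_auto. Qed.

(** * Names of Gaussian rationals divided by square roots *)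

Section AlgebraicNames.
Variable R : realType.
Local Notation C := (R[i]).

Definition scaleC (z : gauss) (N : rat) : C :=
  gC R z / (Num.sqrt (ratr (posq N)))%:C%C.

Lemma poly_of_rep c cs : @rep _ (@rep_seq _ rep_rat) c cs -> poly_of_nat c = Poly cs.
Proof.
rewrite /poly_of_nat => H; congr Poly.
by elim: H => //= x q s t <- _ ->.
Qed.

Lemma quartic_root (x0 y0 : R) (A B : rat) (w : C) :
  ratr A = x0 ^+ 2 - y0 ^+ 2 -> ratr B = 2 * x0 * y0 ->
  (ratpoly R [:: A * A + B * B; 0; - (A + A); 0; 1]).[w] =
  (w - Complex x0 y0) * (w + Complex x0 y0) *
  ((w - Complex x0 (- y0)) * (w + Complex x0 (- y0))).
Proof.
move=> hA hB; rewrite !ratpoly_cons ratpoly_nil !ratrC.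
have -> : ratr (A * A + B * B) =
    (x0 ^+ 2 - y0 ^+ 2) * (x0 ^+ 2 - y0 ^+ 2) + 2 * x0 * y0 * (2 * x0 * y0) :> R.
  by rewrite -hA -hB -!rmorphM -rmorphD.
have -> : ratr (- (A + A)) = - (x0 ^+ 2 - y0 ^+ 2 + (x0 ^+ 2 - y0 ^+ 2)) :> R.
  by rewrite -hA -rmorphD -rmorphN.
rewrite (rmorph0 (ratr : {rmorphism rat -> R})) (rmorph1 (ratr : {rmorphism rat -> R})).
by case: w => x y; apply/eqP; rewrite eq_complex /=; apply/andP; split; apply/eqP; ring.
Qed.

#[global] Instance comp_scaleC : Comp2 scaleC.
Proof.
have [f Hf fE] := comp_sqrt_name; exists f => // c [z N] cz.
have {fE} := fE c (z, N) cz; move: (f c) => {c cz f Hf} k /= [].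
rewrite /= => kp [k1 [k2 [k3 [k4 _]]]].
set A := sqA z N in kp; set B := sqB z N in kp.
set M := sqM z N in k1 k2 k3 k4.
have N0 := posq_gt0 N; set s := Num.sqrt (ratr (posq N) : R).
have s0 : 0 < s by rewrite sqrtr_gt0 ltr0q.
have s2 : s ^+ 2 = ratr (posq N) by rewrite sqr_sqrtr // ler0q ltW.
have sn0 : s != 0 by rewrite gt_eqF.
set x0 := ratr (Re z) / s; set y0 := ratr (Im z) / s.
have zE : scaleC z N = Complex x0 y0.
  apply/(mulIf (x := s%:C%C)); first by rewrite eq_complex /= negb_and sn0.
  rewrite /scaleC -/s divfK; last by rewrite eq_complex /= negb_and sn0.
  by apply/eqP; rewrite eq_complex /= !mulr0 subr0 add0r !divfK // !eqxx.
have hA : ratr A = x0 ^+ 2 - y0 ^+ 2.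
  rewrite /A /sqA fmorph_div /= rmorphB /= !rmorphM /= -s2 /x0 /y0; field.
  exact: sn0.
have hB : ratr B = 2 * x0 * y0.
  rewrite /B /sqB fmorph_div /= rmorphD /= !rmorphM /= -s2 /x0 /y0; field.
  exact: sn0.
have hM : ratr M = 1 + x0 ^+ 2 + y0 ^+ 2.
  rewrite /M /sqM rmorphD /= fmorph_div /= rmorphD /= !rmorphM /= -s2 rmorph1 /x0 /y0; field.
  exact: sn0.
have sgx : (0 <= x0) = (0 <= Re z) by rewrite /x0 pmulr_lge0 ?invr_gt0 // ler0q.
have sgy : (0 <= y0) = (0 <= Im z) by rewrite /y0 pmulr_lge0 ?invr_gt0 // ler0q.
have box w : in_box k w <->
    (if 0 <= x0 then 0 <= Re w <= 1 + x0 ^+ 2 + y0 ^+ 2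
     else - (1 + x0 ^+ 2 + y0 ^+ 2) <= Re w <= 0) /\
    (if 0 <= y0 then 0 <= Im w <= 1 + x0 ^+ 2 + y0 ^+ 2
     else - (1 + x0 ^+ 2 + y0 ^+ 2) <= Im w <= 0).
  rewrite in_boxE /boxend !nth_dec /= {}k1 {}k2 {}k3 {}k4 -sgx -sgy.
  by do 2 case: ifP => _; rewrite ?rmorphN /= ?hM rmorph0.
rewrite /rep /rep_complex /dec_alg nth_dec /= (poly_of_rep kp) -/(ratpoly R _) zE.
split; [|split; [|split]].
- apply/eqP => /(congr1 (fun p : {poly rat} => p`_4)); rewrite coef_Poly coef0 /=.
  by move/eqP; rewrite oner_eq0.
- by rewrite /root (quartic_root _ hA hB) subrr !mul0r.
- apply/box => /=; split.
    case: (leP 0 x0) => hx; nra.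
  case: (leP 0 y0) => hy; nra.
- move=> w /eqP; rewrite (quartic_root _ hA hB) => /eqP wr /box [hx hy].
  (* The box lies in a closed quadrant containing the first of these roots; another one lies there
     only if it coincides with the first. *)
  have : [\/ w = Complex x0 y0, w = Complex (- x0) (- y0),
             w = Complex x0 (- y0) | w = Complex (- x0) y0].
    move: wr; rewrite !mulf_eq0 !subr_eq0 !addr_eq0 => /orP[]/orP[]/eqP ->.
    - by constructor 1. - by constructor 2.
    - by constructor 3. - by constructor 4; apply/eqP; rewrite eq_complex /= opprK !eqxx.
  case=> E; move: hx hy; rewrite E /=;
    case: (leP 0 x0) => hx; case: (leP 0 y0) => hy hx' hy';
    by apply/eqP; rewrite eq_complex /=; apply/andP; split; apply/eqP; lra.
Qed.
End AlgebraicNames.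


(** * Orthogonal families and projections *)

Local Notation hermitian := Defs.hermitian.
Local Notation orthonormal := Defs.orthonormal.

Section Orthogonal.
Variable R : realType.
Local Notation C := (R[i]).
Variable D : nat.
Implicit Types (u v w : 'cV[C]_D) (A B S : 'M[C]_D).

Lemma conjCE (z : C) : Num.conj z = z^*%C.
Proof. by []. Qed.

Lemma ctransM m n p (A : 'M[C]_(m, n)) (B : 'M[C]_(n, p)) :
  ctrans (A *m B) = ctrans B *m ctrans A.
Proof. by rewrite /ctrans map_mxM trmx_mul. Qed.

Lemma ctransK m n (A : 'M[C]_(m, n)) : ctrans (ctrans A) = A.
Proof. by apply/matrixP => i j; rewrite !mxE conjCK. Qed.

Lemma ctransD m n (A B : 'M[C]_(m, n)) : ctrans (A + B) = ctrans A + ctrans B.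
Proof. by rewrite /ctrans map_mxD linearD. Qed.

Lemma ctransB m n (A B : 'M[C]_(m, n)) : ctrans (A - B) = ctrans A - ctrans B.
Proof. by rewrite /ctrans map_mxB linearB. Qed.

Lemma ctransZ m n a (A : 'M[C]_(m, n)) : ctrans (a *: A) = Num.conj a *: ctrans A.
Proof. by rewrite /ctrans map_mxZ linearZ. Qed.

Lemma cdotE u v : cdot u v = \sum_i Num.conj (u i 0) * v i 0.
Proof. by rewrite /cdot mxE; apply: eq_bigr => i _; rewrite !mxE. Qed.

Lemma cdot_mx u v : ctrans u *m v = (cdot u v)%:M.
Proof. by rewrite /cdot -mx11_scalar. Qed.

Lemma cdot_conj u v : Num.conj (cdot u v) = cdot v u.
Proof.
rewrite !cdotE rmorph_sum; apply: eq_bigr => i _.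
by rewrite rmorphM /= conjCK mulrC.
Qed.

Lemma cdotDr u v w : cdot u (v + w) = cdot u v + cdot u w.
Proof. by rewrite /cdot mulmxDr mxE. Qed.
Lemma cdotBr u v w : cdot u (v - w) = cdot u v - cdot u w.
Proof. by rewrite /cdot mulmxBr !mxE. Qed.
Lemma cdotZr a u v : cdot u (a *: v) = a * cdot u v.
Proof. by rewrite /cdot -scalemxAr mxE. Qed.
Lemma cdot_sumr (I : Type) (r : seq I) (F : I -> 'cV[C]_D) u :
  cdot u (\sum_(i <- r) F i) = \sum_(i <- r) cdot u (F i).
Proof. by rewrite /cdot mulmx_sumr summxE. Qed.
Lemma cdotBl u v w : cdot (u - v) w = cdot u w - cdot v w.
Proof. by rewrite -cdot_conj cdotBr rmorphB /= !cdot_conj. Qed.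
Lemma cdotZl a u v : cdot (a *: u) v = Num.conj a * cdot u v.
Proof. by rewrite -cdot_conj cdotZr rmorphM /= cdot_conj. Qed.

Lemma cdot_ge0 u : 0 <= cdot u u.
Proof. by rewrite cdotE sumr_ge0 // => i _; rewrite mulrC mul_conjC_ge0. Qed.

Lemma cdot_eq0 u : (cdot u u == 0) = (u == 0).
Proof.
apply/idP/eqP => [|->]; last first.
  by rewrite cdotE big1 // => i _; rewrite !mxE mulr0.
rewrite cdotE psumr_eq0 => [/allP H|i _]; last by rewrite mulrC mul_conjC_ge0.
apply/matrixP => i j; rewrite ord1 [RHS]mxE.
by have /eqP := H i (mem_index_enum _); rewrite mulrC => /eqP; rewrite mul_conjC_eq0 => /eqP.
Qed.

(** Dividing by the squared norm, without normalising [w], keeps the projection within the field of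
    Gaussian rationals. *)
Definition proj1 w : 'M[C]_D := (cdot w w)^-1 *: (w *m ctrans w).
Definition proj (fs : seq 'cV[C]_D) : 'M[C]_D := \sum_(w <- fs) proj1 w.
Definition orthogonal_family (fs : seq 'cV[C]_D) :=
  all (fun w => w != 0) fs && pairwise (fun u v => cdot u v == 0) fs.

Lemma proj1_herm w : hermitian (proj1 w).
Proof.
by rewrite /hermitian /proj1 ctransZ ctransM ctransK fmorphV /= cdot_conj.
Qed.

Lemma proj1_same w : w != 0 -> proj1 w *m w = w.
Proof.
move=> w0; rewrite /proj1 -scalemxAl -mulmxA cdot_mx mul_mx_scalar scalerA.
by rewrite mulVf ?cdot_eq0 // scale1r.
Qed.

Lemma proj1_other u v : cdot u v = 0 -> proj1 u *m v = 0.
Proof.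
move=> uv; rewrite /proj1 -scalemxAl -mulmxA cdot_mx uv.
by rewrite mul_mx_scalar scale0r scaler0.
Qed.

Lemma proj1_idem w : w != 0 -> proj1 w *m proj1 w = proj1 w.
Proof. by move=> w0; rewrite {2}/proj1 -scalemxAr mulmxA proj1_same. Qed.

Lemma proj1_orth u v : cdot u v = 0 -> proj1 u *m proj1 v = 0.
Proof.
by move=> uv; rewrite {2}/proj1 -scalemxAr mulmxA proj1_other // mul0mx scaler0.
Qed.

Lemma tr_proj1 w : w != 0 -> \tr (proj1 w) = 1.
Proof.
by move=> w0; rewrite mxtraceZ mxtrace_mulC cdot_mx mxtrace_scalar mulr1n mulVf ?cdot_eq0.
Qed.

Lemma tr_mul_proj1 A w : \tr (A *m proj1 w) = (cdot w w)^-1 * qform w A.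
Proof.
rewrite /proj1 -scalemxAr mxtraceZ mulmxA mxtrace_mulC /qform mulmxA.
by rewrite [X in \tr X]mx11_scalar mxtrace_scalar mulr1n.
Qed.

Lemma proj_herm fs : hermitian (proj fs).
Proof.
rewrite /hermitian /proj; elim: fs => [|w fs IH].
  by rewrite big_nil; apply/matrixP => i j; rewrite !mxE rmorph0.
by rewrite big_cons ctransD IH (proj1_herm w).
Qed.

Lemma proj_idem fs : orthogonal_family fs -> proj fs *m proj fs = proj fs.
Proof.
rewrite /proj; elim: fs => [|w fs IH]; first by rewrite big_nil mulmx0.
rewrite /orthogonal_family /= => /andP[/andP[w0 fs0] /andP[wfs pw]].
rewrite big_cons mulmxDl !mulmxDr proj1_idem // IH ?/orthogonal_family ?fs0 //.
have -> : proj1 w *m \sum_(v <- fs) proj1 v = 0.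
  rewrite mulmx_sumr big_seq big1 // => v vfs; apply: proj1_orth.
  by move/allP: wfs => /(_ v vfs) /eqP.
have -> : (\sum_(v <- fs) proj1 v) *m proj1 w = 0.
  rewrite mulmx_suml big_seq big1 // => v vfs; apply: proj1_orth.
  by move/allP: wfs => /(_ v vfs) /eqP wv; rewrite -cdot_conj wv rmorph0.
by rewrite addr0 add0r.
Qed.

Lemma proj_mem fs v : orthogonal_family fs -> v \in fs -> proj fs *m v = v.
Proof.
rewrite /proj; elim: fs => // w fs IH.
rewrite /orthogonal_family /= => /andP[/andP[w0 fs0] /andP[/allP wfs pw]].
rewrite big_cons mulmxDl inE => /orP[/eqP ->|vfs].
  rewrite proj1_same // mulmx_suml big_seq big1 ?addr0 // => u ufs.
  apply: proj1_other; move: (wfs u ufs) => /eqP wu.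
  by rewrite -cdot_conj wu rmorph0.
rewrite IH ?/orthogonal_family ?fs0 // proj1_other ?add0r //.
exact/eqP/wfs.
Qed.

Lemma tr_proj fs : all (fun w => w != 0) fs -> \tr (proj fs) = (size fs)%:R.
Proof.
rewrite /proj; elim: fs => [|w fs IH] /=; first by rewrite big_nil mxtrace0.
by case/andP=> w0 fs0; rewrite big_cons mxtraceD tr_proj1 // IH // mulrS.
Qed.

Lemma tr_mul_proj A fs :
  \tr (A *m proj fs) = \sum_(w <- fs) (cdot w w)^-1 * qform w A.
Proof.
rewrite /proj mulmx_sumr raddf_sum /=; apply: eq_bigr => w _; exact: tr_mul_proj1.
Qed.

(** Induction on the rank: a nonzero column [u] of [S] is fixed by [S], and [S - proj1 u] is a
    projection of smaller rank that annihilates [u]. *)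
Lemma projection_basis S : hermitian S -> S *m S = S ->
  exists2 fs, orthogonal_family fs & S = proj fs.
Proof.
have [n] := ubnP (\rank S); elim: n S => // n IH S; rewrite ltnS => rS hS iS.
have [->|S0] := eqVneq S 0; first by exists [::]; rewrite ?/proj ?big_nil.
have [j uj] : exists j, col j S != 0.
  apply/existsP; apply: contraNT S0; rewrite negb_exists => /forallP H.
  apply/eqP/matrixP => i j; have /eqP/matrixP/(_ i 0) := negPn (H j).
  by rewrite !mxE.
set u := col j S in uj; have Su : S *m u = u by rewrite /u colE mulmxA iS.
have uS : ctrans u *m S = ctrans u by rewrite -[in LHS]hS -ctransM Su.
have SE : S *m proj1 u = proj1 u by rewrite /proj1 -scalemxAr mulmxA Su.
have ES : proj1 u *m S = proj1 u by rewrite /proj1 -scalemxAl -mulmxA uS.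
pose S' := S - proj1 u.
have hS' : hermitian S' by rewrite /hermitian ctransB hS (proj1_herm u).
have iS' : S' *m S' = S'.
  by rewrite /S' mulmxBl !mulmxBr iS SE ES proj1_idem // subrr subr0.
have S'u : S' *m u = 0.
  by rewrite mulmxBl Su proj1_same // subrr.
have uS' : ctrans u *m S' = 0.
  by rewrite -[S']hS' -ctransM S'u; apply/matrixP => i k; rewrite !mxE rmorph0.
have rS' : (\rank S' < \rank S)%N.
  have sub : (S' <= S)%MS.
    by apply/submxP; exists S'; rewrite /S' mulmxBl iS ES.
  (* Equal ranks would give [S = X *m S']; inserting this between [ctrans u] and [u] yields
     [cdot u u = 0]. *)
  rewrite ltn_neqAle mxrankS // andbT; apply/negP => /eqP rE.
  have : (S <= S')%MS by rewrite -(geq_leqif (mxrank_leqif_sup sub)) rE.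
  case/submxP=> X SX; move: uj.
  by rewrite -cdot_eq0 /cdot -uS SX -!mulmxA S'u !mulmx0 mxE eqxx.
have [fs ofs S'E] := IH S' (leq_trans rS' rS) hS' iS'.
exists (u :: fs); last by rewrite /proj big_cons -/(proj fs) -S'E /S' addrC subrK.
case/andP: ofs => fs0 pfs; rewrite /orthogonal_family /= uj fs0 pfs !andbT /=.
apply/allP => v vfs; have ofs : orthogonal_family fs by rewrite /orthogonal_family fs0.
by rewrite /cdot -(proj_mem ofs vfs) -S'E mulmxA uS' mul0mx mxE.
Qed.
End Orthogonal.


(** * Gaussian rational frames *)

Import numFieldNormedType.Exports.

(** * Limits of complex sequences, part by part *)

Section Limits.
Variable R : realType.
Local Notation C := (R[i]).
Local Open Scope classical_set_scope.

Definition tends (u : nat -> C) (l : C) :=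
  ((fun t => Re (u t)) @ \oo --> Re l) /\ ((fun t => Im (u t)) @ \oo --> Im l).

Lemma eq_tends u v l : u =1 v -> tends u l -> tends v l.
Proof. by move=> /funext ->. Qed.

Lemma tends_parts u l (a b : nat -> R) (a' b' : R) :
  (forall t, Re (u t) = a t) -> (forall t, Im (u t) = b t) ->
  Re l = a' -> Im l = b' -> a @ \oo --> a' -> b @ \oo --> b' -> tends u l.
Proof. by move=> /funext ua /funext ub <- <-; rewrite -ua -ub. Qed.

Lemma tends_cst l : tends (fun=> l) l.
Proof. by split; apply: cvg_cst. Qed.

Lemma tendsD u v k l : tends u k -> tends v l -> tends (fun t => u t + v t) (k + l).
Proof.
move=> [u1 u2] [v1 v2]; have h (a b : C) : Re (a + b) = Re a + Re b by case: a; case: b.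
have h' (a b : C) : Im (a + b) = Im a + Im b by case: a; case: b.
apply: (tends_parts (fun t => h _ _) (fun t => h' _ _) (h _ _) (h' _ _)).
all: exact: cvgD.
Qed.

Lemma tendsN u l : tends u l -> tends (fun t => - u t) (- l).
Proof.
move=> [u1 u2]; have h (a : C) : Re (- a) = - Re a by case: a.
have h' (a : C) : Im (- a) = - Im a by case: a.
apply: (tends_parts (fun t => h _) (fun t => h' _) (h _) (h' _)).
all: exact: cvgN.
Qed.

Lemma tends_conj u l : tends u l -> tends (fun t => (u t)^*%C) l^*%C.
Proof.
move=> [u1 u2]; have h (a : C) : Re a^*%C = Re a by case: a.
have h' (a : C) : Im a^*%C = - Im a by case: a.
apply: (tends_parts (fun t => h _) (fun t => h' _) (h _) (h' _)).
  exact: u1.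
exact: cvgN.
Qed.

Lemma tendsM u v k l : tends u k -> tends v l -> tends (fun t => u t * v t) (k * l).
Proof.
move=> [u1 u2] [v1 v2].
have h (a b : C) : Re (a * b) = Re a * Re b - Im a * Im b by case: a; case: b.
have h' (a b : C) : Im (a * b) = Re a * Im b + Im a * Re b by case: a; case: b.
apply: (tends_parts (fun t => h _ _) (fun t => h' _ _) (h _ _) (h' _ _)).
  by apply: cvgB; apply: cvgM.
by apply: cvgD; apply: cvgM.
Qed.

Lemma tendsV u l : l != 0 -> tends u l -> tends (fun t => (u t)^-1) l^-1.
Proof.
move=> l0 [u1 u2].
have h (a : C) : Re a^-1 = Re a / (Re a ^+ 2 + Im a ^+ 2) by case: a.
have h' (a : C) : Im a^-1 = - (Im a / (Re a ^+ 2 + Im a ^+ 2)) by case: a.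
have n0 : Re l ^+ 2 + Im l ^+ 2 != 0.
  apply: contra l0; rewrite paddr_eq0 ?sqr_ge0 // !sqrf_eq0 => /andP[/eqP h1 /eqP h2].
  by rewrite eq_complex h1 h2 /= !eqxx.
have K : (fun t => (Re (u t) ^+ 2 + Im (u t) ^+ 2)^-1) @ \oo -->
     (Re l ^+ 2 + Im l ^+ 2)^-1.
  by apply: cvgV => //; apply: cvgD; under eq_fun do rewrite expr2;
    rewrite expr2; apply: cvgM.
apply: (tends_parts (fun t => h _) (fun t => h' _) (h _) (h' _)).
  exact: cvgM.
by apply: cvgN; apply: cvgM.
Qed.

Lemma tends_sum (I : Type) (r : seq I) (u : nat -> I -> C) (l : I -> C) :
  (forall i, tends (u ^~ i) (l i)) ->
  tends (fun t => \sum_(i <- r) u t i) (\sum_(i <- r) l i).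
Proof.
move=> H; elim: r => [|i r IH].
  by rewrite big_nil; apply: (eq_tends (u := fun=> 0)) (tends_cst 0) => t; rewrite big_nil.
rewrite big_cons; apply: (eq_tends (u := fun t => u t i + \sum_(j <- r) u t j)).
  by move=> t; rewrite big_cons.
exact: tendsD.
Qed.

Lemma tends_shift u l T : tends u l -> tends (fun t => u (t + T)%N) l.
Proof. by move=> [u1 u2]; split; [have := u1 | have := u2] => H;
  rewrite -(cvg_shiftn T) in H.
Qed.

Lemma tends_near u l (e : R) : tends u l -> 0 < e ->
  exists T, forall t, (T <= t)%N -> n1 (u t - l) <= e.
Proof.
move=> [u1 u2] e0; have e2 : 0 < e / 2 by rewrite divr_gt0.
have /cvgrPdist_le /(_ _ e2) [T1 _ H1] := u1.
have /cvgrPdist_le /(_ _ e2) [T2 _ H2] := u2.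
exists (maxn T1 T2) => t; rewrite geq_max => /andP[le1 le2].
have := H1 t le1; have := H2 t le2; rewrite /= !(distrC _ (_ (u t))) => h2 h1.
have -> : n1 (u t - l) = `|Re (u t) - Re l| + `|Im (u t) - Im l|.
  by case: (u t); case: (l).
lra.
Qed.

Lemma tends_neq0 u l : tends u l -> l != 0 ->
  exists T, forall t, (T <= t)%N -> u t != 0.
Proof.
move=> ul l0; have l1 : 0 < n1 l.
  rewrite lt_neqAle n1_ge0 andbT eq_sym; apply: contra l0.
  by rewrite paddr_eq0 // !normr_eq0 eq_complex.
have [T HT] := tends_near ul (divr_gt0 l1 (ltr0n _ 2)).
exists T => t /HT; apply: contraTneq => ->; rewrite sub0r n1N.
by rewrite -ltNge; lra.
Qed.

Lemma rat_approx (x : R) : exists q : nat -> rat, (fun t => ratr (q t) : R) @ \oo --> x.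
Proof.
have H (t : nat) : exists q : rat, x - t.+1%:R^-1 < ratr q < x + t.+1%:R^-1.
  have lt : x - t.+1%:R^-1 < x + t.+1%:R^-1.
    have : (0 : R) < t.+1%:R^-1 by rewrite invr_gt0 ltr0n.
    by move: (_^-1) => y; lra.
  by have [q] := rat_in_itvoo lt; rewrite in_itv; exists q.
have [q Hq] := choice H; exists q; apply/cvgrPdist_le => e e0.
have [N HN] := ex_natr_gt e^-1; exists N => // t /= Nt.
have h : (t.+1%:R^-1 : R) <= e.
  rewrite -[leRHS]invrK lef_pV2 ?posrE ?invr_gt0 ?ltr0n //.
  by apply: ltW; apply: lt_le_trans HN _; rewrite ler_nat leqW.
by have := Hq t; move: h; move: (t.+1%:R^-1) => y h; rewrite ler_distl; lra.
Qed.

Lemma gauss_approx (z : C) : exists q : nat -> gauss, tends (fun t => gC R (q t)) z.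
Proof.
have [a Ha] := rat_approx (Re z); have [b Hb] := rat_approx (Im z).
by exists (fun t => Complex (a t) (b t)).
Qed.
End Limits.

(** * Gram-Schmidt over the Gaussian rationals *)

Section GaussianFrames.
Variable R : realType.
Local Notation C := (R[i]).

Section GramSchmidt.
Variable D : nat.

Definition gdot (u v : 'cV[gauss]_D) : gauss := \sum_i (u i 0)^*%C * v i 0.
Local Notation gmx := (map_mx (gC R)).

Lemma gC_gdot u v : gC R (gdot u v) = cdot (gmx u) (gmx v).
Proof.
rewrite /gdot rmorph_sum cdotE /=; apply: eq_bigr => i _.
by rewrite gCM gC_conj !mxE.
Qed.

Lemma tends_cdot (u v : nat -> 'cV[C]_D) (k l : 'cV[C]_D) :
  (forall i, tends (fun t => u t i 0) (k i 0)) ->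
  (forall i, tends (fun t => v t i 0) (l i 0)) ->
  tends (fun t => cdot (u t) (v t)) (cdot k l).
Proof.
move=> Hu Hv; rewrite cdotE.
apply: (eq_tends (u := fun t => \sum_i (u t i 0)^*%C * v t i 0)).
  by move=> t; rewrite cdotE.
by apply: tends_sum => i; apply: tendsM => //; apply: tends_conj.
Qed.

(* Gram-Schmidt without normalisation stays in the field of Gaussian rationals
   and, applied to approximations of an orthogonal family, changes them little. *)
Lemma orthogonal_approx (f : nat -> 'cV[C]_D) r :
  (forall i j, (i < j < r)%N -> cdot (f i) (f j) = 0) ->
  (forall i, (i < r)%N -> f i != 0) ->
  exists W : nat -> nat -> 'cV[gauss]_D,
  [/\ forall t i j, (i < j < r)%N -> cdot (gmx (W t i)) (gmx (W t j)) = 0,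
      forall t i, (i < r)%N -> gmx (W t i) != 0 &
      forall i k, (i < r)%N -> tends (fun t => gC R (W t i k 0)) (f i k 0)].
Proof.
elim: r => [|r IH] fo f0; first by exists (fun _ _ => 0); split => // t i j /andP[].
have [||W [Wo W0 Wt]] := IH.
- by move=> i j /andP[ij jr]; apply: fo; rewrite ij ltnW.
- by move=> i ir; apply: f0; rewrite ltnW.
have [g Hg] : exists g : nat -> 'cV[gauss]_D,
    forall k, tends (fun t => gC R (g t k 0)) (f r k 0).
  have [h Hh] := choice (fun k : 'I_D => gauss_approx (f r k 0)).
  exists (fun t => \col_k h k t) => k.
  by apply: (eq_tends _ (Hh k)) => t; rewrite mxE.
pose w t := g t - \sum_(j < r) (gdot (W t j) (g t) / gdot (W t j) (W t j)) *: W t j.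
have wE t : gmx (w t) = gmx (g t) - \sum_(j < r)
    (cdot (gmx (W t j)) (gmx (g t)) / cdot (gmx (W t j)) (gmx (W t j))) *: gmx (W t j).
  rewrite /w map_mxB; congr (_ - _).
  rewrite (raddf_sum (map_mx (gC R))) /=; apply: eq_bigr => j _.
  by rewrite map_mxZ /= fmorph_div /= !gC_gdot.
have wo t i : (i < r)%N -> cdot (gmx (W t i)) (gmx (w t)) = 0.
  move=> ir; rewrite wE cdotBr cdot_sumr (bigD1 (Ordinal ir)) //= cdotZr.
  rewrite divfK ?cdot_eq0 ?W0 // big1 ?addr0 ?subrr // => j ji.
  rewrite cdotZr; suff -> : cdot (gmx (W t i)) (gmx (W t j)) = 0 by rewrite mulr0.
  have : (i != j)%N by apply: contra ji => /eqP ij; apply/eqP/val_inj.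
  rewrite neq_ltn => /orP[ij|ji']; first by rewrite Wo // ij /=.
  by rewrite -cdot_conj Wo ?rmorph0 // ji' /=.
have wt k : tends (fun t => gC R (w t k 0)) (f r k 0).
  (* The limit is the Gram-Schmidt step applied to [f] itself, whose coefficients vanish by
     orthogonality. *)
  have -> : f r k 0 = f r k 0 - \sum_(j < r)
      (cdot (f j) (f r) / cdot (f j) (f j)) * f j k 0.
    by rewrite big1 ?subr0 // => j _; rewrite fo ?mul0r // ltn_ord /= ltnS.
  apply: (eq_tends (u := fun t => gC R (g t k 0) - \sum_(j < r)
    (cdot (gmx (W t j)) (gmx (g t)) / cdot (gmx (W t j)) (gmx (W t j))) * gC R (W t j k 0))).
    move=> t; have /matrixP/(_ k 0) := wE t; rewrite !mxE => ->; congr (_ - _).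
    by rewrite summxE; apply: eq_bigr => j _; rewrite !mxE.
  apply: tendsD => //; apply: tendsN; apply: tends_sum => j.
  have Wj i : tends (fun t => gmx (W t j) i 0) (f j i 0).
    by apply: (eq_tends _ (Wt j i (ltn_ord j))) => t; rewrite mxE.
  have gt i : tends (fun t => gmx (g t) i 0) (f r i 0).
    by apply: (eq_tends _ (Hg i)) => t; rewrite mxE.
  apply: tendsM; last exact: Wt.
  apply: tendsM; first exact: tends_cdot.
  by apply: tendsV; [rewrite cdot_eq0 f0 // ltnS ltnW | apply: tends_cdot].
have [T HT] : exists T, forall t, (T <= t)%N -> gmx (w t) != 0.
  have ww : tends (fun t => cdot (gmx (w t)) (gmx (w t))) (cdot (f r) (f r)).
    by apply: tends_cdot => i; apply: (eq_tends _ (wt i)) => t; rewrite [RHS]mxE.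
  have [|T HT] := tends_neq0 ww; first by rewrite cdot_eq0 f0.
  by exists T => t /HT; rewrite cdot_eq0.
(* The new vector may vanish at early times, so all sequences are shifted past [T]. *)
exists (fun t j => if j == r then w (t + T)%N else W (t + T)%N j); split.
- move=> t i j /andP[ij]; rewrite ltnS leq_eqVlt => /orP[/eqP jr|jr].
    by subst j; rewrite eqxx ltn_eqF // wo.
  by rewrite !ltn_eqF // ?(ltn_trans ij) // Wo // ij.
- move=> t i; rewrite ltnS leq_eqVlt => /orP[/eqP ->|ir].
    by rewrite eqxx HT // leq_addl.
  by rewrite ltn_eqF // W0.
- move=> i k; rewrite ltnS leq_eqVlt => /orP[/eqP ->|ir].
    by rewrite eqxx; apply: tends_shift (wt k).
  by rewrite ltn_eqF //; apply: tends_shift (Wt i k ir).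
Qed.
End GramSchmidt.
End GaussianFrames.


Definition gip D (u v : seq gauss) : gauss :=
  \sum_(i <- iota 0 D) (nth 0 u i)^*%C * nth 0 v i.
Definition gnorm2 D (w : seq gauss) : rat := Re (gip D w w).
Definition good D (F : seq (seq gauss)) : bool :=
  all (fun w => 0 < gnorm2 D w) F &&
  all (fun i => all (fun j => (j <= i)%N ||
     (gip D (nth [::] F i) (nth [::] F j) == 0)) (iota 0 (size F))) (iota 0 (size F)).
Definition gproj D (F : seq (seq gauss)) (i j : nat) : gauss :=
  \sum_(w <- F) nth 0 w i * (nth 0 w j)^*%C * Complex (gnorm2 D w)^-1 0.

#[global] Instance comp_gip : Comp3 gip.
Proof. by rewrite /gip; comp_auto. Qed.
#[global] Instance comp_gnorm2 : Comp2 gnorm2.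
Proof. by rewrite /gnorm2; comp_auto. Qed.
#[global] Instance comp_good : Comp2 good.
Proof. by rewrite /good; comp_auto. Qed.
#[global] Instance comp_gproj : Comp4 gproj.
Proof. by rewrite /gproj; comp_auto. Qed.

Lemma sum_iota (V : nmodType) n (F : nat -> V) :
  \sum_(i <- iota 0 n) F i = \sum_(i < n) F i.
Proof. by rewrite -(big_mkord xpredT) /index_iota subn0. Qed.

(** * Frames as lists of Gaussian rationals *)

Section FrameLists.
Variables (R : realType) (D : nat).
Local Notation C := (R[i]).

Definition gvec (w : seq gauss) : 'cV[C]_D := \col_i gC R (nth 0 w i).

Lemma gC_gip u v : gC R (gip D u v) = cdot (gvec u) (gvec v).
Proof.
rewrite /gip sum_iota rmorph_sum cdotE /=; apply: eq_bigr => i _.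
by rewrite gCM gC_conj !mxE.
Qed.

Lemma cdot_gvec w : cdot (gvec w) (gvec w) = (ratr (gnorm2 D w))%:C%C.
Proof.
have := cdot_ge0 (gvec w); rewrite -gC_gip lecE /= => /andP[/eqP im0 _].
by apply/eqP; rewrite eq_complex /= im0 !eqxx.
Qed.

Lemma gvec_neq0 w : (gvec w != 0) = (0 < gnorm2 D w).
Proof.
rewrite -cdot_eq0; have := cdot_ge0 (gvec w).
rewrite cdot_gvec lecR ler0q le_eqVlt eq_complex /= eqxx andbT fmorph_eq0.
by case: ltgtP.
Qed.

Lemma good_orthogonal F : good D F = orthogonal_family (map gvec F).
Proof.
congr (_ && _); first by rewrite all_map; apply: eq_all => w /=; rewrite gvec_neq0.
have gE u v : (gip D u v == 0) = (cdot (gvec u) (gvec v) == 0).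
  by rewrite -gC_gip fmorph_eq0.
rewrite pairwise_map; apply/allP/(pairwiseP [::]) => [H i j iF jF ij|H i].
  have /allP := H i (etrans (mem_iota0 _ _) iF).
  move=> /(_ j (etrans (mem_iota0 _ _) jF)) /orP[|]; first by rewrite leqNgt ij.
  by rewrite gE.
rewrite mem_iota0 => iF; apply/allP => j; rewrite mem_iota0 => jF.
by case: leqP => //= ij; rewrite gE; apply: H.
Qed.

Lemma gC_gproj F (i j : 'I_D) : gC R (gproj D F i j) = proj (map gvec F) i j.
Proof.
rewrite /gproj /proj big_map rmorph_sum summxE /=; apply: eq_bigr => w _.
rewrite !gCM gC_conj gC_rat ratrC fmorphV /= /proj1 cdot_gvec [RHS]mxE mulrC.
congr (_ * _); first by rewrite fmorphV.
by rewrite !mxE big_ord1 !mxE.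
Qed.

Lemma frame_approx (fs : seq 'cV[C]_D) : orthogonal_family fs ->
  exists F : nat -> seq (seq gauss),
  [/\ forall t, good D (F t), forall t, size (F t) = size fs &
      forall j (i : 'I_D), (j < size fs)%N ->
        tends (fun t => gC R (nth 0 (nth [::] (F t) j) i)) (nth 0 fs j i 0)].
Proof.
move=> /andP[/allP fs0 /(pairwiseP 0) fso].
have [||W [Wo W0 Wt]] := @orthogonal_approx R D (nth 0 fs) (size fs).
- move=> i j /andP[ij js]; apply/eqP; apply: fso => //.
  exact: ltn_trans js.
- by move=> i ifs; apply: fs0; rewrite mem_nth.
pose l (v : 'cV[gauss]_D) := [seq v i 0 | i <- enum 'I_D].
have lE v (i : 'I_D) : nth 0 (l v) i = v i 0.
  by rewrite (nth_map i) ?size_enum_ord // nth_ord_enum.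
have gl v : gvec (l v) = map_mx (gC R) v.
  by apply/matrixP => i j; rewrite !mxE lE ord1.
have nE t j : (j < size fs)%N ->
    nth [::] (mkseq (fun j => l (W t j)) (size fs)) j = l (W t j).
  by move=> js; rewrite nth_mkseq.
exists (fun t => mkseq (fun j => l (W t j)) (size fs)); split => [t|t|j i js].
- rewrite good_orthogonal /mkseq -map_comp; apply/andP; split.
    apply/allP => v /mapP[j]; rewrite mem_iota0 => js -> /=.
    by rewrite gl W0.
  rewrite pairwise_map; apply/(pairwiseP 0%N) => i j.
  rewrite !inE size_iota => iF jF ij; rewrite !nth_iota // !add0n /= !gl.
  by apply/eqP/Wo; rewrite ij.
- by rewrite size_mkseq.
- by apply: (eq_tends _ (Wt j i js)) => t; rewrite nE // lE.
Qed.

Lemma tends_gproj (fs : seq 'cV[C]_D) (F : nat -> seq (seq gauss)) :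
  orthogonal_family fs -> (forall t, size (F t) = size fs) ->
  (forall j (i : 'I_D), (j < size fs)%N ->
     tends (fun t => gC R (nth 0 (nth [::] (F t) j) i)) (nth 0 fs j i 0)) ->
  forall i k : 'I_D, tends (fun t => gC R (gproj D (F t) i k)) (proj fs i k).
Proof.
move=> /andP[/allP fs0 _] sF tF i k; rewrite /proj (big_nth 0) big_mkord summxE.
pose v t j := gvec (nth [::] (F t) j).
apply: (eq_tends (u := fun t => \sum_(j < size fs) (cdot (v t j) (v t j))^-1 *
    (v t j i 0 * (v t j k 0)^*%C))).
  move=> t; rewrite gC_gproj /proj big_map (big_nth [::]) big_mkord sF summxE.
  by apply: eq_bigr => j _; rewrite /proj1 [RHS]mxE; congr (_ * _); rewrite [RHS]mxE big_ord1 !mxE.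
apply: tends_sum => j; rewrite /proj1 mxE.
have tj l : tends (fun t => v t j l 0) (nth 0 fs j l 0).
  by apply: (eq_tends _ (tF j l (ltn_ord j))) => t; rewrite mxE.
apply: tendsM.
  apply: tendsV; last exact: tends_cdot.
  by rewrite cdot_eq0 fs0 // mem_nth.
rewrite mxE big_ord1; apply: tendsM => //; rewrite !mxE.
exact: tends_conj.
Qed.
End FrameLists.

(** * Bounds for density matrices *)

Section Density.
Variables (R : realType) (D : nat).
Local Notation C := (R[i]).
Variable A : 'M[C]_D.
Hypothesis dA : density_matrix A.

Lemma qformE (v : 'cV[C]_D) :
  qform v A = \sum_i \sum_j Num.conj (v i 0) * A i j * v j 0.
Proof.
rewrite /qform mxE exchange_big /=; apply: eq_bigr => j _.
by rewrite mxE mulr_suml; apply: eq_bigr => i _; rewrite !mxE.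
Qed.

Lemma qform_ge0 v : 0 <= qform v A.
Proof. by case: dA => _ []. Qed.

Definition bform (u v : 'cV[C]_D) : C := (ctrans u *m A *m v) 0 0.

Lemma qformD u v : qform (u + v) A = qform u A + bform u v + (bform v u + qform v A).
Proof. by rewrite /qform /bform ctransD !mulmxDl !mulmxDr !mxE. Qed.

Lemma bformN u v : bform (- u) v = - bform u v.
Proof. by rewrite /bform -scaleN1r ctransZ rmorphN1 scaleN1r !mulNmx mxE. Qed.

Lemma bformNr u v : bform u (- v) = - bform u v.
Proof. by rewrite /bform mulmxN mxE. Qed.

(** The parallelogram law for [u] and [v - u], with the nonnegative value at their difference
    dropped. *)
Lemma qform_triangle u v : qform v A <= 2 * qform u A + 2 * qform (v - u) A.
Proof.
have := qform_ge0 (u - (v - u)).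
have {2}-> : v = u + (v - u) by rewrite addrC subrK.
move: (v - u) => w; rewrite !qformD !bformN !bformNr.
have -> : qform (- w) A = qform w A by rewrite -[LHS]/(bform (- w) (- w)) bformN bformNr opprK.
move=> H; rewrite -subr_ge0; apply: le_trans H _; rewrite le_eqVlt; apply/orP; left.
by apply/eqP; ring.
Qed.

Lemma bform_delta i j : bform (delta_mx i 0) (delta_mx j 0) = A i j.
Proof.
rewrite /bform -colE mxE -[RHS]mul1r mxE (bigD1 i) //= big1 => [|k ki].
  by rewrite !mxE !eqxx rmorph1 addr0.
by rewrite !mxE (negbTE ki) rmorph0 mul0r.
Qed.

Lemma density_diag_ge0 i : 0 <= A i i.
Proof. by rewrite -bform_delta; apply: qform_ge0. Qed.

Lemma density_diag2 i j : i != j -> A i i + A j j <= 1.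
Proof.
case: dA => _ [_ <-]; rewrite /mxtrace => ij; rewrite (bigD1 i) //= (bigD1 j) 1?eq_sym //=.
by rewrite addrA lerDl sumr_ge0 // => k _; apply: density_diag_ge0.
Qed.

Lemma density_diag1 i : A i i <= 1.
Proof.
case: dA => _ [_ <-]; rewrite /mxtrace (bigD1 i) //=.
by rewrite lerDl sumr_ge0 // => k _; apply: density_diag_ge0.
Qed.

Lemma density_sym i j : A j i = Num.conj (A i j).
Proof. by case: dA => /matrixP/(_ j i); rewrite !mxE => <-. Qed.

(** Positivity on e_i + c e_j, where the two diagonal entries involved add up to at most 1. *)
Lemma density_pair i j (c : C) : Num.conj c * c = 1 -> i != j ->
  0 <= 1 + (c * A i j + Num.conj (c * A i j)).
Proof.
move=> c1 ij; have := qform_ge0 (delta_mx i 0 + c *: delta_mx j 0).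
rewrite qformD -!/(bform _ _) /qform -!/(bform _ _).
have bZr u v : bform u (c *: v) = c * bform u v by rewrite /bform -scalemxAr mxE.
have bZl u v : bform (c *: u) v = Num.conj c * bform u v.
  by rewrite /bform ctransZ -!scalemxAl mxE.
rewrite bZr !bZl bZr !bform_delta mulrA c1 mul1r => /le_trans; apply.
have := density_diag2 ij; rewrite rmorphM /= (density_sym i j) => h.
rewrite -subr_ge0; move: h; rewrite -subr_ge0 => /le_trans; apply.
by rewrite le_eqVlt; apply/orP; left; apply/eqP; ring.
Qed.

Lemma density_entry i j : n1 (A i j) <= 1.
Proof.
have [->|ij] := eqVneq i j.
  have := density_diag_ge0 j; have := density_diag1 j; rewrite !lecE /n1 /=.
  by move=> /andP[_ h1] /andP[/eqP -> h2]; rewrite normr0 addr0 ger0_norm.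
have conj_re (z : C) : 0 <= 1 + (z + Num.conj z) -> - 1 <= 2 * Re z.
  by case: z => a b; rewrite conjCE lecE /= => /andP[_]; lra.
have P c : Num.conj c * c = 1 -> - 1 <= 2 * Re (c * A i j).
  by move=> h; apply: conj_re; apply: density_pair h ij.
(* The four units 1, -1, i, -i bound the real and the imaginary part of an off-diagonal entry by 1/2
   each. *)
have h1 := P 1; have h2 := P (-1).
rewrite rmorph1 rmorphN1 mulrNN !mul1r mulN1r in h1 h2.
have e1 : (Complex 0 1)^*%C * Complex 0 1 = 1 :> C.
  by apply/eqP; rewrite eq_complex /=; apply/andP; split; apply/eqP; ring.
have e2 : (Complex 0 (-1))^*%C * Complex 0 (-1) = 1 :> C.
  by apply/eqP; rewrite eq_complex /=; apply/andP; split; apply/eqP; ring.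
move: (h1 erefl) (h2 erefl) (P _ e1) (P _ e2); rewrite /n1; case: (A i j) => a b /=.
by case: (ger0P a); case: (ger0P b) => *; lra.
Qed.

Lemma n1_sum (I : Type) (r : seq I) (F : I -> C) :
  n1 (\sum_(i <- r) F i) <= \sum_(i <- r) n1 (F i).
Proof.
elim: r => [|i r IH]; first by rewrite !big_nil n1_0.
by rewrite !big_cons; apply: le_trans (n1D _ _) _; rewrite lerD2l.
Qed.

Lemma n1_tr_mul (B : 'M[C]_D) (d : R) : 0 <= d -> (forall i j, n1 (B i j) <= d) ->
  n1 (\tr (A *m B)) <= (D * D)%:R * d.
Proof.
move=> d0 H; rewrite /mxtrace; apply: le_trans (n1_sum _ _) _.
have -> : (D * D)%:R * d = \sum_(i < D) \sum_(j < D) d.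
  by rewrite !sumr_const !card_ord -mulrnA mulr_natl.
apply: ler_sum => i _; rewrite mxE; apply: le_trans (n1_sum _ _) _.
apply: ler_sum => j _; apply: le_trans (n1M _ _) _.
by rewrite -[leRHS]mul1r ler_pM ?n1_ge0 ?density_entry.
Qed.

Lemma n1_qform (v : 'cV[C]_D) (d : R) : 0 <= d -> (forall i, n1 (v i 0) <= d) ->
  n1 (qform v A) <= (D * D)%:R * d ^+ 2.
Proof.
move=> d0 H; rewrite qformE; apply: le_trans (n1_sum _ _) _.
have -> : (D * D)%:R * d ^+ 2 = \sum_(i < D) \sum_(j < D) d ^+ 2.
  by rewrite !sumr_const !card_ord -mulrnA mulr_natl.
apply: ler_sum => i _; apply: le_trans (n1_sum _ _) _.
apply: ler_sum => j _; apply: le_trans (n1M _ _) _.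
rewrite expr2 ler_pM ?n1_ge0 //; apply: le_trans (n1M _ _) _.
by rewrite -[leRHS]mulr1 ler_pM ?n1_ge0 ?density_entry // conjCE n1_conj.
Qed.
End Density.


(** * Binary strings *)

Local Open Scope nat_scope.

(** Starting from 1 it gives the successor of [code_bits s]; starting from 0 it gives the left end
    of the dyadic interval of [s], multiplied by [2 ^ size s]. *)
Definition bval (a : nat) (s : seq bool) : nat := foldl (fun a (b : bool) => a.*2 + b) a s.

Lemma bvalE a s : bval a s = a * 2 ^ size s + bval 0 s.
Proof.
elim: s a => [|b s IH] a; first by rewrite /= muln1 addn0.
have -> : bval 0 (b :: s) = b * 2 ^ size s + bval 0 s by exact: (IH (0.*2 + b)).
have -> : bval a (b :: s) = (a.*2 + b) * 2 ^ size s + bval 0 s by exact: IH.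
by rewrite /= expnS; set z := 2 ^ _; lia.
Qed.

Lemma bval0_lt s : bval 0 s < 2 ^ size s.
Proof.
elim: s => [//|b s IH]; rewrite [bval 0 _](bvalE (0.*2 + b) s) /= expnS.
by case: b; move: IH; set z := 2 ^ _ => /=; lia.
Qed.

Lemma bval_rcons a s b : bval a (rcons s b) = (bval a s).*2 + b.
Proof. by rewrite /bval foldl_rcons. Qed.

Lemma bval1_gt0 s : 0 < bval 1 s.
Proof. by rewrite bvalE mul1n ltn_addr // expn_gt0. Qed.

Lemma code_bitsS s : (code_bits s).+1 = bval 1 s.
Proof. by rewrite /code_bits -/(bval 1 s) prednK // bval1_gt0. Qed.

Lemma code_bits_inj : injective code_bits.
Proof.
move=> s t /(congr1 succn); rewrite !code_bitsS.
elim/last_ind: s t => [|s b IH] t; case/lastP: t => [|t c] //; rewrite !bval_rcons.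
- by have := bval1_gt0 t; case: c => /=; lia.
- by have := bval1_gt0 s; case: b => /=; lia.
- move=> E; have bc : b = c by move: E; case: (b); case: (c) => /=; lia.
  by rewrite bc (IH t) //; move: E; rewrite bc; lia.
Qed.

Lemma code_bits_surj x : exists s, code_bits s = x.
Proof.
suff [s sE] : exists s, bval 1 s = x.+1.
  by exists s; apply/eqP; rewrite -eqSS code_bitsS sE.
have [n] := ubnP x; elim: n x => // n IH x xn.
case: x xn => [|x] xn; first by exists [::].
have [|s sE] := IH (x.+2./2).-1; first by lia.
exists (rcons s (odd x.+2)); rewrite bval_rcons sE prednK; last by lia.
by rewrite addnC odd_double_half.
Qed.

Lemma ex_blen x : exists l, x.+1 < 2 ^ l.+1.
Proof. by exists x; apply: ltn_expl. Qed.

Definition blen x := ex_minn (ex_blen x).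

#[global] Instance comp_blen : Comp1 blen.
Proof.
apply: (computable_ex_minn ex_blen); first by move=> c; exists c.
by comp_auto.
Qed.

Lemma blen_code s : blen (code_bits s) = size s.
Proof.
rewrite /blen; case: ex_minnP => l; rewrite code_bitsS bvalE mul1n => hl lmin.
have h1 : 2 ^ size s + bval 0 s < 2 ^ (size s).+1.
  by have := bval0_lt s; rewrite expnS; set z := 2 ^ _; lia.
have h2 : (code_bits s).+1 < 2 ^ (size s).+1 by rewrite code_bitsS bvalE mul1n.
apply/eqP; rewrite eqn_leq lmin //=.
have : 2 ^ size s < 2 ^ l.+1 by apply: leq_ltn_trans hl; rewrite leq_addr.
by rewrite ltn_exp2l.
Qed.

(** Kraft's inequality times [2 ^ l], which keeps it in the integers. A prefix-free set with the
    empty word has no other element; any other one splits by the first bit into two such sets of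
    shorter words. *)
Lemma kraft (l : nat) (S : seq (seq bool)) : uniq S ->
  {in S &, forall s t, prefix s t -> s = t} ->
  {in S, forall s, size s <= l} ->
  \sum_(s <- S) 2 ^ (l - size s) <= 2 ^ l.
Proof.
have nilS (S' : seq (seq bool)) m : uniq S' -> {in S', forall s, s = [::]} ->
    \sum_(s <- S') 2 ^ (m - size s) <= 2 ^ m.
  case: S' => [|s [|t S']] u H; first by rewrite big_nil.
    by rewrite big_seq1 leq_exp2l // leq_subr.
  have s0 : s = [::] by apply: H; rewrite mem_head.
  have t0 : t = [::] by apply: H; rewrite in_cons mem_head orbT.
  by move: u; rewrite s0 t0.
elim: l S => [|l IH] S uS pS sS.
  apply: nilS => // s /sS; rewrite leqn0 => /eqP; exact: size0nil.
have [nS|nS] := boolP ([::] \in S).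
  by apply: nilS => // s sS'; apply/esym/pS => //; apply: prefix0s.
pose S' (b : bool) := [seq behead s | s <- S & head true s == b].
have memS' b s : s \in S' b -> (b :: s) \in S.
  case/mapP=> -[|c t]; rewrite mem_filter => /andP[/eqP h tS] ->; first by rewrite tS in nS.
  by rewrite -h.
have injS b : {in [seq s <- S | head true s == b] &, injective behead}.
  move=> [|c s] [|d t]; rewrite !mem_filter => /andP[/eqP h1 sS'] /andP[/eqP h2 tS] //=.
  - by rewrite sS' in nS.
  - by rewrite tS in nS.
  - by move=> ->; move: h1 h2 => /= -> ->.
have KS b : \sum_(s <- S' b) 2 ^ (l - size s) <= 2 ^ l.
  apply: IH.
  - by rewrite (map_inj_in_uniq (injS b)) filter_uniq.
  - move=> s t /memS' sS' /memS' tS st; have := pS _ _ sS' tS.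
    by rewrite /= eqxx => /(_ st) [].
  - by move=> s /memS' /sS.
rewrite (bigID (fun s => head true s == true)) /= expnS mul2n -addnn.
have E b : \sum_(s <- S | head true s == b) 2 ^ (l.+1 - size s) =
    \sum_(s <- S' b) 2 ^ (l - size s).
  rewrite big_map big_filter big_seq_cond [RHS]big_seq_cond; apply: eq_bigr => -[|c s] /andP[tS _] //.
  by rewrite tS in nS.
apply: leq_add; first by rewrite E.
rewrite (eq_bigl (fun s : seq bool => head true s == false)) ?E //.
by move=> s; case: (head true s).
Qed.


(** * From small complexity to a failed test *)

Local Open Scope ring_scope.

(** An error of this size for each of [m] vectors and each of the [2 ^ n * 2 ^ n] matrix entries
    adds up to at most 2^-s / 16; the 16 leaves room for constant factors. *)
Definition delta (n m s : nat) : rat := ((2 ^ n * 2 ^ n * m.+1 * 2 ^ s.+4)%N%:R)^-1.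
Definition close (vc n : nat) (w : seq gauss) (dN : rat * nat) : bool :=
  (size (dec vc) == 2 ^ n)%N &&
  all (fun i => approx (nth 0%N (dec vc) i) (nth 0 w i) dN.1 dN.2) (iota 0 (2 ^ n)).
(** Only one direction is tested: each coded vector has a member of [F] near it. The bound on the
    squared norms limits the loss in passing from vectors to projections, and nonemptiness makes [k]
    determine [n]. *)
Definition matches (s : nat) (k n : nat) (F : seq (seq gauss)) (N : nat) : bool :=
  [&& good (2 ^ n) F, all (fun w => gnorm2 (2 ^ n) w <= 2) F, (0 < size (dec k))%N &
   all (fun vc => has (fun w => close vc n w (delta n (size (dec k)) s, N)) F) (dec k)].

#[global] Instance comp_delta : Comp3 delta.
Proof. by rewrite /delta; comp_auto. Qed.
#[global] Instance comp_close : Comp4 close.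
Proof. by rewrite /close; comp_auto. Qed.
#[global] Instance comp_matches s : Comp4 (matches s).
Proof. by rewrite /matches; comp_auto. Qed.

Lemma sum_sub_le (K : numDomainType) (T : eqType) (s t : seq T) (f : T -> K) :
  uniq s -> {subset s <= t} -> (forall x, 0 <= f x) ->
  \sum_(x <- s) f x <= \sum_(x <- t) f x.
Proof.
move=> us st f0; elim: s t us st => [|x s IH] t; first by rewrite big_nil sumr_ge0.
rewrite /= => /andP[xs us] st; have xt : x \in t by apply: st; rewrite mem_head.
rewrite (perm_big _ (perm_to_rem xt)) /= !big_cons lerD2l; apply: IH => // y ys.
have : y \in t by apply: st; rewrite inE ys orbT.
rewrite (perm_mem (perm_to_rem xt)) inE => /orP[/eqP yx|//].
by rewrite yx (negbTE xs) in ys.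
Qed.

Lemma eventually_forall (m : nat) (P : nat -> nat -> Prop) :
  (forall i, (i < m)%N -> exists T, forall t, (T <= t)%N -> P i t) ->
  exists T, forall t, (T <= t)%N -> forall i, (i < m)%N -> P i t.
Proof.
elim: m => [|m IH] H; first by exists 0%N.
have [|T1 H1] := IH; first by move=> i im; apply: H; rewrite ltnW.
have [T2 H2] := H m (leqnn _); exists (maxn T1 T2) => t.
rewrite geq_max => /andP[le1 le2] i; rewrite ltnS leq_eqVlt => /orP[/eqP ->|im].
  exact: H2.
exact: H1.
Qed.

(** * Coded orthonormal sets and matching frames *)

Section Matching.
Variable R : realType.
Local Notation C := (R[i]).

Lemma le_n1 (z : C) (r : R) : 0 <= z -> n1 z <= r -> z <= r%:C%C.
Proof.
rewrite !lecE /n1 /= => /andP[/eqP -> z0]; rewrite normr0 addr0 eqxx /=.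
by move=> h; apply: le_trans h; apply: ler_norm.
Qed.

Lemma delta_gt0 n m s : 0 < delta n m s.
Proof. by rewrite /delta invr_gt0 ltr0n !(expn_gt0, muln_gt0). Qed.

Lemma delta_small n m s : let d := (ratr (delta n m s) : R) in
  [/\ 0 < d, d <= 16^-1, (2 ^ n)%N%:R * d <= 16^-1 &
      m%:R * (2 ^ n * 2 ^ n)%N%:R * d <= (16 * 2 ^+ s)^-1].
Proof.
move=> d; rewrite {}/d /delta fmorphV /= ratr_nat; set D := (2 ^ n)%N.
have D0 : (0 < D)%N by rewrite expn_gt0.
have s0 : (0 < 2 ^ s)%N by rewrite expn_gt0.
have sE : (2 ^ s.+4 = 16 * 2 ^ s)%N by rewrite !expnS; lia.
have P : (0 < D * D * m.+1 * 2 ^ s.+4)%N by rewrite !(expn_gt0, muln_gt0).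
have P' : (0 : R) < (D * D * m.+1 * 2 ^ s.+4)%N%:R by rewrite ltr0n.
split; first by rewrite invr_gt0.
- rewrite lef_pV2 ?posrE // ler_nat sE.
  by move: D0 s0; set z := (2 ^ s)%N; nia.
- rewrite ler_pdivrMr // ler_pdivlMl // -[16]/(16%N%:R) -natrM ler_nat sE.
  by move: D0 s0; set z := (2 ^ s)%N; nia.
- have -> : 16 * 2 ^+ s = (16 * 2 ^ s)%N%:R :> R by rewrite natrM natrX.
  rewrite ler_pdivrMr // ler_pdivlMl ?ltr0n ?muln_gt0 // -!natrM ler_nat sE.
  by move: D0 s0; set z := (2 ^ s)%N; nia.
Qed.

Lemma close_sound n vc w d N (v : 'cV[C]_(2 ^ n)) : dec_vec vc v ->
  close vc n w (d, N) -> forall i, n1 (v i 0 - gvec R (2 ^ n) w i 0) <= 2 * ratr d.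
Proof.
move=> [_ dv] /andP[_ /allP H] i; rewrite mxE.
by apply: approx_sound (dv i) (H i _); rewrite mem_iota0.
Qed.

(** The squared norm of [v - v'] is 2, but entries of size at most [4 * d] allow only 16 * (D d) * d
    <= 1/16. Hence distinct vectors of the set have distinct neighbours in the frame. *)
Lemma orthonormal_close_inj D (v v' u : 'cV[C]_D) (d : R) :
  cdot v v = 1 -> cdot v' v' = 1 -> cdot v v' = 0 -> 0 < d -> d <= 16^-1 ->
  D%:R * d <= 16^-1 -> (forall i, n1 (v i 0 - u i 0) <= 2 * d) ->
  (forall i, n1 (v' i 0 - u i 0) <= 2 * d) -> False.
Proof.
move=> vv vv' vo d0 d16 Dd Hv Hv'; have v'v : cdot v' v = 0 by rewrite -cdot_conj vo rmorph0.
have : cdot (v - v') (v - v') = 2 by rewrite cdotBl !cdotBr vv vv' vo v'v; ring.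
move/(congr1 (@n1 R)); have -> : n1 (2 : C) = 2.
  by rewrite -(rmorph_nat (real_complex R) 2) /n1 /= normr0 addr0 ger0_norm.
rewrite cdotE => E; have := n1_sum (index_enum _) (fun i =>
   Num.conj ((v - v') i 0) * (v - v') i 0); rewrite E.
have K i : n1 (Num.conj ((v - v') i 0) * (v - v') i 0) <= (4 * d) ^+ 2.
  have h : n1 ((v - v') i 0) <= 4 * d.
    rewrite !mxE -(subrKA (u i 0)); apply: le_trans (n1D _ _) _.
    by rewrite -[X in _ + n1 X]opprB n1N; have := Hv i; have := Hv' i; lra.
  apply: le_trans (n1M _ _) _; rewrite conjCE n1_conj expr2.
  by rewrite ler_pM ?n1_ge0.
have S : \sum_i n1 (Num.conj ((v - v') i 0) * (v - v') i 0) <= D%:R * (4 * d) ^+ 2.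
  have -> : D%:R * (4 * d) ^+ 2 = \sum_(i < D) (4 * d) ^+ 2.
    by rewrite sumr_const card_ord mulr_natl.
  by apply: ler_sum => i _; apply: K.
move=> /le_trans/(_ S); apply/negP; rewrite -ltNge.
have -> : D%:R * (4 * d) ^+ 2 = 16 * (D%:R * d * d) by ring.
have : D%:R * d * d <= 16^-1 * 16^-1.
  by apply: ler_pM => //; [apply: mulr_ge0 => // |]; exact: ltW.
lra.
Qed.

(** The factor 4 is 2 from [qform_triangle] times the bound 2 on squared norms; the other term of
    [qform_triangle] goes into the additive error. *)
Lemma matches_sound s k n F N (L : seq 'cV[C]_(2 ^ n)) (A : 'M[C]_(2 ^ n)) :
  density_matrix A -> matches s k n F N -> dec_list k L ->
  Defs.orthonormal (undup L) ->
  \sum_(v <- undup L) qform v A <=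
    4 * \tr (A *m proj (map (gvec R (2 ^ n)) F)) + ((2 ^+ s)^-1)%:C%C.
Proof.
move=> dA /and4P[gF nF k0 /allP mk] [sL dL] oL; set D := (2 ^ n)%N.
set d := delta n (size (dec k)) s in mk.
have [d0 d16 Dd md] := delta_small n (size (dec k)) s; rewrite -/d in d0 d16 Dd md.
have cl (v : 'cV[C]_D) : exists w, v \in L -> w \in F /\
    forall i, n1 (v i 0 - gvec R D w i 0) <= 2 * ratr d.
  have [vL|] := boolP (v \in L); last by exists [::].
  have iL : (index v L < size L)%N by rewrite index_mem.
  have /hasP[w wF cw] := mk _ (mem_nth 0%N (etrans (esym (congr1 (leq _) sL)) iL)).
  exists w => _; split => //; apply: close_sound cw.
  by rewrite -{2}(nth_index 0 vL); apply: dL.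
have [g Hg] := choice cl.
pose t (w : seq gauss) := (cdot (gvec R D w) (gvec R D w))^-1 * qform (gvec R D w) A.
have t0 w : 0 <= t w by rewrite mulr_ge0 ?invr_ge0 ?cdot_ge0 ?(qform_ge0 dA).
have qv v : v \in undup L -> qform v A <= 4 * t (g v) +
    (2 * ((D * D)%N%:R * (2 * ratr d) ^+ 2))%:C%C.
  rewrite mem_undup => vL; have [gvF gvc] := Hg v vL.
  apply: le_trans (qform_triangle dA (gvec R D (g v)) v) _; apply: lerD.
    have -> : qform (gvec R D (g v)) A = (ratr (gnorm2 D (g v)))%:C%C * t (g v).
      rewrite -cdot_gvec /t mulrA mulfV ?mul1r // cdot_eq0 gvec_neq0.
      by case/andP: gF => /allP/(_ _ gvF).
    rewrite mulrA ler_wpM2r // -[4 : C]/((2 * 2)%N%:R) natrM ler_wpM2l //.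
    have -> : 2%:R = (2%:R : R)%:C%C :> C by rewrite rmorph_nat.
    by rewrite lecR -[2%:R : R](ratr_nat R 2) ler_rat; move/allP: nF; apply.
  rewrite rmorphM /= rmorph_nat; apply: ler_wpM2l => //; apply: le_n1; first exact: qform_ge0.
  apply: n1_qform => //; first by rewrite mulr_ge0 // ltW.
  by move=> i; rewrite !mxE; have := gvc i; rewrite mxE.
(* Thus no frame member is counted twice, and the sum over the chosen ones is at most the trace. *)
have ginj : {in undup L &, injective g}.
  move=> v v' vL vL' E; apply/eqP/negPn/negP => vv'.
  have := oL v v' vL vL'; have := oL v' v' vL' vL'; have := oL v v vL vL.
  rewrite !eqxx (negbTE vv') => v1 v2 v3.
  apply: (@orthonormal_close_inj D v v' (gvec R D (g v)) (ratr d)) => //.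
    by have [] := Hg v _; rewrite // -mem_undup.
  by rewrite E; have [] := Hg v' _; rewrite // -mem_undup.
rewrite big_seq; apply: le_trans (ler_sum _ qv) _.
rewrite big_split /= -!big_seq -mulr_sumr; apply: lerD.
  rewrite ler_wpM2l // tr_mul_proj big_map -(big_map g xpredT t).
  apply: sum_sub_le => //; first by rewrite (map_inj_in_uniq ginj) undup_uniq.
  by move=> w /mapP[v]; rewrite mem_undup => vL ->; have [] := Hg v vL.
rewrite big_const_seq count_predT iter_addr_0 -rmorphMn lecR -mulr_natl.
have sk : (size (undup L))%:R <= (size (dec k))%:R :> R by rewrite ler_nat -sL size_undup.
move: d0 d16 md; move: (ratr d : R) => e d0 d16 md.
have -> : 2 * ((D * D)%N%:R * (2 * e) ^+ 2) =
   8 * ((D * D)%N%:R * e * e) :> R by ring.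
apply: le_trans (_ : (size (dec k))%:R * (8 * ((D * D)%N%:R * e * e)) <= _).
  by have dd := ltW d0; apply: ler_wpM2r => //; rewrite !mulr_ge0.
have -> : (size (dec k))%:R * (8 * ((D * D)%N%:R * e * e)) =
  8 * ((size (dec k))%:R * (D * D)%N%:R * e * e) :> R by ring.
have s0 : 0 < (2 : R) ^+ s by rewrite exprn_gt0.
have : (size (dec k))%:R * (D * D)%N%:R * e * e <= (16 * 2 ^+ s)^-1 * 16^-1 :> R.
  by have dd := ltW d0; apply: ler_pM; [rewrite !mulr_ge0|by []|exact: md|exact: d16].
rewrite invfM; have : 0 < (2 ^+ s)^-1 :> R by rewrite invr_gt0.
move: ((2 ^+ s)^-1) => y; lra.
Qed.

Lemma matches_complete s k n (L : seq 'cV[C]_(2 ^ n)) : dec_list k L ->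
  Defs.orthonormal (undup L) -> L != [::] ->
  exists F N, matches s k n F N /\ size F = size (undup L).
Proof.
move=> [sL dL] oL L0; set D := (2 ^ n)%N; pose fs := undup L.
have ofs : orthogonal_family fs.
  apply/andP; split.
    by apply/allP => v vL; rewrite -cdot_eq0 (oL v v vL vL) eqxx oner_eq0.
  apply/(pairwiseP 0) => i j ifs jfs ij; rewrite oL ?mem_nth //.
  by rewrite nth_uniq ?undup_uniq // ltn_eqF.
have [F [gF sF tF]] := frame_approx ofs.
set d := delta n (size (dec k)) s; have d0 : 0 < d := delta_gt0 _ _ _.
have dR : 0 < (ratr d : R) / 2 by rewrite divr_gt0 // ltr0q.
have [T1 H1] : exists T, forall t, (T <= t)%N -> forall j, (j < size fs)%N ->
    forall i : 'I_D, n1 (gC R (nth 0 (nth [::] (F t) j) i) - nth 0 fs j i 0) <= ratr d / 2.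
  apply: eventually_forall => j js.
  have [|T HT] := @eventually_forall D (fun i t => forall k : 'I_D, i = k ->
      n1 (gC R (nth 0 (nth [::] (F t) j) k) - nth 0 fs j k 0) <= ratr d / 2).
    move=> i iD; have [T HT] := tends_near (tF j (Ordinal iD) js) dR.
    by exists T => t /HT h k' ik; rewrite (_ : k' = Ordinal iD) //; apply: val_inj.
  by exists T => t /HT h i; apply: (h i).
(* The squared norms tend to 1, so they are eventually at most 2. *)
have [T2 H2] : exists T, forall t, (T <= t)%N -> forall j, (j < size fs)%N ->
    gnorm2 D (nth [::] (F t) j) <= 2.
  apply: eventually_forall => j js.
  have tc : tends (fun t => cdot (gvec R D (nth [::] (F t) j)) (gvec R D (nth [::] (F t) j)))
     (cdot (nth 0 fs j) (nth 0 fs j)).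
    by apply: tends_cdot => i; apply: (eq_tends _ (tF j i js)) => t; rewrite mxE.
  have [T HT] := tends_near tc (ltr01 : 0 < 1 :> R).
  exists T => t /HT; rewrite oL ?mem_nth // eqxx cdot_gvec /n1 /= => h.
  rewrite -(ler_rat R) ratr_nat; have := ler_norm (ratr (gnorm2 D (nth [::] (F t) j)) - 1 : R).
  by move: h; have := normr_ge0 (0 - 0 : R); lra.
pose t := maxn T1 T2.
have [N0 HN] : exists N0, forall N, (N0 <= N)%N -> forall a, (a < size L)%N ->
    close (nth 0%N (dec k) a) n (nth [::] (F t) (index (nth 0 L a) fs)) (d, N).
  apply: eventually_forall => a aL; have [sv dv] := dL a aL.
  have jfs : (index (nth 0%R L a) fs < size fs)%N by rewrite index_mem mem_undup mem_nth.
  have [|N0 HN0] := @eventually_forall D (fun i N =>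
     approx (nth 0%N (dec (nth 0%N (dec k) a)) i)
       (nth 0 (nth [::] (F t) (index (nth 0 L a) fs)) i) d N).
    move=> i iD; apply: (approx_complete (dv (Ordinal iD)) d0).
    rewrite -n1N opprB; have := H1 t (leq_maxl _ _) _ jfs (Ordinal iD).
    by rewrite nth_index // mem_undup mem_nth.
  exists N0 => N /HN0 h; apply/andP; split; first by rewrite sv.
  by apply/allP => i; rewrite mem_iota0; apply: h.
exists (F t), N0; split => //; apply/and4P; split => //.
- apply/(all_nthP [::]) => j; rewrite sF => js; apply: H2 => //; exact: leq_maxr.
- by rewrite -sL lt0n size_eq0.
- apply/(all_nthP 0%N) => a aL'; have aL : (a < size L)%N by rewrite sL.
  apply/(has_nthP [::]).
  exists (index (nth 0 L a) fs); first by rewrite sF index_mem mem_undup mem_nth.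
  exact: HN.
Qed.
End Matching.


(** The least such [q] is the quotient; the second disjunct ends the search at 0, the value of
    division by zero. *)
Lemma ex_divn (p : nat * nat) : exists q, ((p.1 < q.+1 * p.2) || (p.2 == 0))%N.
Proof.
exists p.1; case: p => a [|b] /=; rewrite ?orbT // orbF.
by rewrite mulnS (leq_trans (leqnn _)) // leq_addr.
Qed.

#[global] Instance comp_divn : Comp2 divn.
Proof.
rewrite /Comp2; apply: (@eq_computable _ _ _ _ (fun p => ex_minn (ex_divn p))).
  move=> [a b] /=; case: ex_minnP => q /=; have [->|b0] := posnP b.
    by move=> _ /(_ 0%N); rewrite orbT divn0 leqn0 => /(_ isT) /eqP.
  have bF : (b == 0)%N = false by rewrite gtn_eqF.
  rewrite ?bF orbF => h qmin; apply/eqP; rewrite eqn_leq qmin; last first.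
    by rewrite ?bF orbF -ltn_divLR.
  by rewrite -ltnS ltn_divLR.
apply: computable_ex_minn; last by comp_auto.
by move=> c; exists (fstc c, sndc c).
Qed.

Lemma rep_seq_size A `{RA : Rep A} (c : nat) (s : seq A) : rep c s -> size (dec c) = size s.
Proof. by move=> H; exact: List.Forall2_length H. Qed.

Lemma rep_seq_nth A `{RA : Rep A} (c : nat) (s : seq A) i z : rep c s ->
  (i < size s)%N -> rep (nth 0%N (dec c) i) (nth z s i).
Proof.
rewrite {1}/rep /rep_seq /rep_seq_def => H.
elim: H i => // a x u t ax _ IH [|i] //= it; exact: IH.
Qed.

(** * Strong Solovay tests from computable frames *)

Section FrameTest.
Variable R : realType.
Local Notation C := (R[i]).

(** Thus the names made for normalised entries also serve for the Gaussian rational entries of a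
    projection. *)
Lemma scaleC1 z : scaleC R z 1 = gC R z.
Proof. by rewrite /scaleC /posq ltr01 rmorph1 sqrtr1 divr1. Qed.

Lemma algebraic_gC z : algebraicC (gC R z).
Proof.
have [f _ fE] := comp_scaleC R.
have [c cz] : Named (z, 1 : rat) by typeclasses eauto.
have [p0 [pr _]] := fE c (z, 1) cz; rewrite -scaleC1.
by exists (poly_of_nat (nth 0%N (dec (f c)) 0)).
Qed.

Section Test.
Variables (d : nat -> nat) (F : nat -> seq (seq gauss)).
Hypotheses (cd : computable d) (cF : computable F).
Hypothesis gF : forall m, good (2 ^ d m) (F m).

Definition frame_mx m : 'M[C]_(2 ^ d m) := proj (map (gvec R (2 ^ d m)) (F m)).

Lemma tau_frame m : tau_mx (frame_mx m) = (size (F m))%:R / (2 ^ d m)%N%:R.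
Proof.
rewrite /tau_mx tr_proj ?size_map //.
by have := gF m; rewrite (good_orthogonal R) => /andP[].
Qed.

Lemma frame_test (B : R) :
  (forall N, \sum_(m < N) (size (F m))%:R / (2 ^ d m)%N%:R <= realC B) ->
  strong_solovay_test frame_mx.
Proof.
move=> HB; split; [|split]; last first.
- by exists B => N; under eq_bigr do rewrite tau_frame.
- move=> m; split; first exact: proj_herm; split.
    by apply: proj_idem; rewrite -good_orthogonal.
  by move=> i j; rewrite -gC_gproj; apply: algebraic_gC.
(* The entries row by row: quotient and remainder of [l] are the row and the column. *)
pose es m := [seq scaleC R (gproj (2 ^ d m) (F m) (l %/ 2 ^ d m)
   (l - l %/ 2 ^ d m * 2 ^ d m)%N) 1 | l <- iota 0 (2 ^ d m * 2 ^ d m)].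
(* The final 0 ends the list, so a name of this nested pair is a list code of the form read by
   [dec_mx]. *)
have [g [e He] gE] : computable (fun m => (d m, (es m, 0%N))).
  have cd' : Comp1 d by []. have cF' : Comp1 F by [].
  by rewrite /es; comp_auto.
exists e => m; exists (g m); split => //.
have [/= g1 [/= g2 _]] := gE m m erefl.
have D0 : (0 < 2 ^ d m)%N by rewrite expn_gt0.
have ses : size (es m) = (2 ^ d m * 2 ^ d m)%N by rewrite size_map size_iota.
rewrite /dec_mx !nth_dec /=; split; first exact: g1; split.
  by rewrite -ses (rep_seq_size g2).
move=> i j.
have lt : (i * 2 ^ d m + j < 2 ^ d m * 2 ^ d m)%N.
  apply: leq_trans (_ : (i.+1 * 2 ^ d m <= _)%N); last by rewrite leq_mul2r ltn_ord orbT.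
  by rewrite mulSn addnC ltn_add2r.
have := rep_seq_nth 0 g2; move=> /(_ (i * 2 ^ d m + j)%N); rewrite ses lt => /(_ isT).
rewrite (nth_map 0%N) ?size_iota // nth_iota // add0n scaleC1.
by rewrite divnMDl // divn_small ?ltn_ord // addn0 addKn gC_gproj.
Qed.
End Test.
End FrameTest.

(** * The test that collects the outputs of short programs *)

Section SmallComplexityTest.
Variables (U : machine) (eU : recf) (s c : nat).
Hypothesis hU : forall x y, U x y <-> eval eU [:: code_bits x] y.
Hypothesis pfU : prefix_free U.

(** A program with a time bound, and a dimension with a frame and a grid size. Every number is a
    candidate, so the test is indexed by the candidates themselves. *)
Definition candidate (m : nat) : nat * nat * (nat * (seq (seq gauss) * nat)) :=
  decode_pair (decode_pair id id)
    (decode_pair id (decode_pair (decode_seq (decode_seq decode_gauss)) id)) m.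

Local Notation c_in m := (candidate m).1.1.
Local Notation c_time m := (candidate m).1.2.
Local Notation c_dim m := (candidate m).2.1.
Local Notation c_frame m := (candidate m).2.2.1.
Local Notation c_grid m := (candidate m).2.2.2.

(** The last clause says that for a program x the frame has normalised trace at most 2^c 2^-|x|, the
    form in which Kraft's inequality applies. *)
Definition accepted (m : nat) : bool :=
  [&& (0 < evalt eU (c_time m) [:: c_in m])%N,
      matches s (evalt eU (c_time m) [:: c_in m]).-1 (c_dim m) (c_frame m) (c_grid m) &
      (size (c_frame m) * 2 ^ blen (c_in m) <= 2 ^ (c_dim m + c))%N].
(* Keeping one candidate per program lets Kraft's inequality bound the weights. *)
Definition selected (m : nat) : bool :=
  accepted m && ~~ has (fun m' => accepted m' && (c_in m' == c_in m)) (iota 0 m).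
(** A test needs a projection at every index; those not selected contribute the zero projection. *)
Definition t_dim m := if selected m then c_dim m else 0%N.
Definition t_frame m := if selected m then c_frame m else [::].

#[global] Instance comp_candidate : Comp1 candidate := computable_decode.
#[global] Instance comp_accepted : Comp1 accepted.
Proof. by rewrite /accepted; comp_auto. Qed.
#[global] Instance comp_selected : Comp1 selected.
Proof. by rewrite /selected; comp_auto. Qed.
Lemma comp_t_dim : computable t_dim.
Proof. by rewrite /t_dim; comp_auto. Qed.
Lemma comp_t_frame : computable t_frame.
Proof. by rewrite /t_frame; comp_auto. Qed.

Lemma good_t_frame m : good (2 ^ t_dim m) (t_frame m).
Proof.
rewrite /t_dim /t_frame; case: ifP => // /andP[/and3P[_ /and4P[]]] //.
Qed.

Lemma selected_uniq m m' : selected m -> selected m' -> c_in m = c_in m' -> m = m'.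
Proof.
wlog lt : m m' / (m < m')%N.
  move=> H sm sm' E; case: (ltngtP m m') => // lt; first exact: H.
  by apply/esym; apply: H.
move=> /andP[am _] /andP[_ /hasPn H] E.
by have := H m; rewrite mem_iota0 lt am E eqxx => /(_ isT).
Qed.

Lemma t_sum (R : realType) N :
  \sum_(m < N) (size (t_frame m))%:R / (2 ^ t_dim m)%N%:R <= realC ((2 ^+ c) : R).
Proof.
pose str x := projT1 (cid (code_bits_surj x)).
have strE x : code_bits (str x) = x by rewrite /str; case: cid.
pose S := [seq str (c_in m) | m <- iota 0 N & selected m].
have dom x : x \in S -> exists y, U x y.
  case/mapP=> m; rewrite mem_filter => /andP[/andP[/and3P[e0 _ _] _] _] ->.
  exists (evalt eU (c_time m) [:: c_in m]).-1; apply/hU; rewrite strE.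
  by apply: evalt_sound; rewrite prednK.
(* [S] lists distinct programs in the prefix-free domain of [U]; any common bound on their lengths
   turns [kraft] into the usual inequality. *)
pose l := \max_(x <- S) size x.
have K : (\sum_(x <- S) 2 ^ (l - size x) <= 2 ^ l)%N.
  apply: kraft.
  - rewrite map_inj_in_uniq ?filter_uniq ?iota_uniq // => m m'.
    rewrite !mem_filter => /andP[sm _] /andP[sm' _] /(congr1 code_bits).
    by rewrite !strE; apply: selected_uniq.
  - by move=> x y /dom[a Ua] /dom[b Ub]; apply: pfU Ua Ub.
  - by move=> x xS; apply: leq_bigmax_seq.
have K' : \sum_(x <- S) ((2 ^ size x)%N%:R)^-1 <= 1 :> R[i].
  have p0 n : (0 : R[i]) < (2 ^ n)%N%:R by rewrite ltr0n expn_gt0.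
  rewrite -(ler_pM2l (p0 l)) mulr1 mulr_sumr.
  have -> : \sum_(x <- S) (2 ^ l)%N%:R * ((2 ^ size x)%N%:R)^-1 =
      (\sum_(x <- S) 2 ^ (l - size x))%N%:R :> R[i].
    rewrite natr_sum !big_seq; apply: eq_bigr => x xS.
    have xl : (size x <= l)%N by apply: leq_bigmax_seq.
    by rewrite -{1}(subnK xl) expnD natrM mulfK // gt_eqF.
  by rewrite ler_nat.
have -> : realC (2 ^+ c : R) = (2 ^ c)%N%:R by rewrite /realC rmorphXn /= rmorph_nat natrX.
rewrite -(big_mkord xpredT (fun m => (size (t_frame m))%:R / (2 ^ t_dim m)%N%:R)).
rewrite /index_iota subn0 (bigID selected) /= [X in _ + X]big1 ?addr0; last first.
  by move=> m /negbTE sm; rewrite /t_frame sm mul0r.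
apply: le_trans (_ : \sum_(m <- iota 0 N | selected m)
    (2 ^ c)%N%:R * ((2 ^ size (str (c_in m)))%N%:R)^-1 <= _).
  apply: ler_sum => m sm; rewrite /t_frame /t_dim sm.
  have /andP[/and3P[_ _ h] _] := sm; move: h.
  rewrite -{1}(strE (c_in m)) blen_code expnD => h.
  rewrite ler_pdivrMr ?ltr0n ?expn_gt0 // mulrAC ler_pdivlMr ?ltr0n ?expn_gt0 //.
  by rewrite -!natrM ler_nat [(2 ^ c * _)%N]mulnC.
rewrite -mulr_sumr -[leRHS]mulr1 ler_wpM2l //.
by rewrite -big_filter -(big_map (fun m => str (c_in m)) xpredT (fun x => ((2 ^ size x)%N%:R)^-1)).
Qed.

(** The selected candidate for [x] need not carry the frame built from [L]. Its frame matches the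
    same output [k], though, and the length of a vector coded in [k] forces the dimension. *)
Lemma selected_dim (R : realType) x n k (L : seq 'cV[R[i]]_(2 ^ n)) :
  U x k -> dec_list k L -> Defs.orthonormal (undup L) -> L != [::] ->
  (size (undup L) * 2 ^ size x <= 2 ^ (n + c))%N ->
  exists m, [/\ selected m, c_dim m = n & matches s k n (c_frame m) (c_grid m)].
Proof.
move=> Uxk dL oL L0 hs.
have [F [N [mF sF]]] := matches_complete s dL oL L0.
have /hU /evalt_complete [t0 Ht0] := Uxk.
have [m0 m0E] := decode_surj (decode := candidate) ((code_bits x, t0), (n, (F, N))).
have exm : exists m, accepted m && (c_in m == code_bits x).
  by exists m0; rewrite /accepted m0E /= Ht0 //= mF blen_code sF hs eqxx.
case: (ex_minnP exm) => m /andP[am /eqP mx] mmin; exists m.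
have kE : (evalt eU (c_time m) [:: c_in m]).-1 = k.
  case/and3P: am => e0 _ _; apply: (eval_inj (e := eU) (v := [:: code_bits x])).
    by apply: (evalt_sound (t := c_time m)); rewrite -mx prednK.
  exact/hU.
have mk : matches s k (c_dim m) (c_frame m) (c_grid m).
  by case/and3P: (am) => _; rewrite kE.
have dimE : c_dim m = n.
  case/and4P: mk => _ _ k0 /allP H.
  have /hasP[w _ /andP[/eqP sz _]] := H _ (mem_nth 0%N k0).
  case: dL => sL dL; have [|sv _] := dL 0%N; first by rewrite sL.
  by apply/eqP; rewrite -(eqn_exp2l (m := 2)) // -sz sv.
split => //; last by rewrite -dimE.
rewrite /selected am andTb; apply/hasPn => m'; rewrite mem_iota0 => lt.
apply/negP => /andP[am' /eqP E]; have := mmin m'; rewrite am' E mx eqxx => /(_ isT).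
by rewrite leqNgt lt.
Qed.
End SmallComplexityTest.


Section Logarithms.
Variable R : realType.

Lemma ln2_gt0 : 0 < ln (2 : R).
Proof. by rewrite ln_gt0 // ltr1n. Qed.

Lemma log2_shift (q a : nat) : (0 < q)%N ->
  a%:R + log2 (q%:R : R) = log2 ((q * 2 ^ a)%N%:R : R).
Proof.
move=> q0; rewrite /log2 natrM natrX lnM ?posrE ?ltr0n ?exprn_gt0 //.
rewrite lnXn // -[ln 2 *+ a]mulr_natr mulrDl.
by rewrite mulrAC divff ?gt_eqF ?ln2_gt0 // mul1r addrC.
Qed.

Lemma log2_pow2 (b : nat) : log2 ((2 ^ b)%N%:R : R) = b%:R.
Proof.
by rewrite -[(2 ^ b)%N]mul1n -log2_shift // /log2 ln1 mul0r addr0.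
Qed.

Lemma log2_le (p q : nat) : (0 < p)%N -> (0 < q)%N ->
  (log2 (p%:R : R) <= log2 (q%:R : R)) = (p <= q)%N.
Proof.
move=> p0 q0; rewrite /log2 ler_pM2r ?invr_gt0 ?ln2_gt0 //.
by rewrite ler_ln ?posrE ?ltr0n // ler_nat.
Qed.
End Logarithms.

Section RandomToComplexity.
Variable R : realType.

Lemma ex_pow2_small (x : R) : 0 < x -> exists s : nat, (2 ^+ s)^-1 <= x.
Proof.
move=> x0; have [s hs] := ex_natr_gt x^-1; exists s.
rewrite -[leRHS]invrK lef_pV2 ?posrE ?invr_gt0 ?exprn_gt0 //.
by apply: ltW; apply: lt_le_trans hs _; rewrite -natrX ler_nat ltnW // ltn_expl.
Qed.

Lemma random_complexity (U : machine) (rho : forall n, 'M[R[i]]_(2 ^ n)) :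
  prefix_free_machine U -> (forall n, density_matrix (rho n)) ->
  weak_solovay_random rho ->
  forall eps c : R, 0 < eps -> 0 < c -> exists n0 : nat, forall n, (n0 <= n)%N ->
    ((n%:R + c)%:E <= QK U eps (rho n))%E.
Proof.
move=> [[eU hU] pfU] drho wsr eps c eps0 c0; apply: contrapT => /forallNP H.
have {}H n0 : exists n, (n0 <= n)%N /\ ~ ((n%:R + c)%:E <= QK U eps (rho n))%E.
  have /existsNP[n /not_implyP[nn0 h]] := H n0; by exists n.
have [c' hc'] := ex_natr_gt c.
have eps2 : 0 < eps / 2 by rewrite divr_gt0.
have [s hs] := ex_pow2_small eps2.
pose d := t_dim eU s c'; pose F := t_frame eU s c'.
have test : strong_solovay_test (@frame_mx R d F).
  apply: frame_test; [exact: comp_t_dim|exact: comp_t_frame|exact: good_t_frame|].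
  exact: t_sum hU pfU R.
(* eps < 4 T + 2^-s and 2^-s <= eps / 2 give T > eps / 8. *)
have eps8 : 0 < eps / 8 by rewrite divr_gt0.
apply: (wsr _ _ test _ eps8) => M.
(* Taking [n] above all dimensions of the first [M] projections ensures that the index found for it
   is at least [M]. *)
have [n [nM]] := H (\max_(m < M) d m).+1.
move=> /negP; rewrite -ltNge => /ereal_inf_lt[_ [x [k [L [Uxk [dL [oL [hq ->]]]]]]]].
rewrite lte_fin => hlt.
have L0 : L != [::].
  apply: contraTneq hq => ->; rewrite /= big_nil -(rmorph0 (real_complex R)).
  by rewrite ltcR -leNgt ltW.
have uL0 : (0 < size (undup L))%N.
  by rewrite lt0n size_eq0; apply: contra L0 => /eqP /undup_nil ->.
have hsz : (size (undup L) * 2 ^ size x <= 2 ^ (n + c'))%N.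
  rewrite -(log2_le R) ?muln_gt0 ?uL0 ?expn_gt0 // -log2_shift // log2_pow2 natrD.
  by apply: ltW; apply: lt_trans hlt _; rewrite ltrD2l.
have [m [sm dm mm]] := selected_dim s hU Uxk dL oL L0 hsz.
have dE : d m = n by rewrite /d /t_dim sm.
have FE : F m = (candidate m).2.2.1 by rewrite /F /t_frame sm.
exists m; split.
  rewrite leqNgt; apply/negP => mM.
  by have := leq_bigmax (Ordinal mM) (F := fun i : 'I_M => d i); rewrite dE leqNgt nM.
have := matches_sound (drho n) mm dL oL.
rewrite /state_val /frame_mx FE; rewrite dE.
set T := \tr _ => hT; have {hq hT} := lt_le_trans hq hT.
have T0 : 0 <= T.
  rewrite /T tr_mul_proj sumr_ge0 // => w _.
  by rewrite mulr_ge0 ?invr_ge0 ?cdot_ge0 ?(qform_ge0 (drho n)).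
move: T0; case: T => a b; rewrite lecE /= => /andP[/eqP -> a0].
rewrite /realC !ltcE /= !(mul0r, mulr0, addr0, add0r, subr0) => /andP[_ h].
by rewrite eqxx /=; lra.
Qed.
End RandomToComplexity.


(** * From a failed test to small complexity *)

Definition mxentry (k i j : nat) : nat :=
  nth 0%N (dec (nth 0%N (dec k) 1)) (i * 2 ^ nth 0%N (dec k) 0 + j)%N.
(** Unlike [matches], this compares projections entry by entry, because a test supplies no basis of
    the range. *)
Definition represents (s k : nat) (F : seq (seq gauss)) (N : nat) : bool :=
  good (2 ^ nth 0%N (dec k) 0) F &&
  all (fun i => all (fun j => approx (mxentry k i j) (gproj (2 ^ nth 0%N (dec k) 0) F i j)
      (delta (nth 0%N (dec k) 0) 1 s) N)
    (iota 0 (2 ^ nth 0%N (dec k) 0))) (iota 0 (2 ^ nth 0%N (dec k) 0)).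

#[global] Instance comp_mxentry : Comp3 mxentry.
Proof. by rewrite /mxentry; comp_auto. Qed.
#[global] Instance comp_represents s : Comp3 (represents s).
Proof. by rewrite /represents; comp_auto. Qed.

(** * Rational approximation of the projections of a test *)

Section Representing.
Variables (R : realType) (s k n : nat).
Local Notation C := (R[i]).
Variable S : 'M[C]_(2 ^ n).
Hypothesis kS : dec_mx k S.

Lemma represents_entry F N : represents s k F N -> forall i j,
  n1 (S i j - proj (map (gvec R (2 ^ n)) F) i j) <= 2 * ratr (delta n 1 s).
Proof.
case: kS => nE [_ eS]; rewrite /represents /mxentry nE => /andP[_ /allP H] i j.
have /allP Hi := H i (etrans (mem_iota0 _ _) (ltn_ord i)).
rewrite -gC_gproj; apply: approx_sound (eS i j) (Hi j _).
by rewrite mem_iota0 ltn_ord.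
Qed.

Lemma represents_good F N : represents s k F N -> good (2 ^ n) F.
Proof. by case: kS => nE _; rewrite /represents nE => /andP[]. Qed.

Lemma represents_state F N (A : 'M[C]_(2 ^ n)) : density_matrix A ->
  represents s k F N ->
  n1 (\tr (A *m S) - \tr (A *m proj (map (gvec R (2 ^ n)) F))) <= (2 ^+ s)^-1.
Proof.
move=> dA rF; rewrite -linearB /= -mulmxBr.
have [d0 d16 Dd md] := delta_small R n 1 s.
apply: le_trans (n1_tr_mul (d := 2 * ratr (delta n 1 s)) dA _ _) _.
- by rewrite mulr_ge0 // ltW.
- by move=> i j; have := represents_entry rF i j; rewrite !mxE.
have s0 : 0 < (2 ^+ s)^-1 :> R by rewrite invr_gt0 exprn_gt0.
move: md; rewrite mul1r invfM; move: s0; move: ((2 ^+ s)^-1) (ratr _) => y e.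
move: ((2 ^ n * 2 ^ n)%N%:R) => D; lra.
Qed.

(** Both traces are integers and they differ by at most 1/8. *)
Lemma represents_trace F N : Defs.hermitian S -> S *m S = S ->
  represents s k F N -> \tr S = (size F)%:R.
Proof.
move=> hS iS rF; have [fs ofs SE] := projection_basis hS iS.
have trS : \tr S = (size fs)%:R by rewrite SE tr_proj //; case/andP: ofs.
have gF := represents_good rF; rewrite (good_orthogonal R) in gF.
have trF : \tr (proj (map (gvec R (2 ^ n)) F)) = (size F)%:R.
  by rewrite tr_proj ?size_map //; case/andP: gF.
have [d0 d16 Dd md] := delta_small R n 1 s.
have : n1 (\tr S - \tr (proj (map (gvec R (2 ^ n)) F))) <= 8^-1.
  rewrite /mxtrace -sumrB; apply: le_trans (n1_sum _ _) _.
  apply: le_trans (_ : \sum_(i < 2 ^ n) 2 * ratr (delta n 1 s) <= _).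
    by apply: ler_sum => i _; exact: (represents_entry rF i i).
  rewrite sumr_const card_ord -[leLHS]mulr_natr.
  by move: Dd; move: (ratr _) ((2 ^ n)%N%:R) => e D; lra.
rewrite trS trF => h; congr (_%:R); apply/eqP/negPn/negP => ne.
have : 1 <= n1 ((size fs)%:R - (size F)%:R : C).
  rewrite -!(rmorph_nat (real_complex R)) -rmorphB /n1 /= normr0 addr0.
  move: ne; move: (size fs) (size F) => a b ab.
  wlog lt : a b ab / (b < a)%N.
    move=> H; have := ab; rewrite neq_ltn => /orP[lt|]; last exact: H.
    by rewrite distrC; apply: H; rewrite // eq_sym.
  by rewrite -natrB ?(ltnW lt) // ger0_norm // ler1n subn_gt0.
by move: h; move: (n1 _) => y; lra.
Qed.

Lemma represents_complete : Defs.hermitian S -> S *m S = S ->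
  exists F N, represents s k F N.
Proof.
move=> hS iS; have [fs ofs SE] := projection_basis hS iS.
have [F [gF sF tF]] := frame_approx ofs.
have tP := tends_gproj ofs sF tF; set D := (2 ^ n)%N in tP *.
set d := delta n 1 s; have d0 : 0 < d := delta_gt0 _ _ _.
have dR : 0 < (ratr d : R) / 2 by rewrite divr_gt0 // ltr0q.
have [T HT] : exists T, forall t, (T <= t)%N -> forall i, (i < D)%N -> forall j, (j < D)%N ->
    forall i' j' : 'I_D, i = i' -> j = j' ->
    n1 (gC R (gproj D (F t) i j) - S i' j') <= ratr d / 2.
  apply: eventually_forall => i iD; apply: eventually_forall => j jD.
  have [T HT] := tends_near (tP (Ordinal iD) (Ordinal jD)) dR.
  exists T => t /HT h i' j' ii jj; rewrite SE.
  have -> : i' = Ordinal iD by apply: val_inj.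
  by have -> : j' = Ordinal jD by apply: val_inj.
case: kS => nE [_ eS].
have [N HN] : exists N0, forall N, (N0 <= N)%N -> forall i, (i < D)%N -> forall j, (j < D)%N ->
    approx (mxentry k i j) (gproj D (F T) i j) d N.
  apply: eventually_forall => i iD; apply: eventually_forall => j jD.
  rewrite /mxentry nE; apply: (approx_complete (eS (Ordinal iD) (Ordinal jD)) d0).
  by rewrite -n1N opprB; apply: HT.
exists (F T), N; rewrite /represents nE gF; apply/allP => i; rewrite mem_iota0 => iD.
by apply/allP => j; rewrite mem_iota0 => jD; apply: HN.
Qed.
End Representing.

(** * Codewords inside consecutive intervals *)

Section Codewords.
Variables (q d : nat -> nat) (c : nat).
Hypotheses (cq : computable q) (cd : computable d).

(** A normalised trace scaled by 2^-c. The interval from [start m] to [start m.+1], of this length,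
    is reserved for index [m]. *)
Definition weight m : rat := (q m)%:R / (2 ^ (d m + c))%N%:R.
Definition start m : rat := \sum_(j <- iota 0 m) weight j.
Hypothesis start_le1 : forall m, start m <= 1.

(** The second disjunct says that 2^-l is at most half the weight, which leaves room for a dyadic
    interval of that length; the first ends the search when nothing is reserved. *)
Lemma ex_wordlen m : exists l, ((q m == 0) || (2 * 2 ^ (d m + c) <= q m * 2 ^ l))%N.
Proof.
exists (d m + c).+1; case: posnP => //= q0; rewrite expnS.
by rewrite leq_pmull.
Qed.
Definition wordlen m := ex_minn (ex_wordlen m).

Lemma ex_wordval m : exists v : nat, start m * (2 ^ wordlen m)%N%:R <= v%:R.
Proof.
by exists (2 ^ wordlen m)%N; rewrite ler_piMl // ler0n.
Qed.
Definition wordval m := ex_minn (ex_wordval m).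

(** The code of the string of length [wordlen m] with binary value [wordval m]. *)
Definition word m := (2 ^ wordlen m + wordval m).-1.

Lemma computable_weight : Comp1 weight.
Proof.
have cq' : Comp1 q by []. have cd' : Comp1 d by [].
by rewrite /weight; comp_auto.
Qed.

Lemma computable_word : computable word.
Proof.
have cq' : Comp1 q by []. have cd' : Comp1 d by [].
have cw := computable_weight.
have cs : Comp1 start by rewrite /start; comp_auto.
have cl : Comp1 wordlen.
  by apply: (computable_ex_minn ex_wordlen); [move=> x; exists x|comp_auto].
have cv : Comp1 wordval.
  by apply: (computable_ex_minn ex_wordval); [move=> x; exists x|comp_auto].
by rewrite /word; comp_auto.
Qed.

Lemma weight_ge0 m : 0 <= weight m.
Proof. by rewrite divr_ge0. Qed.

Lemma startS m : start m.+1 = start m + weight m.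
Proof. by rewrite /start -[m.+1]addn1 iotaD big_cat /= big_seq1. Qed.

Lemma start_mono m m' : (m <= m')%N -> start m <= start m'.
Proof.
elim: m' => [|m' IH]; first by rewrite leqn0 => /eqP ->.
rewrite leq_eqVlt => /orP[/eqP -> //|]; rewrite ltnS => /IH h.
by rewrite startS (le_trans h) // lerDl weight_ge0.
Qed.

(** Rounding [start m] up to a multiple of 2^-l costs less than 2^-l and the dyadic interval takes
    2^-l more; the weight is at least twice that. *)
Lemma word_interval m : (0 < q m)%N ->
  start m * (2 ^ wordlen m)%N%:R <= (wordval m)%:R /\
  (wordval m).+1%:R <= start m.+1 * (2 ^ wordlen m)%N%:R.
Proof.
move=> q0; have wl : (2 * 2 ^ (d m + c) <= q m * 2 ^ wordlen m)%N.
  by rewrite /wordlen; case: ex_minnP => l; rewrite eqn0Ngt q0.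
have w2 : 2 <= weight m * (2 ^ wordlen m)%N%:R.
  rewrite /weight mulrAC ler_pdivlMr ?ltr0n ?expn_gt0 //.
  by rewrite -!natrM ler_nat.
rewrite /wordval; case: ex_minnP => v hv vmin; split => //.
rewrite startS mulrDl; case: v hv vmin => [|v] hv vmin.
  apply: le_trans (_ : 2 <= _); first by lra.
  apply: le_trans w2 _; rewrite lerDr mulr_ge0 //.
  by rewrite sumr_ge0 // => j _; apply: weight_ge0.
have : v%:R < start m * (2 ^ wordlen m)%N%:R.
  rewrite ltNge; apply/negP => /vmin; by rewrite ltnn.
rewrite -2!natr1; lra.
Qed.

Lemma word_size m x : (0 < q m)%N -> code_bits x = word m ->
  size x = wordlen m /\ bval 0 x = wordval m.
Proof.
move=> q0 xE; have [_ h] := word_interval q0.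
have vl : (wordval m < 2 ^ wordlen m)%N.
  rewrite -(ler_nat rat); apply: le_trans h _; rewrite ler_piMl //; exact: start_le1.
have := code_bitsS x; rewrite xE /word prednK ?addn_gt0 ?expn_gt0 // bvalE mul1n.
have xl := bval0_lt x => E.
have sE : size x = wordlen m.
  have h1 : (2 ^ size x < 2 ^ (wordlen m).+1)%N by rewrite expnS; lia.
  have h2 : (2 ^ wordlen m < 2 ^ (size x).+1)%N by rewrite expnS; lia.
  by move: h1 h2; rewrite !ltn_exp2l // !ltnS => h1 h2; apply/eqP; rewrite eqn_leq h1.
by split => //; move: E; rewrite sE; lia.
Qed.

(** If [x] is a prefix of [y], the dyadic interval of [y] lies in that of [x], while intervals
    reserved for different indices do not overlap. The case [x = y] makes codewords distinct. *)
Lemma word_prefix m m' x y : (0 < q m)%N -> (0 < q m')%N ->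
  code_bits x = word m -> code_bits y = word m' -> prefix x y -> m = m'.
Proof.
move=> q0 q0' xE yE /prefixP[u yu].
have [sx bx] := word_size q0 xE; have [sy by_] := word_size q0' yE.
have [h1 h2] := word_interval q0; have [h1' h2'] := word_interval q0'.
have vE : wordval m' = (wordval m * 2 ^ size u + bval 0 u)%N.
  by rewrite -by_ -bx yu /bval foldl_cat -/(bval 0 x) -/(bval _ u) bvalE.
have lE : wordlen m' = (wordlen m + size u)%N by rewrite -sy -sx yu size_cat.
have uu := bval0_lt u.
have P0 n : (0 : rat) < (2 ^ n)%N%:R by rewrite ltr0n expn_gt0.
have E' : (2 ^ wordlen m')%N%:R = (2 ^ wordlen m)%N%:R * (2 ^ size u)%N%:R :> rat.
  by rewrite lE expnD natrM.
(* On the finer scale of [m'], either order of the indices would put the right end of the interval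
   of [y] at or below its left end. *)
case: (ltngtP m m') => // lt.
  have := start_mono lt; have up : (wordval m').+1%:R <= (wordval m).+1%:R * (2 ^ size u)%N%:R :> rat.
    by rewrite -natrM ler_nat vE mulSn addnC ltn_add2r.
  move: h2 h1' up; rewrite E' -(ler_pM2r (P0 (size u))).
  rewrite -mulrA -!natrM -!expnD -lE natrM => h2 h1' up.
  rewrite -(ler_pM2r (P0 (wordlen m'))) => h.
  have : ((wordval m').+1%:R : rat) <= (wordval m')%:R.
    apply: le_trans up _; apply: le_trans h2 _; apply: le_trans h _.
    by move: h1'; rewrite lE expnD natrM.
  by rewrite ler_nat ltnn.
have := start_mono lt; have dn : (wordval m)%:R * (2 ^ size u)%N%:R <= (wordval m')%:R :> rat.
  by rewrite -natrM ler_nat vE leq_addr.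
move: h1 h2'; rewrite E' -(ler_pM2r (P0 (size u))) mulrA => h1 h2'.
rewrite -(ler_pM2r (P0 (wordlen m'))) E' !mulrA => h.
have : ((wordval m').+1%:R : rat) <= (wordval m')%:R.
  apply: le_trans h2' _; apply: le_trans h _; apply: le_trans h1 _; exact: dn.
by rewrite ler_nat ltnn.
Qed.

(** By minimality the defining inequality fails for a length shorter by one. One factor 2 stems from
    that inequality, the other from the shorter length. *)
Lemma word_cost m : (0 < q m)%N -> (q m * 2 ^ wordlen m <= 2 ^ (d m + c + 2))%N.
Proof.
move=> q0; rewrite /wordlen; case: ex_minnP => -[|l] _ lmin.
  have : weight m <= 1.
    apply: le_trans (start_le1 m.+1); rewrite startS lerDr.
    by rewrite sumr_ge0 // => j _; apply: weight_ge0.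
  rewrite /weight ler_pdivrMr ?ltr0n ?expn_gt0 // mul1r ler_nat muln1 => h.
  by apply: leq_trans h _; rewrite leq_exp2l // leq_addr.
have h : (q m * 2 ^ l < 2 * 2 ^ (d m + c))%N.
  by rewrite ltnNge; apply/negP => h; have := lmin l; rewrite h orbT ltnn => /(_ isT).
rewrite expnS mulnCA addn2 [leqRHS]expnS leq_mul2l /= expnS; exact: ltnW.
Qed.
End Codewords.


(** Supplies the partial function that looks up the index of a codeword and diverges on all other
    inputs. *)
Lemma search_machine (p : nat -> nat -> bool) (g : nat -> nat) :
  Comp2 p -> computable1 g -> exists e, forall x y,
    eval e [:: x] y <->
    exists m, [/\ p m x, forall m', (m' < m)%N -> ~~ p m' x & y = g m].
Proof.
move=> cp [eg Hg]; pose f m x := if p m x then 0%N else 1%N.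
have [ef Hf] : computable2 f.
  have [h Hh hE] : computable (fun a : nat * nat => f a.1 a.2) by rewrite /f; comp_auto.
  have H := computable1_app2 Hh computable2_pair.
  apply: eq_computable2 H => m x; apply: (hE _ (m, x)).
  by split; rewrite /= ?fstc_pairc ?sndc_pairc.
exists (RComp eg [:: RMu ef]) => x y; split.
  move=> H; inversion H as [| | |e' gs v ws y' Hws Hy| | |]; subst.
  inversion Hws as [|e' gs v m ws' Hm Hnil]; subst; inversion Hnil; subst.
  inversion Hm as [| | | | | |e' v m' H0 Hlt]; subst.
  exists m; split.
  - by have := eval_inj H0 (Hf m x); rewrite /f; case: ifP.
  - move=> m' /Hlt[k Hk]; have := eval_inj Hk (Hf m' x); rewrite /f.
    by case: ifP.
  - exact: eval_inj Hy (Hg m).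
move=> [m [pm pmin ->]]; apply: (@evComp _ _ _ [:: m]) => //.
apply: evsCons; last exact: evsNil.
apply: evMu => [|m' /pmin pm'].
  by have := Hf m x; rewrite /f pm.
by exists 0%N; have := Hf m' x; rewrite /f (negbTE pm').
Qed.

(** * Normalised frames *)

Section Normalised.
Variables (R : realType) (D : nat).
Local Notation C := (R[i]).

Lemma orthonormal_seq (L : seq 'cV[C]_D) :
  all (fun u => cdot u u == 1) L -> pairwise (fun u v => cdot u v == 0) L ->
  uniq L /\ Defs.orthonormal L.
Proof.
elim: L => [|w L IH] /=; first by split.
move=> /andP[/eqP w1 a1] /andP[/allP wL pL]; have [uL oL] := IH a1 pL.
have wn : w \notin L.
  by apply/negP => /wL; rewrite w1 oner_eq0.
split; first by rewrite wn.
have wv v : v \in L -> cdot w v = (w == v)%:R.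
  by move=> vL; rewrite (eqP (wL v vL)); case: eqP => // wv; rewrite wv vL in wn.
move=> u v; rewrite !inE => /orP[/eqP ->|uL'] /orP[/eqP ->|vL].
- by rewrite eqxx w1.
- exact: wv.
- by rewrite -cdot_conj wv // eq_sym rmorph_nat.
- exact: oL.
Qed.

Definition normvec (w : seq gauss) : 'cV[C]_D :=
  \col_i scaleC R (nth 0 w i) (gnorm2 D w).

Lemma normvecE w : 0 < gnorm2 D w ->
  normvec w = ((Num.sqrt (ratr (gnorm2 D w) : R))^-1)%:C%C *: gvec R D w.
Proof.
move=> w0; apply/matrixP => i j; rewrite !mxE /scaleC /posq w0 mulrC.
by rewrite -fmorphV.
Qed.

Variable F : seq (seq gauss).
Hypothesis gF : good D F.

Lemma normvec_sqr w : w \in F ->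
  ((Num.sqrt (ratr (gnorm2 D w) : R))^-1)%:C%C * ((Num.sqrt (ratr (gnorm2 D w)))^-1)%:C%C =
  (cdot (gvec R D w) (gvec R D w))^-1 :> C.
Proof.
move=> wF; have w0 : 0 < gnorm2 D w by case/andP: gF => /allP/(_ w wF).
rewrite cdot_gvec -rmorphM -fmorphV /= -invfM -expr2 sqr_sqrtr //.
by rewrite ler0q ltW.
Qed.

Lemma normvec_orthonormal :
  uniq (map normvec F) /\ Defs.orthonormal (map normvec F).
Proof.
have cr (x : R) : Num.conj x%:C%C = x%:C%C :> C by rewrite conjCE /= oppr0.
have F0 w : w \in F -> 0 < gnorm2 D w by case/andP: gF => /allP h _ /h.
have := gF; rewrite (good_orthogonal R) => /andP[/allP n0 pw]; apply: orthonormal_seq.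
  apply/allP => v /mapP[w wF ->]; rewrite normvecE ?F0 // cdotZl cdotZr cr mulrA.
  by rewrite normvec_sqr // mulVf // cdot_eq0 n0 // map_f.
move: pw; rewrite !pairwise_map => /(pairwiseP [::]) H; apply/(pairwiseP [::]) => i j iF jF ij.
rewrite /= !normvecE ?F0 ?mem_nth // cdotZl cdotZr (eqP (H i j iF jF ij)).
by rewrite !mulr0.
Qed.

Lemma normvec_qform (A : 'M[C]_D) :
  \sum_(v <- map normvec F) qform v A = \tr (A *m proj (map (gvec R D) F)).
Proof.
have cr (x : R) : Num.conj x%:C%C = x%:C%C :> C by rewrite conjCE /= oppr0.
rewrite tr_mul_proj !big_map !big_seq; apply: eq_bigr => w wF.
have w0 : 0 < gnorm2 D w by case/andP: gF => /allP/(_ w wF).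
rewrite -normvec_sqr // normvecE // /qform ctransZ cr -!scalemxAl -scalemxAr.
by rewrite 2!mxE mulrA.
Qed.
End Normalised.

Definition decode_frame (j : nat) : seq (seq gauss) * nat :=
  decode_pair (decode_seq (decode_seq decode_gauss)) id j.
#[global] Instance comp_decode_frame : Comp1 decode_frame := computable_decode.

(** * The machine that describes the projections of a test *)

Section ComplexityToRandom.
Variable R : realType.
Local Notation C := (R[i]).

Lemma dec_list_normvec D (F : seq (seq gauss)) (c : nat) :
  rep c [seq [seq scaleC R (nth 0 w i) (gnorm2 D w) | i <- iota 0 D] | w <- F] ->
  dec_list c (map (@normvec R D) F).
Proof.
move=> H; split; first by rewrite (rep_seq_size H) !size_map.
move=> i; rewrite size_map => iF; have := rep_seq_nth [::] H; move=> /(_ i).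
rewrite size_map iF (nth_map [::]) // => /(_ isT) Hi; rewrite (nth_map [::]) //.
have sD := rep_seq_size Hi; rewrite size_map size_iota in sD; split => // j.
have := rep_seq_nth 0 Hi; move=> /(_ j); rewrite size_map size_iota ltn_ord => /(_ isT).
by rewrite (nth_map 0%N) ?size_iota // nth_iota // add0n mxE.
Qed.

Lemma complexity_random (U : machine) (rho : forall n, 'M[C]_(2 ^ n)) :
  universal_prefix_free U -> (forall n, density_matrix (rho n)) ->
  (forall eps c : R, 0 < eps -> 0 < c -> exists n0 : nat, forall n, (n0 <= n)%N ->
    ((n%:R + c)%:E <= QK U eps (rho n))%E) ->
  weak_solovay_random rho.
Proof.
move=> [_ univ] drho HQ d S [[e He] [spS [B HB]]] eps eps0 fail.
have [K HK] := choice He.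
have cK : Comp1 K by apply: comp1_nat; exists e => x; case: (HK x).
have dK m : nth 0%N (dec (K m)) 0 = d m by case: (HK m) => _ [].
have cd : computable d.
  apply: (@eq_computable _ _ _ _ (fun m => nth 0%N (dec (K m)) 0)) => //.
  by comp_auto.
have eps2 : 0 < eps / 2 by rewrite divr_gt0.
have [s hs] := ex_pow2_small eps2.
(* Existence rests on a basis that is not computed; the frame used below is the first one accepted
   by a search, hence computable. *)
have exF m : exists j, represents s (K m) (decode_frame j).1 (decode_frame j).2.
  have [_ kS] := HK m; have [hS [iS _]] := spS m.
  have [F [N rF]] := represents_complete s kS hS iS.
  have [j jE] := decode_surj (decode := decode_frame) (F, N).
  by exists j; rewrite jE.
pose F m := (decode_frame (ex_minn (exF m))).1.
have rF m : exists N, represents s (K m) (F m) N.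
  by rewrite /F; case: ex_minnP => j rj _; exists (decode_frame j).2.
have cF : computable F.
  have cmin : Comp1 (fun m => ex_minn (exF m)).
    by apply: computable_ex_minn; [move=> x; exists x|comp_auto].
  by rewrite /F; apply: computable_fst; exact: (computable_comp comp_decode_frame cmin).
have gF m : good (2 ^ d m) (F m).
  by have [N rN] := rF m; exact: (represents_good (HK m).2 rN).
have trS m : \tr (S m) = (size (F m))%:R.
  have [N rN] := rF m; have [hS [iS _]] := spS m.
  exact: (represents_trace (HK m).2 hS iS rN).
pose q m := size (F m).
have cq : computable q.
  by have cF' : Comp1 F by []; rewrite /q; comp_auto.
(* As B < c <= 2^c, the traces scaled by 2^-c add up to at most 1. *)
have [c hc] := ex_natr_gt B.
have start1 m : start q d c m <= 1.
  rewrite /start -(ler_rat C) rmorph1 raddf_sum /= sum_iota.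
  have c0 : (0 : C) < (2 ^ c)%N%:R by rewrite ltr0n expn_gt0.
  rewrite -(ler_pM2r c0) mul1r mulr_suml.
  have -> : \sum_(i < m) ratr (weight q d c i) * (2 ^ c)%N%:R = \sum_(i < m) tau_mx (S i) :> C.
    apply: eq_bigr => i _; rewrite /tau_mx trS /weight fmorph_div /= !ratr_nat.
    by rewrite expnD natrM invfM mulrA mulfVK // gt_eqF.
  apply: le_trans (HB m) _; apply: le_trans (_ : (c%:R : R)%:C%C <= _).
    by rewrite lecR ltW.
  by rewrite rmorph_nat ler_nat ltnW // ltn_expl.
have wd := computable_word cq cd start1.
pose out m := [seq [seq scaleC R (nth 0 w i) (gnorm2 (2 ^ d m) w)
                   | i <- iota 0 (2 ^ d m)] | w <- F m].
have [g cg gE] : computable out.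
  have cF' : Comp1 F by []. have cd' : Comp1 d by [].
  by rewrite /out; comp_auto.
pose p m x := (0 < q m)%N && (word start1 m == x).
have cp : Comp2 p.
  have wd' : Comp1 (word start1) by []. have cq' : Comp1 q by [].
  by rewrite /p; comp_auto.
have [e' He'] := search_machine cp cg.
pose M : machine := fun x y => eval e' [:: code_bits x] y.
have pfM : prefix_free_machine M.
  split; first by exists e'.
  move=> x y u v /He'[m [/andP[qm /eqP mx] _ _]] /He'[m' [/andP[qm' /eqP mx'] _ _]] xy.
  apply: code_bits_inj; rewrite -mx -mx'.
  by rewrite (word_prefix qm qm' (esym mx) (esym mx') xy).
have [r Hr] := univ M pfM.
have big m : realC eps < state_val rho (S m) ->
    realC (eps / 2) < \tr (rho (d m) *m proj (map (gvec R (2 ^ d m)) (F m))).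
  have [N rN] := rF m; have := represents_state (HK m).2 (drho (d m)) rN.
  rewrite /state_val; move: (\tr (rho (d m) *m S m)) => a.
  have : 0 <= \tr (rho (d m) *m proj (map (gvec R (2 ^ d m)) (F m))).
    rewrite tr_mul_proj sumr_ge0 // => w _.
    by rewrite mulr_ge0 ?invr_ge0 ?cdot_ge0 ?(qform_ge0 (drho (d m))).
  move: (\tr _) => b; case: a b => a1 a2 [b1 b2].
  rewrite lecE !ltcE /n1 /= => /andP[/eqP -> _] h /andP[_ ha]; rewrite eqxx /=.
  have := ler_norm (a1 - b1); have := normr_ge0 (a2 - 0); lra.
have qpos m : realC eps < state_val rho (S m) -> (0 < q m)%N.
  move/big; rewrite lt0n; apply: contraTneq => /size0nil ->.
  rewrite /= /proj big_nil mulmx0 mxtrace0 -(rmorph0 (real_complex R)) ltcR.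
  by rewrite -leNgt ltW.
(* If all failures occurred below dimension [n0], each would add at least 2^-(n0 + c) to the partial
   sums of the weights, which stay below 1. *)
have unbounded n0 : exists m, (n0 <= d m)%N /\ realC eps < state_val rho (S m).
  apply: contrapT => /forallNP small.
  have {}small m : realC eps < state_val rho (S m) -> (d m < n0)%N.
    by move=> h; rewrite ltnNge; apply/negP => h'; apply: (small m).
  have P0 n : (0 : rat) < (2 ^ n)%N%:R by rewrite ltr0n expn_gt0.
  have grow k : exists N, k%:R / (2 ^ (n0 + c))%N%:R <= start q d c N.
    elim: k => [|k [N HN]]; first by exists 0%N; rewrite mul0r /start big_nil.
    have [m [Nm /[dup] /qpos qm /small dm]] := fail N; exists m.+1.
    rewrite startS -natr1 mulrDl; apply: lerD.
      by apply: le_trans HN _; apply: start_mono.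
    rewrite /weight; apply: ler_pM; rewrite ?ler1n // ?invr_ge0 //.
    by rewrite lef_pV2 ?posrE // ler_nat leq_exp2l // leq_add2r ltnW.
  have [N HN] := grow (2 ^ (n0 + c)).+1; have := le_trans HN (start1 N).
  by rewrite ler_pdivrMr // mul1r ler_nat ltnn.
(* The translation prefix [r] and [word_cost] give complexity at most [size r + d m + c + 2]; the 3
   makes the contradiction strict. *)
have [|n0 Hn0] := HQ (eps / 2) ((size r)%:R + c%:R + 3) eps2.
  by rewrite ltr_wpDl // addr_ge0.
have [m [dm fm]] := unbounded n0; have qm := qpos m fm.
have [x xE] := code_bits_surj (word start1 m).
have Ux : U (r ++ x) (g m).
  (* No smaller index can stop the search, since different indices have different codewords. *)
  apply/Hr/He'; exists m; split => //; first by rewrite /p qm xE eqxx.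
  move=> m' m'm; apply/negP => /andP[qm' /eqP E]; rewrite xE in E.
  have xE' : code_bits x = word start1 m' by rewrite E.
  by move: m'm; rewrite (word_prefix qm' qm xE' xE (prefix_refl x)) ltnn.
have [uL oL] := normvec_orthonormal R (gF m).
have := Hn0 _ dm; apply/negP; rewrite -ltNge.
apply: le_lt_trans (_ : (((size (r ++ x))%:R + log2 (q m)%:R)%:E < _)%E).
  apply: ereal_inf_lbound; exists (r ++ x), (g m), (map (@normvec R (2 ^ d m)) (F m)).
  split => //; split; first exact: dec_list_normvec (gE m m erefl).
  rewrite undup_id //; split => //; split; last by rewrite size_map.
  by rewrite normvec_qform //; apply: big.
rewrite lte_fin size_cat natrD -addrA.
have [sx _] := word_size qm xE.
have : (size x)%:R + log2 (q m)%:R <= (d m + c + 2)%N%:R :> R.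
  rewrite log2_shift // -(log2_pow2 R (d m + c + 2)) log2_le ?muln_gt0 ?qm ?expn_gt0 // sx.
  exact: word_cost.
by rewrite !natrD; lra.
Qed.
End ComplexityToRandom.

Theorem mainTheorem8 (R : realType) (U : machine)
  (hU : universal_prefix_free U)
  (rho : forall n : nat, 'M[R[i]]_(2 ^ n)) (hrho : is_state rho) :
  weak_solovay_random rho <->
  (forall eps c : R, 0 < eps -> 0 < c ->
     exists n0 : nat, forall n : nat, (n0 <= n)%N ->
       ((n%:R + c)%:E <= QK U eps (rho n))%E).
Proof.
case: hrho => drho _; split; first exact: (random_complexity hU.1 drho).
exact: complexity_random.
Qed.
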